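(* Let $\mathfrak g=\mathfrak l\oplus\mathfrak u$ be a Lie algebra with a splitting, and let $t\in S^2(\mathfrak g)^{\mathfrak g}$ decompose as $t=t_{\mathfrak l}+t_{\mathfrak u}$ with $t_{\mathfrak l}\in S^2(\mathfrak l)$, $t_{\mathfrak u}\in S^2(\mathfrak u)$. Let $C\in\mathrm{End}(\mathfrak u)$ be a Cayley endomorphism such that $(C\otimes\mathrm{id}+\mathrm{id}\otimes C)(t_{\mathfrak u})=0$, and let $c\in\mathbb C$. For $\lambda\in\mathfrak l^*$ set $\lambda^\vee=(\lambda\otimes\mathrm{id})(t_{\mathfrak l})$ and $$\rho_{C,c}(\lambda):=\big(c\,f(c\,\mathrm{ad}(\lambda^\vee))\otimes\mathrm{id}\big)(t_{\mathfrak l})+i\pi c\Big(\frac{C+i\tan(\pi c\,\mathrm{ad}(\lambda^\vee))}{1+i\tan(\pi c\,\mathrm{ad}(\lambda^\vee))\,C}\otimes\mathrm{id}\Big)(t_{\mathfrak u}),\qquad f(x)=-\frac1x+\pi\cot(\pi x).$$ Then $\rho_{C,c}$ is an $\mathfrak l$-invariant (formal) function $\mathfrak l^*\to\wedge^2(\mathfrak g)$ satisfying $$\mathrm{CYB}(\rho_{C,c})+\mathrm{Alt}(\mathrm d\rho_{C,c})=-\pi^2c^2Z,\qquad Z=[t^{1,2},t^{2,3}].$$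
   Context: All Lie algebras are finite dimensional over $\mathbb C$. Lie algebra with a splitting: $\mathfrak g=\mathfrak l\oplus\mathfrak u$, $\mathfrak l$ a Lie subalgebra and $[\mathfrak l,\mathfrak u]\subset\mathfrak u$. For $x\in\mathfrak g$, $x_{\mathfrak u}$ is the projection to $\mathfrak u$ along $\mathfrak l$. $C\in\mathrm{End}(\mathfrak u)$ is a Cayley endomorphism if it is an $\mathfrak l$-module endomorphism and, for all $x,y\in\mathfrak u$, $[C(x),C(y)]_{\mathfrak u}=C([C(x),y]_{\mathfrak u})+C([x,C(y)]_{\mathfrak u})-[x,y]_{\mathfrak u}$. $C$ commutes with $\mathrm{ad}(\lambda^\vee)_{|\mathfrak u}$, and the quotient is understood as an $\mathrm{End}(\mathfrak u)$-valued formal function of $\lambda$ near $0$ (the denominator is the identity at $\lambda=0$). Formal functions are elements of $\wedge^2(\mathfrak g)\otimes\widehat S^\cdot(\mathfrak l)$, $\widehat S^\cdot$ being the completed symmetric algebra. $\mathrm{CYB}(\rho)=[\rho^{1,2},\rho^{1,3}]+[\rho^{1,2},\rho^{2,3}]+[\rho^{1,3},\rho^{2,3}]$; $\mathrm d(x\otimes y\otimes z_1\cdots z_l)=\sum_ix\otimes y\otimes z_i\otimes z_1\cdots\check z_i\cdots z_l$; $\mathrm{Alt}(\xi\otimes g)=(\xi+\xi^{2,3,1}+\xi^{3,1,2})\otimes g$ for $\xi\in\mathfrak g^{\otimes3}$ antisymmetric in two tensor factors. *)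

(* Defs.v *)
From HB Require Import structures.
From mathcomp Require Import all_boot all_order all_algebra.
From mathcomp Require Import mpoly.
From mathcomp Require Import complex.
From mathcomp Require Import reals.
From mathcomp Require trigo.

Set Implicit Arguments.
Unset Strict Implicit.
Unset Printing Implicit Defensive.

Import GRing.Theory.
Local Open Scope ring_scope.

Section LieAlgebras.
Variables (K : fieldType) (g : vectType K).

Record lie_bracket (br : g -> g -> g) : Prop := LieBracket {
  lie_linl : forall (a : K) (x y z : g),
    br (a *: x + y) z = a *: br x z + br y z;
  lie_linr : forall (a : K) (x y z : g),
    br z (a *: x + y) = a *: br z x + br z y;
  lie_alt : forall x : g, br x x = 0;
  lie_jacobi : forall x y z : g,
    br x (br y z) + br y (br z x) + br z (br x y) = 0 }.

Record lie_splitting (br : g -> g -> g) (l u : {vspace g}) : Prop :=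
  LieSplitting {
    split_add : (l + u)%VS = fullv;
    split_cap : (l :&: u)%VS = 0%VS;
    split_ll : forall x y, x \in l -> y \in l -> br x y \in l;
    split_lu : forall x y, x \in l -> y \in u -> br x y \in u }.

(** The projection of [g] onto [U] along [V], when [g] is the direct sum of
    [U] and [V], with values in [U] seen as a vector space. *)
Definition proj_along (U V : {vspace g}) (x : g) : subvs_of U :=
  vsproj U (daddv_pi U V x).

(** The action [x, y |-> [x, y]] of [l] on [u]; when [(l, u)] is a splitting,
    [br x y] is already in [u] and the projection only changes its type. *)
Definition ad_u (br : g -> g -> g) (l u : {vspace g})
    (x : subvs_of l) (y : subvs_of u) : subvs_of u :=
  proj_along u l (br (vsval x) (vsval y)).

Definition ad_l (br : g -> g -> g) (l u : {vspace g})
    (x y : subvs_of l) : subvs_of l :=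
  proj_along l u (br (vsval x) (vsval y)).

Record cayley_endo (br : g -> g -> g) (l u : {vspace g})
    (C : 'End(subvs_of u)) : Prop := CayleyEndo {
  cayley_lmod : forall (x : subvs_of l) (y : subvs_of u),
    C (ad_u br x y) = ad_u br x (C y);
  cayley_eq : forall x y : subvs_of u,
    let bru (a b : subvs_of u) := proj_along u l (br (vsval a) (vsval b)) in
    bru (C x) (C y) = C (bru (C x) y) + C (bru x (C y)) - bru x y }.

End LieAlgebras.

(** [V (x) W (x) A], for [A] a commutative [K]-algebra, is the type of matrices
    ['M[A]_(\dim {:V}, \dim {:W})], the entry [(i, j)] being the coefficient of
    [bvec V i (x) bvec W j]; so an element of [g (x) g] is in [S^2(g)]
    (resp. [wedge^2(g)]) iff its matrix is equal to (resp. is the opposite of)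
    its transpose. *)

Section Tensors.
Variable K : fieldType.

Definition bvec (V : vectType K) (i : 'I_(\dim {:V})) : V :=
  (vbasis {:V})`_i.

Definition crd (V : vectType K) (i : 'I_(\dim {:V})) (x : V) : K :=
  coord (vbasis {:V}) i x.

(** Column convention: [mx_of (f \o h) = mx_of f *m mx_of h], and
    [(f (x) h)(t)] is [mx_of f *m t *m (mx_of h)^T]. *)
Definition mx_of (V W : vectType K) (f : V -> W) :
    'M[K]_(\dim {:W}, \dim {:V}) :=
  \matrix_(i, j) crd i (f (bvec j)).

Definition tmap2 (V W : vectType K) (f : V -> W) (t : 'M[K]_(\dim {:V})) :
    'M[K]_(\dim {:W}) :=
  mx_of f *m t *m (mx_of f)^T.

(** [(f (x) id + id (x) f)(t)] *)
Definition tder2 (V : vectType K) (f : V -> V) (t : 'M[K]_(\dim {:V})) :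
    'M[K]_(\dim {:V}) :=
  mx_of f *m t + t *m (mx_of f)^T.

End Tensors.

Section FormalSeries.
Variable A : pzRingType.

Definition fps := nat -> A.

Definition fps_const (a : A) : fps := fun k => if k == 0%N then a else 0.

Definition fps_add (F G : fps) : fps := fun k => F k + G k.

Definition fps_sub (F G : fps) : fps := fun k => F k - G k.

Definition fps_mul (F G : fps) : fps :=
  fun k => \sum_(i < k.+1) F i * G (k - i)%N.

Definition fps_exp (F : fps) (n : nat) : fps :=
  iter n (fps_mul F) (fps_const 1).

(** The inverse of a series with constant term [1], by the geometric series
    [\sum_j (1 - F)^j]; as [1 - F] has no constant term, only the [j <= k]
    contribute in degree [k]. *)
Definition fps_inv (F : fps) : fps :=
  fun k => \sum_(j < k.+1) fps_exp (fps_sub (fps_const 1) F) j k.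

End FormalSeries.

Section TrigonometricSeries.
Variable K : fieldType.

Definition sin_fps : fps K :=
  fun k => if odd k then (-1) ^+ k./2 / (k`!)%:R else 0.

Definition cos_fps : fps K :=
  fun k => if odd k then 0 else (-1) ^+ k./2 / (k`!)%:R.

Definition tan_fps : fps K := fps_mul sin_fps (fps_inv cos_fps).

(** [sin y / y] *)
Definition sinc_fps : fps K := fun k => sin_fps k.+1.

(** [cot y - 1 / y = ((cos y - sin y / y) / y) / (sin y / y)] *)
Definition cot_reg_fps : fps K :=
  fps_mul (fun k => cos_fps k.+1 - sinc_fps k.+1) (fps_inv sinc_fps).

End TrigonometricSeries.

(** [S(l)] is the polynomial ring on the basis of [l], the variable ['X_i]
    being the basis vector [bvec L i], and its completion is the product of the
    [S^k(l)]. A formal function with values in [V (x) W] is thus a sequence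
    of matrices over [S(l)] whose [k]-th term has its entries in [S^k(l)], as
    expressed by [formal_fun]; products are those of [fps]. *)

Section FormalFunctions.
Variables (K : fieldType) (L : vectType K).

Definition sym := {mpoly K[\dim {:L}]}.

Definition symC (c : K) : sym := mpolyC _ c.

Definition mxC (p q : nat) (M : 'M[K]_(p, q)) : 'M[sym]_(p, q) :=
  map_mx symC M.

Definition formal_fun (p q : nat) (F : nat -> 'M[sym]_(p, q)) : Prop :=
  forall k i j, F k i j \is k.-homog.

(** [L] as [S^1(L)] *)
Definition sym1 (x : L) : sym := \sum_i crd i x *: 'X_i.

(** The derivation of [S(L)] which extends [D : L -> L] *)
Definition sym_der (D : L -> L) (p : sym) : sym :=
  \sum_i sym1 (D (bvec i)) * mderiv i p.

(** The [i]-th coordinate of [lambda^vee = (lambda (x) id)(tl)], an element of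
    [S^1(L)] since it is linear in [lambda] *)
Definition lam_vee (tl : 'M[K]_(\dim {:L})) (i : 'I_(\dim {:L})) : sym :=
  \sum_j tl j i *: 'X_j.

(** The action of [lambda^vee] on [V], as an element of [End(V) (x) S^1(L)],
    when [L] acts on [V] by [act] *)
Definition act_lam_vee (V : vectType K) (act : L -> V -> V)
    (tl : 'M[K]_(\dim {:L})) : 'M[sym]_(\dim {:V}) :=
  \sum_i lam_vee tl i *: mxC (mx_of (act (bvec i))).

(** [phi(X)] for [X] in [End(V) (x) S^1(L)] *)
Definition fps_subst (n : nat) (phi : fps K) (X : 'M[sym]_n) : fps 'M[sym]_n :=
  fun k => symC (phi k) *: X ^+ k.

End FormalFunctions.

Section Dynamical.
Variables (K : fieldType) (g : vectType K) (br : g -> g -> g).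

Notation n := (\dim {:g}).

Definition str_cst (a i j : 'I_n) : K := crd a (br (bvec i) (bvec j)).

Section Coefficients.
Variables (l : {vspace g}).

Notation S := (sym (subvs_of l)).

(** [g (x) g (x) g (x) S(l)] *)
Definition tens3 := 'I_n -> 'I_n -> 'I_n -> S.

(** [[A^{1,2}, B^{1,3}]], [[A^{1,2}, B^{2,3}]] and [[A^{1,3}, B^{2,3}]] *)
Definition br_12_13 (A B : 'M[S]_n) : tens3 := fun a b c =>
  \sum_i \sum_j str_cst a i j *: (A i b * B j c).

Definition br_12_23 (A B : 'M[S]_n) : tens3 := fun a b c =>
  \sum_i \sum_j str_cst b i j *: (A a i * B j c).

Definition br_13_23 (A B : 'M[S]_n) : tens3 := fun a b c =>
  \sum_i \sum_j str_cst c i j *: (A a i * B b j).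

(** [k] is the degree in the symmetric algebra. *)
Definition CYB (rho : nat -> 'M[S]_n) (k : nat) : tens3 := fun a b c =>
  \sum_(i < k.+1) (br_12_13 (rho i) (rho (k - i)%N) a b c
                   + br_12_23 (rho i) (rho (k - i)%N) a b c
                   + br_13_23 (rho i) (rho (k - i)%N) a b c).

(** [d] lowers the degree in the symmetric algebra by one. *)
Definition dform (rho : nat -> 'M[S]_n) (k : nat) : tens3 := fun a b c =>
  \sum_i crd c (vsval (bvec i)) *: mderiv i (rho k.+1 a b).

(** [(x (x) y (x) z)^{2,3,1} = z (x) x (x) y] and
    [(x (x) y (x) z)^{3,1,2} = y (x) z (x) x] *)
Definition Alt (xi : tens3) : tens3 := fun a b c =>
  xi a b c + xi b c a + xi c a b.

End Coefficients.

(** [S^2(g)^g] *)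
Definition inv_sym2 (t : 'M[K]_n) : Prop :=
  t^T = t /\ forall x : g, tder2 (br x) t = 0.

Section Invariance.
Variables l u : {vspace g}.

(** Invariance under [l], which acts on [g (x) g] and on [S(l)] by the adjoint
    action *)
Definition l_invariant (rho : nat -> 'M[sym (subvs_of l)]_n) : Prop :=
  forall (z : subvs_of l) (k : nat),
    mxC _ (mx_of (br (vsval z))) *m rho k
    + rho k *m (mxC _ (mx_of (br (vsval z))))^T
    + map_mx (sym_der (ad_l br u z)) (rho k) = 0.

End Invariance.

End Dynamical.

Section RMatrix.
Variables (R : realType) (g : vectType R[i]) (br : g -> g -> g).
Variables (l u : {vspace g}).
Variables (tl : 'M[R[i]]_(\dim {:subvs_of l})).
Variables (tu : 'M[R[i]]_(\dim {:subvs_of u})).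
Variables (C : 'End(subvs_of u)) (c : R[i]).

Notation L := (subvs_of l).
Notation U := (subvs_of u).

Definition piC : R[i] := (@trigo.pi R)%:C%C.

(** [f(x) = - 1 / x + pi cot(pi x)] *)
Definition f_fps : fps R[i] := fun k => piC ^+ k.+1 * cot_reg_fps R[i] k.

Definition ad_lam_vee_g : 'M[sym L]_(\dim {:g}) :=
  act_lam_vee (fun (x : L) (y : g) => br (vsval x) y) tl.

Definition ad_lam_vee_u : 'M[sym L]_(\dim {:U}) :=
  act_lam_vee (fun (x : L) (y : U) => ad_u br x y) tl.

(** [c f(c ad(lambda^vee))] *)
Definition cf_ad : fps 'M[sym L]_(\dim {:g}) :=
  fun k => symC L c *: fps_subst f_fps (symC L c *: ad_lam_vee_g) k.

(** [i tan(pi c ad(lambda^vee))] *)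
Definition itan_ad : fps 'M[sym L]_(\dim {:U}) :=
  fun k => symC L 'i%C *:
    fps_subst (tan_fps R[i]) (symC L (piC * c) *: ad_lam_vee_u) k.

Definition C_fps : fps 'M[sym L]_(\dim {:U}) := fps_const (mxC L (mx_of C)).

(** [(C + i tan(pi c ad(lambda^vee))) / (1 + i tan(pi c ad(lambda^vee)) C)] *)
Definition cayley_quotient : fps 'M[sym L]_(\dim {:U}) :=
  fps_mul (fps_add C_fps itan_ad)
          (fps_inv (fps_add (fps_const 1) (fps_mul itan_ad C_fps))).

Definition rho_Cc (k : nat) : 'M[sym L]_(\dim {:g}) :=
  cf_ad k *m mxC L (tmap2 (vsval : L -> g) tl)
  + symC L ('i%C * piC * c) *:
    (mxC L (mx_of (vsval : U -> g)) *m (cayley_quotient k *m mxC L tu)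
     *m (mxC L (mx_of (vsval : U -> g)))^T).

End RMatrix.

(* Main.v *)
Require Import Defs.
From HB Require Import structures.
From mathcomp Require Import all_boot all_order all_algebra.
From mathcomp Require Import mpoly.
From mathcomp Require Import complex.
From mathcomp Require Import reals.
From mathcomp Require trigo.
From mathcomp Require boolp.
From mathcomp Require Import ssrcomplements ring.

Set Implicit Arguments.
Unset Strict Implicit.
Unset Printing Implicit Defensive.

Import Order.TTheory GRing.Theory Num.Theory.
Local Open Scope ring_scope.

(** Put [Y = pi c ad(lambda^vee)] and let [Psi] be the endomorphism valued
    series [cot Y - 1 / Y] on [l] and [i (C + i tan Y) / (1 + i tan Y C)] on
    [u], so that [rho = pi c (Psi (x) id)(t)]. As [t] is invariant and [Psi] is
    antisymmetric for [t], every term of the equation is obtained by letting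
    [Y] and [C] act in the three slots of [Z = [t^{1,2}, t^{2,3}]]: writing [A_j]
    for [A] acting in slot [j],
    - [CYB(Psi t) = - (Psi_2 Psi_3 + Psi_1 Psi_3 + Psi_1 Psi_2) Z];
    - the derivative of [Psi] along [l] is the divided difference of [Psi] at
      [Y_1] and [- Y_2].
    Invariance gives [Y_1 + Y_2 + Y_3 = 0] on [Z]. On the components of [Z]
    in [l (x) u (x) u] one has [C_2 + C_3 = 0] because [C] is [l]-linear, on
    [u (x) u (x) u] the Cayley equation reads
    [C_1 C_2 + C_2 C_3 + C_3 C_1 = -1], and the components with exactly two
    factors [l] vanish. On each component the equation thus becomes an identity
    between power series in commuting variables, which is the addition formula
    of the cotangent. Such identities are proved in a polynomial ring, where the
    variables can be cancelled, and then specialized to the slot operators. *)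

(** * The ring of formal power series *)

(** Why the [d rho] term is there: the addition formula of the cotangent holds for the function with
    its pole, while [rho] contains only the regular part. The divided differences coming from
    [d rho] are exactly the missing products with [1 / Y], because their denominator [Y_1 + Y_2] is
    [- Y_3]. Two obstacles shape the argument. First, the relations between the [C_j] hold on single
    components of [Z] only, not on all three-tensors. Hence a polynomial is compared with an
    operator on the orbit of one component, where a relation known at the generating vector
    propagates. Second, the Cayley quotient lives in a noncommutative matrix ring. Each of its
    coefficients is nevertheless a finite ring expression, thanks to the geometric series. So
    transposition, [l]-invariance, restriction to [u] and the action on tensors are all deduced from
    one principle: a relation compatible with the ring operations passes from the arguments of a
    series to its coefficients. *)

Section FpsRing.
Variable A : comNzRingType.
Implicit Types F G H : fps A.

Definition fps0 : fps A := fun=> 0.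
Definition fps_opp F : fps A := fun k => - F k.

Lemma fps_ext F G : (forall k, F k = G k) -> F = G.
Proof. exact: boolp.funext. Qed.

Definition fps_poly (N : nat) F : {poly A} := \poly_(i < N.+1) F i.

(** Truncation lets associativity and commutativity be inherited from [{poly A}], which avoids
    reindexing double sums. *)
Lemma fps_mul_poly N F G k : (k <= N)%N ->
  fps_mul F G k = (fps_poly N F * fps_poly N G)`_k.
Proof.
move=> kN; rewrite coefM /fps_mul; apply: eq_bigr => i _.
rewrite !coef_poly !ltnS (leq_trans (leq_ord i) kN).
by rewrite (leq_trans (leq_subr _ _) kN).
Qed.

Lemma fps_mulA : associative (@fps_mul A).
Proof.
move=> F G H; apply: fps_ext => k.
transitivity ((fps_poly k F * (fps_poly k G * fps_poly k H))`_k).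
  rewrite coefM /fps_mul; apply: eq_bigr => i _.
  rewrite coef_poly ltnS leq_ord; congr (_ * _).
  exact: (fps_mul_poly _ _ (leq_subr _ _)).
rewrite mulrA coefM [RHS]/fps_mul; apply: eq_bigr => i _.
rewrite -fps_mul_poly ?leq_ord // coef_poly ltnS leq_subr //.
Qed.

Lemma fps_mulC : commutative (@fps_mul A).
Proof.
by move=> F G; apply: fps_ext => k; rewrite !(fps_mul_poly _ _ (leqnn k)) mulrC.
Qed.

Lemma fps_mul1 : left_id (fps_const 1) (@fps_mul A).
Proof.
move=> F; apply: fps_ext => k; rewrite /fps_mul big_ord_recl /= subn0 mul1r.
by rewrite big1 ?addr0 // => i _; rewrite /fps_const /= mul0r.
Qed.

Lemma fps_mulDl : left_distributive (@fps_mul A) (@fps_add A).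
Proof.
move=> F G H; apply: fps_ext => k; rewrite /fps_mul /fps_add -big_split /=.
by apply: eq_bigr => i _; rewrite mulrDl.
Qed.

(** The ring hierarchy asks for decidable equality and choice, which infinite sequences have only
    classically. *)
HB.instance Definition _ := boolp.gen_eqMixin (fps A).
HB.instance Definition _ := boolp.gen_choiceMixin (fps A).

Lemma fps_addA : associative (@fps_add A).
Proof. by move=> F G H; apply: fps_ext => k; rewrite /fps_add addrA. Qed.
Lemma fps_addC : commutative (@fps_add A).
Proof. by move=> F G; apply: fps_ext => k; rewrite /fps_add addrC. Qed.
Lemma fps_add0 : left_id fps0 (@fps_add A).
Proof. by move=> F; apply: fps_ext => k; rewrite /fps_add add0r. Qed.
Lemma fps_addN : left_inverse fps0 fps_opp (@fps_add A).
Proof. by move=> F; apply: fps_ext => k; rewrite /fps_add addNr. Qed.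

HB.instance Definition _ :=
  GRing.isZmodule.Build (fps A) fps_addA fps_addC fps_add0 fps_addN.

Lemma fps_oner_neq0 : fps_const 1 != 0 :> fps A.
Proof.
by apply/eqP => /(congr1 (fun F : fps A => F 0%N)) /eqP; rewrite oner_eq0.
Qed.

HB.instance Definition _ := GRing.Zmodule_isComNzRing.Build (fps A)
  fps_mulA fps_mulC fps_mul1 fps_mulDl fps_oner_neq0.

Lemma fpsD F G k : (F + G) k = F k + G k. Proof. by []. Qed.
Lemma fpsN F k : (- F) k = - F k. Proof. by []. Qed.
Lemma fpsB F G k : (F - G) k = F k - G k. Proof. by []. Qed.
Lemma fpsM F G k : (F * G) k = \sum_(i < k.+1) F i * G (k - i)%N.
Proof. by []. Qed.
Lemma fps1 k : (1 : fps A) k = (k == 0%N)%:R.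
Proof. by rewrite /GRing.one /= /fps_const; case: eqP. Qed.

Lemma fps_mulE F G : fps_mul F G = F * G. Proof. by []. Qed.
Lemma fps_addE F G : fps_add F G = F + G. Proof. by []. Qed.
Lemma fps_const1E : fps_const 1 = 1 :> fps A. Proof. by []. Qed.

Lemma fps_sum (I : Type) (r : seq I) (P : pred I) (F : I -> fps A) k :
  (\sum_(i <- r | P i) F i) k = \sum_(i <- r | P i) F i k.
Proof. by elim/big_rec2: _ => // i _ y _ <-. Qed.

Lemma fps_expE F j : fps_exp F j = F ^+ j.
Proof. by elim: j => [//|j IH]; rewrite exprS -IH. Qed.

Lemma fps_exp_lt F j k : F 0%N = 0 -> (k < j)%N -> (F ^+ j) k = 0.
Proof.
move=> F0; elim: j k => // j IH k; rewrite ltnS => kj.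
rewrite exprS fpsM big1 // => i _.
case: (posnP i) => [-> | i0]; first by rewrite F0 mul0r.
rewrite IH ?mulr0 // ltn_subLR ?leq_ord // (leq_ltn_trans kj) //.
by rewrite -[X in (X < _)%N]add0n ltn_add2r.
Qed.

Lemma fps_mulV F : F 0%N = 1 -> F * fps_inv F = 1.
Proof.
move=> F0; pose N := 1 - F.
have N0 : N 0%N = 0 by rewrite /N fpsB F0 fps1 subrr.
apply: fps_ext => k.
(* [fps_inv] cuts the geometric sum at a bound depending on the degree. Up to degree [k] the common
   bound [k] gives the same coefficients, since [N ^+ j] vanishes below degree [j]; the sum then
   telescopes. *)
have -> : (F * fps_inv F) k = (F * \sum_(j < k.+1) N ^+ j) k.
  rewrite !fpsM; apply: eq_bigr => i _; congr (_ * _).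
  rewrite fps_sum /fps_inv; under eq_bigr do rewrite fps_expE.
  rewrite (big_ord_widen k.+1 (fun j => (N ^+ j) (k - i)%N)) ?ltnS ?leq_subr //.
  rewrite big_mkcond; apply: eq_bigr => j _; rewrite ltnS.
  by case: leqP => // /(fps_exp_lt N0).
have -> : F = 1 - N by rewrite /N opprB addrC subrK.
have : (1 - N) * (\sum_(j < k.+1) N ^+ j) = 1 - N ^+ k.+1.
  by rewrite -opprB mulNr -subrX1 opprB.
by move=> ->; rewrite fpsB (fps_exp_lt N0 (ltnSn k)) subr0.
Qed.

End FpsRing.

(** * Series in one variable *)

Section HomogeneousSeries.
Variables (K : fieldType) (W : pzRingType) (s : K -> W) (I : K).

(** The coefficients are in [W] rather than [K], because those of the Cayley quotient involve
    [gam]. *)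
Definition hom_ser (d : fps W) (x : W) : fps W := fun k => d k * x ^+ k.

Definition fps_sub_at (phi : fps K) (x : W) : fps W :=
  hom_ser (fun k => s (phi k)) x.

Definition itan (x : W) : fps W := fun k => s I * fps_sub_at (tan_fps K) x k.

(** Written over any ring, so that the same formula can be read in matrices over [S(l)] and in a
    polynomial ring, and the two readings compared. *)
Definition cayley_quo (gam x : W) : fps W :=
  fps_mul (fps_add (fps_const gam) (itan x))
    (fps_inv (fps_add (fps_const 1) (fps_mul (itan x) (fps_const gam)))).

(* The derivative of [\sum_k d k Y ^ k] on an invariant tensor: the factors [Y]
   at the right of the derived one act as [- Y] in the next slot. *)
Definition div_diff (d : fps W) (x y : W) : fps W :=
  fun k => d k.+1 * \sum_(a < k.+1) x ^+ (k - a) * y ^+ a.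

End HomogeneousSeries.

Section FpsVar.
Variable A : comNzRingType.
Implicit Types F G H : fps A.

Definition fpsX : fps A := fun k => (k == 1%N)%:R.

Lemma fpsXM F k : (fpsX * F) k = if k is k'.+1 then F k' else 0.
Proof.
case: k => [|k]; first by rewrite fpsM big_ord1 /fpsX mul0r.
rewrite fpsM big_ord_recl [fpsX _]/fpsX mul0r add0r big_ord_recl /=.
rewrite /fpsX /= mul1r big1 ?addr0 /bump /= ?subn1 // => i _.
by rewrite mul0r.
Qed.

Lemma fpsX_inj : injective ( *%R fpsX).
Proof.
move=> F G FG; apply: fps_ext => k.
by have := congr1 (fun H : fps A => H k.+1) FG; rewrite !fpsXM.
Qed.

Lemma fps_constM a F k : (fps_const a * F) k = a * F k.
Proof.
rewrite fpsM big_ord_recl /= subn0 big1 ?addr0 // => i _.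
by rewrite /fps_const /= mul0r.
Qed.

Lemma fps_const_is_additive : additive (@fps_const A).
Proof.
by move=> a b; apply: fps_ext => k; rewrite fpsB /fps_const; case: eqP; rewrite ?subr0.
Qed.

Lemma fps_const_is_multiplicative : monoid_morphism (@fps_const A).
Proof.
split=> // a b; apply: fps_ext => k.
by rewrite fps_constM /fps_const; case: eqP; rewrite ?mulr0.
Qed.

HB.instance Definition _ := GRing.isZmodMorphism.Build A (fps A) (@fps_const A)
  fps_const_is_additive.
HB.instance Definition _ :=
  GRing.isMonoidMorphism.Build A (fps A) (@fps_const A)
  fps_const_is_multiplicative.

Lemma fps_unit_inj F : F 0%N = 1 -> injective ( *%R F).
Proof.
move=> F0 G H /(congr1 ( *%R (fps_inv F))).
by rewrite !mulrA [_ * F]mulrC fps_mulV // !mul1r.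
Qed.

Lemma fps0M F G : (F * G) 0%N = F 0%N * G 0%N.
Proof. by rewrite fpsM big_ord1. Qed.

(** The factor [fpsX] makes up for the degree lost in a divided difference. *)
Lemma div_diffE (d : fps A) x y :
  fpsX * fps_const (x - y) * div_diff d x y = hom_ser d x - hom_ser d y.
Proof.
apply: fps_ext => k; rewrite -mulrA fpsXM fpsB /hom_ser -mulrBr.
case: k => [|k]; first by rewrite !expr0 subrr mulr0.
by rewrite fps_constM /div_diff subrXX mulrCA.
Qed.

End FpsVar.

Lemma fps_const_inj (A : idomainType) (a : A) :
  a != 0 -> injective ( *%R (fps_const a : fps A)).
Proof.
move=> a0 F G FG; apply: fps_ext => k.
have := congr1 (fun H : fps A => H k) FG; rewrite !fps_constM.
exact: mulfI.
Qed.

Section Substitution.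
Variables (K : fieldType) (A : comNzRingType) (s : {rmorphism K -> A}).
Implicit Types (phi chi : fps K) (x y : A).

Local Notation sub := (fps_sub_at s).

Lemma fps_sub_atM phi chi x : sub (phi * chi) x = sub phi x * sub chi x.
Proof.
apply: fps_ext => k; rewrite /fps_sub_at /hom_ser !fpsM rmorph_sum mulr_suml.
apply: eq_bigr => i _; rewrite rmorphM /= mulrACA -exprD subnKC //.
by rewrite -ltnS.
Qed.

Lemma fps_sub_atD phi chi x : sub (phi + chi) x = sub phi x + sub chi x.
Proof.
by apply: fps_ext => k; rewrite /fps_sub_at /hom_ser !fpsD rmorphD mulrDl.
Qed.

Lemma fps_sub_atB phi chi x : sub (phi - chi) x = sub phi x - sub chi x.
Proof.
by apply: fps_ext => k; rewrite /fps_sub_at /hom_ser !fpsB rmorphB mulrBl.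
Qed.

Lemma fps_sub_at_const a x : sub (fps_const a) x = fps_const (s a).
Proof.
apply: fps_ext => k; rewrite /fps_sub_at /hom_ser /fps_const.
by case: eqP => [->|_]; rewrite ?expr0 ?mulr1 // rmorph0 mul0r.
Qed.

Lemma fps_sub_atX x : sub (fpsX K) x = fpsX A * fps_const x.
Proof.
apply: fps_ext => k; rewrite fpsXM /fps_sub_at /hom_ser /fpsX /fps_const.
case: k => [|[|k]] /=; by rewrite ?rmorph0 ?mul0r ?rmorph1 ?mul1r ?expr1.
Qed.

Lemma fps_sub_at0 phi x : sub phi x 0%N = s (phi 0%N).
Proof. by rewrite /fps_sub_at /hom_ser expr0 mulr1. Qed.

End Substitution.

(** * Trigonometric series *)

Section Trigonometry.
Variables (K : numFieldType) (I : K).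
Hypothesis I2 : I * I = -1.

Lemma cos0 : cos_fps K 0%N = 1.
Proof. by rewrite /cos_fps fact0 /= expr0 divr1. Qed.

Lemma sinc0 : sinc_fps K 0%N = 1.
Proof. by rewrite /sinc_fps /sin_fps /= expr0 divr1. Qed.

Lemma tanM_cos : tan_fps K * cos_fps K = sin_fps K :> fps K.
Proof.
by rewrite /tan_fps fps_mulE -mulrA [fps_inv _ * _]mulrC fps_mulV ?cos0 ?mulr1.
Qed.

Lemma fpsX_sinc : fpsX K * sinc_fps K = sin_fps K.
Proof. by apply: fps_ext => -[|k]; rewrite fpsXM // /sin_fps. Qed.

Lemma cot_regM_sinc :
  fpsX K * (cot_reg_fps K * sinc_fps K) = (cos_fps K : fps K) - sinc_fps K.
Proof.
rewrite /cot_reg_fps fps_mulE -[X in fpsX K * X]mulrA [fps_inv _ * _]mulrC.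
rewrite fps_mulV ?sinc0 // mulr1; apply: fps_ext => k; rewrite fpsXM fpsB.
(* The division by [y] is a shift of indices; it is exact because both constant terms are [1]. *)
by case: k => // ; rewrite cos0 sinc0 subrr.
Qed.

(** The series of [exp(a y)], used at [a = I] and [a = - I]. Its addition law is the binomial
    formula, and the cotangent identities all rest on it. *)
Definition expi_fps (a : K) : fps K := fun k => a ^+ k / k`!%:R.

Lemma cosDsin : expi_fps I = (cos_fps K : fps K) + fps_const I * sin_fps K.
Proof.
apply: fps_ext => k; rewrite fpsD fps_constM /cos_fps /sin_fps /expi_fps.
rewrite -{1}[k]odd_double_half exprD -muln2 mulnC exprM expr2 I2.
case: (odd k); rewrite ?expr1 ?expr0 ?mulr0 ?addr0 ?add0r ?mul1r //.
by rewrite mulrA.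
Qed.

Lemma cosBsin : expi_fps (- I) = (cos_fps K : fps K) - fps_const I * sin_fps K.
Proof.
apply: fps_ext => k; rewrite fpsB fps_constM /cos_fps /sin_fps /expi_fps.
rewrite -{1}[k]odd_double_half exprD -muln2 mulnC exprM expr2 mulrNN I2.
case: (odd k); rewrite ?expr1 ?expr0 ?mulr0 ?subr0 ?sub0r ?mul1r //.
by rewrite -mulrA mulNr.
Qed.

Section InAlgebra.
Variables (A : comNzRingType) (s : {rmorphism K -> A}).
Local Notation sub := (fps_sub_at s).
Local Notation J := (fps_const (s I) : fps A).

Lemma fps_expiD a x y :
  sub (expi_fps a) (x + y) = sub (expi_fps a) x * sub (expi_fps a) y.
Proof.
apply: fps_ext => k; rewrite addrC fpsM /fps_sub_at /hom_ser exprDn mulr_sumr.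
apply: eq_bigr => i _; have ik : (i <= k)%N by rewrite -ltnS.
rewrite [RHS]mulrACA -rmorphM /= -mulr_natr -(rmorph_nat s).
rewrite [X in s _ * X]mulrC [LHS]mulrA -rmorphM [X in _ * X = _]mulrC /=.
congr (s _ * _); rewrite /expi_fps -{1}(subnKC ik) exprD -(bin_fact ik) !natrM.
have f0 m : m`!%:R != 0 :> K by rewrite pnatr_eq0 -lt0n fact_gt0.
have b0 : 'C(k, i)%:R != 0 :> K by rewrite pnatr_eq0 -lt0n bin_gt0.
by field; rewrite !f0 b0.
Qed.

Lemma fps_expi0 a : sub (expi_fps a) 0 = 1.
Proof.
apply: fps_ext => -[|k]; rewrite /fps_sub_at /hom_ser /expi_fps fps1.
  by rewrite fact0 expr0 divr1 rmorph1 mulr1.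
by rewrite expr0n mulr0.
Qed.

Lemma J2 : J * J = -1.
Proof. by rewrite -!rmorphM I2 !rmorphN !rmorph1. Qed.

Lemma expi_sub x : sub (expi_fps I) x = sub (cos_fps K) x + J * sub (sin_fps K) x.
Proof. by rewrite cosDsin fps_sub_atD fps_sub_atM fps_sub_at_const. Qed.

Lemma expNi_sub x :
  sub (expi_fps (- I)) x = sub (cos_fps K) x - J * sub (sin_fps K) x.
Proof. by rewrite cosBsin fps_sub_atB fps_sub_atM fps_sub_at_const. Qed.

Lemma fps_two_inj : injective ( *%R (2 : fps A)).
Proof.
have -> : 2 = fps_const (s 2) :> fps A by rewrite !rmorph_nat.
move=> F G /(congr1 ( *%R (fps_const (s 2^-1)))).
by rewrite !mulrA -!rmorphM mulVf ?pnatr_eq0 // !rmorph1 !mul1r.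
Qed.

(* With [N = p cos + i q sin] and [D = q cos + i p sin] one has
   [N + D = (p + q) exp(i x)] and [N - D = (p - q) exp(- i x)], and the
   exponentials cancel as the arguments add up to [0]. *)
Lemma triple_product (x1 x2 x3 : A) (p1 p2 p3 q1 q2 q3 : fps A) :
  x1 + x2 + x3 = 0 ->
  let N p q x := p * sub (cos_fps K) x + J * (q * sub (sin_fps K) x) in
  N p1 q1 x1 * N p2 q2 x2 * N q3 p3 x3 + N p2 q2 x2 * N p3 q3 x3 * N q1 p1 x1
  + N p3 q3 x3 * N p1 q1 x1 * N q2 p2 x2
  + N q1 p1 x1 * N q2 p2 x2 * N q3 p3 x3
  = p1 * p2 * q3 + p2 * p3 * q1 + p3 * p1 * q2 + q1 * q2 * q3.
Proof.
move=> x0 N; apply: fps_two_inj.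
have E a : sub (expi_fps a) x1 * sub (expi_fps a) x2 * sub (expi_fps a) x3 = 1.
  by rewrite -!fps_expiD x0 fps_expi0.
have := E I; have := E (- I); rewrite !expi_sub !expNi_sub /N.
move: (sub (cos_fps K) _) (sub (cos_fps K) x2) (sub (cos_fps K) x3) => c1 c2 c3.
move: (sub (sin_fps K) _) (sub (sin_fps K) x2) (sub (sin_fps K) x3) => s1 s2 s3.
move=> Em Ep.
(* In the difference of the products of the [N + D] and of the [N - D], only terms with an odd
   number of factors [D] survive, each of them twice: this is the doubled left-hand side. *)
transitivity ((p1 + q1) * (p2 + q2) * (p3 + q3)
                * ((c1 + J * s1) * (c2 + J * s2) * (c3 + J * s3))
  - (p1 - q1) * (p2 - q2) * (p3 - q3)
                * ((c1 - J * s1) * (c2 - J * s2) * (c3 - J * s3))).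
  by ring.
by rewrite Ep Em; ring.
Qed.

End InAlgebra.
End Trigonometry.

(** * Transfer of series along relations *)

Section Transfer.
Variables (W W' : pzRingType) (Rel : W -> W' -> Prop).
Hypotheses (Rel0 : Rel 0 0) (Rel1 : Rel 1 1).
Hypothesis RelD :
  forall a a' b b', Rel a a' -> Rel b b' -> Rel (a + b) (a' + b').
Hypothesis RelN : forall a a', Rel a a' -> Rel (- a) (- a').
Hypothesis RelM :
  forall a a' b b', Rel a a' -> Rel b b' -> Rel (a * b) (a' * b').

Definition fps_rel (F : fps W) (F' : fps W') := forall k, Rel (F k) (F' k).

Lemma rel_sum (J : Type) (r : seq J) (P : pred J) F F' :
  (forall i, P i -> Rel (F i) (F' i)) ->
  Rel (\sum_(i <- r | P i) F i) (\sum_(i <- r | P i) F' i).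
Proof. by move=> FF'; elim/big_rec2: _ => // i x y Pi; apply: RelD; apply: FF'. Qed.

Lemma rel_expr a a' k : Rel a a' -> Rel (a ^+ k) (a' ^+ k).
Proof. by move=> aa'; elim: k => // k IH; rewrite !exprS; apply: RelM. Qed.

Lemma fps_rel_const a a' : Rel a a' -> fps_rel (fps_const a) (fps_const a').
Proof. by move=> aa' k; rewrite /fps_const; case: eqP. Qed.

Lemma fps_rel_add F F' G G' :
  fps_rel F F' -> fps_rel G G' -> fps_rel (fps_add F G) (fps_add F' G').
Proof. by move=> FF' GG' k; apply: RelD. Qed.

Lemma fps_rel_sub F F' G G' :
  fps_rel F F' -> fps_rel G G' -> fps_rel (fps_sub F G) (fps_sub F' G').
Proof. by move=> FF' GG' k; apply: RelD => //; apply: RelN. Qed.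

Lemma fps_rel_mul F F' G G' :
  fps_rel F F' -> fps_rel G G' -> fps_rel (fps_mul F G) (fps_mul F' G').
Proof. by move=> FF' GG' k; apply: rel_sum => i _; apply: RelM. Qed.

Lemma fps_rel_exp F F' j : fps_rel F F' -> fps_rel (fps_exp F j) (fps_exp F' j).
Proof.
move=> FF'; elim: j => [|j IH]; first exact: fps_rel_const.
exact: (fps_rel_mul FF' IH).
Qed.

Lemma fps_rel_inv F F' : fps_rel F F' -> fps_rel (fps_inv F) (fps_inv F').
Proof.
move=> FF' k; apply: rel_sum => j _; apply: fps_rel_exp.
by apply: fps_rel_sub => //; apply: fps_rel_const.
Qed.

Variables (K : fieldType) (s : K -> W) (s' : K -> W') (I : K).
Hypothesis RelS : forall a, Rel (s a) (s' a).

Lemma fps_rel_sub_at phi x x' :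
  Rel x x' -> fps_rel (fps_sub_at s phi x) (fps_sub_at s' phi x').
Proof. by move=> xx' k; apply: RelM => //; apply: rel_expr. Qed.

Lemma fps_rel_itan x x' : Rel x x' -> fps_rel (itan s I x) (itan s' I x').
Proof. by move=> xx' k; apply: RelM => //; apply: fps_rel_sub_at. Qed.

Lemma fps_rel_cayley_quo g g' x x' :
  Rel g g' -> Rel x x' -> fps_rel (cayley_quo s I g x) (cayley_quo s' I g' x').
Proof.
move=> gg' xx'; apply: fps_rel_mul.
  by apply: fps_rel_add; [apply: fps_rel_const | apply: fps_rel_itan].
apply: fps_rel_inv; apply: fps_rel_add; first exact: fps_rel_const.
by apply: fps_rel_mul; [apply: fps_rel_itan | apply: fps_rel_const].
Qed.

End Transfer.

(** * Separating the powers of the variable from the coefficients of a series *)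

Section Homogeneity.
Variables (W : pzRingType) (x : W).
Implicit Types d e : fps W.

Let cx (d : fps W) := forall k, GRing.comm x (d k).

Lemma hom_ser_const a : hom_ser (fps_const a) x = fps_const a.
Proof.
by apply: boolp.funext => k; rewrite /hom_ser /fps_const; case: eqP => [->|_];
   rewrite ?mulr1 ?mul0r.
Qed.

Lemma hom_ser_mul d e : cx e ->
  hom_ser (fps_mul d e) x = fps_mul (hom_ser d x) (hom_ser e x).
Proof.
move=> ce; apply: boolp.funext => k; rewrite /hom_ser /fps_mul mulr_suml.
apply: eq_bigr => i _.
have cei := commrX i (commr_sym (ce (k - i)%N)).
rewrite mulrA -[d i * x ^+ i * e _]mulrA -cei.
by rewrite !mulrA -[RHS]mulrA -exprD subnKC // -ltnS.
Qed.

Lemma hom_ser_exp d j : cx d -> hom_ser (fps_exp d j) x = fps_exp (hom_ser d x) j.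
Proof.
move=> cd; elim: j => [|j IH]; first exact: hom_ser_const.
rewrite [LHS]hom_ser_mul ?IH // => k.
(* The commutant of [x] is a subring, used here as a relation in its first argument only. *)
apply: (@fps_rel_exp W W (fun a _ => GRing.comm x a) _ _ _ _ _ d) => //.
- exact: commr0.
- exact: commr1.
- by move=> a _ b _; apply: commrD.
- by move=> a _ b _; apply: commrM.
Qed.

Lemma hom_ser_inv d : cx d -> hom_ser (fps_inv d) x = fps_inv (hom_ser d x).
Proof.
move=> cd; apply: boolp.funext => k; rewrite /hom_ser /fps_inv mulr_suml.
apply: eq_bigr => j _; rewrite -[LHS]/(hom_ser _ x k) hom_ser_exp.
  congr (fps_exp _ _ _); apply: boolp.funext => i.
  by rewrite /hom_ser /fps_sub mulrBl -[_ * _ ^+ _]/(hom_ser _ x i) hom_ser_const.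
by move=> i; apply: commrB => //; rewrite /fps_const; case: eqP => _;
  [apply: commr1|apply: commr0].
Qed.

Variables (K : fieldType) (s : K -> W) (I : K).
Hypothesis cs : forall a, GRing.comm x (s a).

(** This isolates the power [x ^+ k] in degree [k], the only factor on which a derivation of [S(l)]
    will act. *)
Lemma cayley_quo_hom g : GRing.comm x g ->
  cayley_quo s I g x = hom_ser (cayley_quo s I g 1) x.
Proof.
move=> cg.
have it : hom_ser (itan s I 1) x = itan s I x.
  apply: boolp.funext => k.
  by rewrite /itan /fps_sub_at /hom_ser expr1n mulr1 mulrA.
have ct : cx (itan s I 1).
  by move=> k; rewrite /itan /fps_sub_at /hom_ser expr1n mulr1; apply: commrM.
have cc a : GRing.comm x a -> cx (fps_const a).
  by move=> ca k; rewrite /fps_const; case: eqP => // _; apply: commr0.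
have cm : cx (fps_mul (itan s I 1) (fps_const g)).
  by move=> k; apply: commr_sum => i _; apply: commrM => //; apply: cc.
have hD (d e : fps W) : hom_ser (fps_add d e) x = fps_add (hom_ser d x) (hom_ser e x).
  by apply: boolp.funext => k; rewrite /hom_ser /fps_add mulrDl.
have cD : cx (fps_add (fps_const 1) (fps_mul (itan s I 1) (fps_const g))).
  by move=> k; apply: commrD => //; apply: cc; apply: commr1.
rewrite [in RHS]/cayley_quo hom_ser_mul; last first.
  move=> k.
  apply: (@fps_rel_inv W W (fun a _ => GRing.comm x a) _ _ _ _ _ _ _ cD) => //.
  - exact: commr0.
  - exact: commr1.
  - by move=> a _ b _; apply: commrD.
  - by move=> a _; apply: commrN.
  - by move=> a _ b _; apply: commrM.
rewrite hom_ser_inv // !hD !hom_ser_const it hom_ser_mul; last exact: cc.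
by rewrite it hom_ser_const.
Qed.

End Homogeneity.

Lemma fps_sub_at_opp (K : fieldType) (phi : fps K) :
  fps_sub_at idfun phi (-1) = fun k => if odd k then - phi k else phi k.
Proof.
apply: boolp.funext => k; rewrite /fps_sub_at /hom_ser -signr_odd.
by case: (odd k); rewrite ?mulrN1 ?mulr1.
Qed.

(** * Parity of the trigonometric series and of the Cayley quotient *)

Section Parity.
Variable K : numFieldType.

Local Notation flip phi := (@fps_sub_at K K idfun phi (-1)).

Let flipM (phi chi : fps K) : flip (phi * chi) = (flip phi : fps K) * flip chi.
Proof. exact: (fps_sub_atM idfun). Qed.

Let flipB (phi chi : fps K) : flip (phi - chi) = (flip phi : fps K) - flip chi.
Proof. exact: (fps_sub_atB idfun). Qed.

Let flipX : flip (fpsX K) = - fpsX K.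
Proof. by rewrite (fps_sub_atX idfun) rmorphN rmorph1 mulrN1. Qed.

Lemma sin_flip : flip (sin_fps K) = - (sin_fps K : fps K).
Proof.
rewrite fps_sub_at_opp; apply: fps_ext => k; rewrite fpsN /sin_fps.
by case: (odd k); rewrite ?oppr0.
Qed.

Lemma cos_flip : flip (cos_fps K) = cos_fps K.
Proof.
rewrite fps_sub_at_opp; apply: fps_ext => k; rewrite /cos_fps.
by case: (odd k); rewrite ?oppr0.
Qed.

Lemma sinc_flip : flip (sinc_fps K) = sinc_fps K.
Proof.
rewrite fps_sub_at_opp; apply: fps_ext => k; rewrite /sinc_fps /sin_fps /=.
by case: (odd k); rewrite ?oppr0.
Qed.

(** The substitution [y -> - y] is multiplicative, so the parity of a quotient can be tested after
    multiplying by its denominator. *)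
Lemma tan_flip : flip (tan_fps K) = - (tan_fps K : fps K).
Proof.
apply: (fps_unit_inj (cos0 K)); rewrite mulrN [X in _ = - X]mulrC tanM_cos.
by rewrite -sin_flip -tanM_cos (flipM (tan_fps K) (cos_fps K)) cos_flip mulrC.
Qed.

Lemma cot_reg_flip : flip (cot_reg_fps K) = - (cot_reg_fps K : fps K).
Proof.
apply: (fps_unit_inj (sinc0 K)); apply: fpsX_inj.
rewrite mulrN [X in _ = _ * - X]mulrC mulrN cot_regM_sinc.
rewrite -cos_flip -{2}sinc_flip -flipB -cot_regM_sinc !flipM.
by rewrite flipX sinc_flip mulNr opprK [X in _ * X = _]mulrC.
Qed.

Lemma even_tan k : ~~ odd k -> tan_fps K k = 0.
Proof.
move=> /negPf ek; have := congr1 (fun F : fps K => F k) tan_flip.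
by rewrite fps_sub_at_opp ek fpsN => /eqP; rewrite -addr_eq0 -mulr2n mulrn_eq0 => /eqP.
Qed.

Lemma even_cot_reg k : ~~ odd k -> cot_reg_fps K k = 0.
Proof.
move=> /negPf ek; have := congr1 (fun F : fps K => F k) cot_reg_flip.
by rewrite fps_sub_at_opp ek fpsN => /eqP; rewrite -addr_eq0 -mulr2n mulrn_eq0 => /eqP.
Qed.

Variables (W : pzRingType) (s : K -> W).
Hypothesis s0 : s 0 = 0.

Lemma fps_sub_at_odd phi (x : W) k : (forall j, ~~ odd j -> phi j = 0) ->
  fps_sub_at s phi (- x) k = - fps_sub_at s phi x k.
Proof.
move=> phi_odd; rewrite /fps_sub_at /hom_ser exprNn -signr_odd.
case: (boolP (odd k)) => [_|/phi_odd->]; last by rewrite s0 !mul0r oppr0.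
by rewrite expr1 mulN1r mulrN.
Qed.

(** Changing both signs reverses the numerator and leaves [1 + i tan(x) g] fixed, since the tangent
    is odd. *)
Lemma cayley_quo_odd (I : K) (g x : W) k :
  cayley_quo s I (- g) (- x) k = - cayley_quo s I g x k.
Proof.
have it : itan s I (- x) = fun k => - itan s I x k.
  apply: boolp.funext => i; rewrite /itan fps_sub_at_odd ?mulrN //.
  exact: even_tan.
have cN : fps_const (- g) = fun k => - fps_const g k.
  by apply: boolp.funext => i; rewrite /fps_const; case: eqP; rewrite ?oppr0.
rewrite /cayley_quo it cN /fps_mul -sumrN; apply: eq_bigr => i _.
rewrite -mulNr /fps_add opprD; congr (_ * fps_inv _ _).
apply: boolp.funext => j; congr (_ + _); apply: eq_bigr => a _.
by rewrite mulrNN.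
Qed.

End Parity.

(** * Cotangent identities *)

Section CotangentIdentities.
Variables (K : numFieldType) (I : K) (I2 : I * I = -1).
Variables (A : idomainType) (s : {rmorphism K -> A}).
Local Notation sub := (fps_sub_at s).
Local Notation J := (fps_const (s I) : fps A).
Local Notation X := (fpsX A).
Local Notation cst x := (fps_const x : fps A).
Local Notation ccos x := (sub (cos_fps K) x).
Local Notation csin x := (sub (sin_fps K) x).
Local Notation csinc x := (sub (sinc_fps K) x).
Local Notation ccot x := (sub (cot_reg_fps K) x).
Local Notation quo g x := (cayley_quo s I g x : fps A).

Lemma sub_sin x : csin x = X * cst x * csinc x.
Proof. by rewrite -fpsX_sinc fps_sub_atM fps_sub_atX. Qed.

Lemma sub_cot x : X * cst x * (ccot x * csinc x) = ccos x - csinc x.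
Proof.
by rewrite -fps_sub_atB -cot_regM_sinc !fps_sub_atM fps_sub_atX.
Qed.

Lemma sub_cos0 x : ccos x 0%N = 1.
Proof. by rewrite fps_sub_at0 cos0 rmorph1. Qed.

Lemma sub_sin0 x : csin x 0%N = 0.
Proof. by rewrite fps_sub_at0 /sin_fps rmorph0. Qed.

Lemma sub_sinc0 x : csinc x 0%N = 1.
Proof. by rewrite fps_sub_at0 sinc0 rmorph1. Qed.

Lemma sub_cotN x : ccot (- x) = - ccot x.
Proof.
apply: fps_ext => k; rewrite fpsN fps_sub_at_odd ?rmorph0 //.
exact: even_cot_reg.
Qed.

(** Denominator of the Cayley quotient multiplied by [cos x]. The factor [1] is kept so that it is
    literally [N 1 g x] in [triple_product]; likewise [quo_num] is [N g 1 x]. *)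
Definition quo_den (g x : A) : fps A := 1 * ccos x + J * (cst g * csin x).

Definition quo_num (g x : A) : fps A := cst g * ccos x + J * (1 * csin x).

Lemma quo_den0 g x : quo_den g x 0%N = 1.
Proof. by rewrite /quo_den fpsD !fps0M sub_cos0 sub_sin0 fps1 !mulr0 addr0 mulr1. Qed.

Lemma quoM g x : quo g x * quo_den g x = quo_num g x.
Proof.
have itE : itan s I x = J * sub (tan_fps K) x.
  by apply: fps_ext => k; rewrite fps_constM.
have tc : sub (tan_fps K) x * ccos x = csin x.
  by rewrite -tanM_cos (fps_sub_atM s (tan_fps K) (cos_fps K)).
have -> : quo_den g x = (1 + (itan s I x : fps A) * cst g) * ccos x.
  by rewrite /quo_den itE -tc; ring.
rewrite /cayley_quo !fps_mulE !fps_addE fps_const1E.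
rewrite mulrA -[X in X * _ = _]mulrA [fps_inv _ * _]mulrC fps_mulV.
  by rewrite mulr1 itE /quo_num -tc; ring.
by rewrite fpsD fps0M /itan fps_sub_at0 even_tan // rmorph0 mulr0 mul0r addr0 fps1.
Qed.

Lemma quoN g x : quo (- g) (- x) = - quo g x.
Proof. by apply: fps_ext => k; rewrite cayley_quo_odd ?rmorph0. Qed.

Lemma quo_hom g x : quo g x = hom_ser (cayley_quo s I g 1) x.
Proof. by apply: cayley_quo_hom; [move=> a|]; exact: mulrC. Qed.

(** Over the common denominator, [triple_product] with [p = g] and [q = 1] turns the numerator into
    an expression free of the [x], which is the Cayley relation. *)
Lemma uuu_identity x1 x2 x3 g1 g2 g3 : x1 + x2 + x3 = 0 ->
  quo g1 x1 * quo g2 x2 + quo g2 x2 * quo g3 x3 + quo g3 x3 * quo g1 x1 + 1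
  = cst (g1 * g2 + g2 * g3 + g3 * g1 + 1)
    * fps_inv (quo_den g1 x1 * quo_den g2 x2 * quo_den g3 x3).
Proof.
move=> x0; have := triple_product I2 s (cst g1) (cst g2) (cst g3) 1 1 1 x0.
rewrite /= -!/(quo_num _ _) -!/(quo_den _ _) => T.
set D := _ * _ * quo_den g3 x3.
have D0 : D 0%N = 1 by rewrite /D !fps0M !quo_den0 !mulr1.
apply: (fps_unit_inj D0); rewrite [RHS]mulrCA fps_mulV // mulr1.
transitivity (quo_num g1 x1 * quo_num g2 x2 * quo_den g3 x3
  + quo_num g2 x2 * quo_num g3 x3 * quo_den g1 x1
  + quo_num g3 x3 * quo_num g1 x1 * quo_den g2 x2 + D).
  by rewrite -!quoM /D; ring.
by rewrite T !rmorphD !rmorphM rmorph1; ring.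
Qed.

(** For the slot in [l], [p = 1] and [q = 0] give [cos] over [i sin], that is [- i cot x1] with its
    pole. The divided difference equals [- (quo g x2 + quo (- g) x3) / x1], so it completes
    [ccot x1] to the full cotangent. *)
Lemma luu_identity x1 x2 x3 g : x1 + x2 + x3 = 0 -> x1 != 0 ->
  quo g x2 * quo (- g) x3 - J * (ccot x1 * (quo g x2 + quo (- g) x3))
  + J * div_diff (cayley_quo s I g 1) x2 (- x3) = -1.
Proof.
move=> x0 x10; set dd := (div_diff _ _ _ : fps A).
have Edd : X * cst x1 * dd = - (quo g x2 + quo (- g) x3).
  have x23 : x2 - - x3 = - x1.
    by apply/eqP; rewrite opprK -addr_eq0 addrC addrA x0.
  have := div_diffE (cayley_quo s I g 1 : fps A) x2 (- x3).
  (* The divided difference ends with [quo g (- x3)], which by oddness is [- quo (- g) x3]. *)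
  rewrite -!quo_hom -/dd x23 -[in quo g (- x3)](opprK g) quoN opprK.
  by rewrite rmorphN mulrN mulNr => <-; rewrite opprK.
have := triple_product I2 s 1 (cst g) (cst (- g)) 0 1 1 x0.
rewrite /= -!/(quo_num _ _) -!/(quo_den _ _) mul1r !mul0r !mulr0 add0r addr0.
have D20 := quo_den0 g x2; have D30 := quo_den0 (- g) x3.
have s10 := sub_sinc0 x1.
have hN : cst (- g) = - cst g by rewrite rmorphN.
move: (quoM g x2) (quoM (- g) x3) (sub_cot x1) Edd; rewrite sub_sin hN.
move: (quo g x2) (quo (- g) x3) (quo_num g x2) (quo_num (- g) x3) => q2 q3 n2 n3.
move=> <- <- Ecot Edd T.
apply: (fpsX_inj); apply: (fps_const_inj x10).
apply: (fps_unit_inj s10); apply: (fps_unit_inj D20); apply: (fps_unit_inj D30).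
move: T Ecot Edd; move: (quo_den g x2) (quo_den (- g) x3) => d2 d3.
move: (ccot x1) (csinc x1) (ccos x1) dd => k1 s1 c1 dd.
move: (cst g) (cst x1) (J) (X) (J2 I2 s) => h a j X JJ.
move=> T Ecot Edd.
transitivity (d3 * (d2 * (s1 * (a * (X * -1)))) - j * (c1 * (q2 * d2) * d3
   + q2 * d2 * (q3 * d3) * (j * (1 * (X * a * s1))) + q3 * d3 * c1 * d2
   + j * (1 * (X * a * s1)) * d2 * d3)).
  transitivity (d2 * d3 * (X * a * s1 * (q2 * q3) - j * (q2 + q3) * (X * a * (k1 * s1))
    + j * s1 * (X * a * dd))); first by ring.
  rewrite Ecot Edd.
  transitivity (d3 * (d2 * (s1 * (a * (X * -1)))) - j * c1 * d2 * d3 * (q2 + q3)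
    - j * j * (X * a * s1 * d2 * d3 * (q2 * q3 + 1))); last by ring.
  by rewrite JJ; ring.
by rewrite T; ring.
Qed.

Local Notation cot_at := (fun k => s (cot_reg_fps K k) : A).

(** The full cotangents satisfy [cot x1 cot x2 + cot x2 cot x3 + cot x3 cot x1 = 1]. Splitting off
    the poles, the mixed terms are the divided differences, and [1/(x1 x2) + 1/(x2 x3) + 1/(x3 x1)]
    vanishes with [x1 + x2 + x3]. *)
Lemma lll_identity x1 x2 x3 : x1 + x2 + x3 = 0 ->
  x1 != 0 -> x2 != 0 -> x3 != 0 ->
  ccot x1 * ccot x2 + ccot x2 * ccot x3 + ccot x3 * ccot x1
  - (div_diff cot_at x1 (- x2) + div_diff cot_at x2 (- x3)
     + div_diff cot_at x3 (- x1)) = 1 :> fps A.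
Proof.
move=> x0 x10 x20 x30.
have Edd y1 y2 y3 : y1 + y2 + y3 = 0 ->
    X * cst y3 * div_diff cot_at y1 (- y2) = - (ccot y1 + ccot y2).
  move=> y0; have := div_diffE (cot_at : fps A) y1 (- y2).
  have -> : y1 - - y2 = - y3 by apply/eqP; rewrite opprK -addr_eq0 y0.
  rewrite -[hom_ser _ (- y2)]/(ccot (- y2)) sub_cotN opprK => <-.
  by rewrite rmorphN mulrN mulNr opprK.
have E12 := Edd _ _ _ x0.
have E23 : _ = - _ := Edd x2 x3 x1 _; rewrite addrC addrA in E23.
have E31 : _ = - _ := Edd x3 x1 x2 _; rewrite -addrA addrC in E31.
move: {E23} (E23 x0) => E23; move: {E31} (E31 x0) => E31.
have := triple_product I2 s 1 1 1 0 0 0 x0.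
have h0 : cst x1 + cst x2 + cst x3 = 0 by rewrite -!rmorphD x0 rmorph0.
move: (sub_cot x1) (sub_cot x2) (sub_cot x3) (sub_sinc0 x1) (sub_sinc0 x2)
  (sub_sinc0 x3).
move: E12 E23 E31; rewrite /= !sub_sin.
move: (div_diff _ _ _ : fps A) (div_diff _ x2 _ : fps A) (div_diff _ x3 _ : fps A).
move: (ccot x1) (ccot x2) (ccot x3) (csinc x1) (csinc x2) (csinc x3).
move: (ccos x1) (ccos x2) (ccos x3).
move=> c1 c2 c3 k1 k2 k3 s1 s2 s3 d12 d23 d31 E12 E23 E31 C1 C2 C3 s10 s20 s30 T.
apply: fpsX_inj; apply: fpsX_inj; apply: (fps_const_inj x10).
apply: (fps_const_inj x20); apply: (fps_const_inj x30).
apply: (fps_unit_inj s10); apply: (fps_unit_inj s20); apply: (fps_unit_inj s30).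
transitivity (cst x3 * s3 * (X * cst x1 * (k1 * s1)) * (X * cst x2 * (k2 * s2))
  + cst x1 * s1 * (X * cst x2 * (k2 * s2)) * (X * cst x3 * (k3 * s3))
  + cst x2 * s2 * (X * cst x3 * (k3 * s3)) * (X * cst x1 * (k1 * s1))
  - (X * cst x1 * cst x2 * s1 * s2 * s3 * (X * cst x3 * d12)
   + X * cst x2 * cst x3 * s1 * s2 * s3 * (X * cst x1 * d23)
   + X * cst x3 * cst x1 * s1 * s2 * s3 * (X * cst x2 * d31))).
  by ring.
rewrite E12 E23 E31.
transitivity (cst x3 * s3 * (X * cst x1 * (k1 * s1)) * (X * cst x2 * (k2 * s2))
  + cst x1 * s1 * (X * cst x2 * (k2 * s2)) * (X * cst x3 * (k3 * s3))
  + cst x2 * s2 * (X * cst x3 * (k3 * s3)) * (X * cst x1 * (k1 * s1))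
  + (X * cst x1 * (k1 * s1)) * s2 * s3 * (cst x2 + cst x3)
  + (X * cst x2 * (k2 * s2)) * s3 * s1 * (cst x3 + cst x1)
  + (X * cst x3 * (k3 * s3)) * s1 * s2 * (cst x1 + cst x2)).
  by ring.
rewrite C1 C2 C3.
(* Every term of [T] contains a sine [X x sinc x], hence one power of [X] more than the goal. *)
apply: fpsX_inj; move: T h0.
move: (cst x1) (cst x2) (cst x3) (J) (X) (J2 I2 s) => a1 a2 a3 j X JJ T h0.
have {}T : j * j * (c1 * c2 * (X * a3 * s3) + c2 * c3 * (X * a1 * s1)
    + c3 * c1 * (X * a2 * s2)
    + j * j * (X * a1 * s1 * (X * a2 * s2) * (X * a3 * s3))) = 0.
  have := congr1 ( *%R j) T; rewrite !mul0r !mulr0 !add0r mulr0 => <-; ring.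
rewrite JJ in T.
transitivity (X * (- ((a1 + a2 + a3) * (s1 * s2 * s3)))
  + X * a1 * s1 * (X * a2 * s2) * (X * a3 * s3)
  - (-1 * (c1 * c2 * (X * a3 * s3) + c2 * c3 * (X * a1 * s1)
    + c3 * c1 * (X * a2 * s2)
    + -1 * (X * a1 * s1 * (X * a2 * s2) * (X * a3 * s3))))).
  by ring.
by rewrite T h0; ring.
Qed.

End CotangentIdentities.

(** * Polynomials acting through commuting operators *)

Section PolynomialAction.
Variables (K : fieldType) (M : lmodType K) (n : nat).
Variables (X : 'I_n -> {linear M -> M}) (v : M).
Hypothesis XC : forall i j w, X i (X j w) = X j (X i w).

Definition mact_mon (m : 'X_{1..n}) : M :=
  foldr (fun i w => iter (m i) (X i) w) v (enum 'I_n).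

Definition mact (p : {mpoly K[n]}) : M := \sum_(m <- msupp p) p@_m *: mact_mon m.

Lemma iterXC k i j w : X i (iter k (X j) w) = iter k (X j) (X i w).
Proof. by elim: k => //= k <-. Qed.

Lemma mact_monU m i : mact_mon (m + U_(i)) = X i (mact_mon m).
Proof.
rewrite /mact_mon; have: uniq (enum 'I_n) := enum_uniq _.
have: i \in enum 'I_n by rewrite mem_enum.
elim: (enum 'I_n) => //= j r IH; rewrite inE => ij /andP[jr ur].
rewrite mnmDE mnm1E; have [e|ne] := eqVneq i j; last first.
  by move: ij; rewrite (negPf ne) /= => ir; rewrite addn0 IH // iterXC.
subst j; rewrite /= addn1 iterS; congr (X i (iter _ _ _)).
elim: r jr {ur IH ij} => //= j r IH; rewrite inE negb_or => /andP[ij jr].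
by rewrite mnmDE mnm1E (negPf ij) addn0 IH.
Qed.

Lemma mactE p i : (msize p <= i)%N ->
  mact p = \sum_(m : 'X_{1..n < i}) p@_m *: mact_mon m.
Proof.
move=> le_pi; set J : subFinType _ := 'X_{1..n < i}.
rewrite /mact (big_mksub J) ?msupp_uniq //=; first last.
  by move=> x /msize_mdeg_lt /leq_trans; apply.
rewrite big_rmcond //= => j /memN_msupp_eq0 ->.
by rewrite scale0r.
Qed.

Lemma mact_is_linear : linear mact.
Proof.
move=> a p q /=; pose i := maxn (msize (a *: p + q)) (maxn (msize p) (msize q)).
have ip : (msize p <= i)%N by rewrite !leq_max leqnn !orbT.
have iq : (msize q <= i)%N by rewrite !leq_max leqnn !orbT.
have ipq : (msize (a *: p + q) <= i)%N by rewrite leq_max leqnn.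
rewrite (mactE ip) (mactE iq) (mactE ipq) scaler_sumr -big_split /=.
by apply: eq_bigr => m _; rewrite mcoeffD mcoeffZ scalerDl scalerA.
Qed.

HB.instance Definition _ := GRing.isLinear.Build K {mpoly K[n]} M *:%R mact
  mact_is_linear.

Lemma mactD : {morph mact : p q / p + q}. Proof. exact: linearD. Qed.
Lemma mactN : {morph mact : p / - p}. Proof. exact: linearN. Qed.
Lemma mact0 : mact 0 = 0. Proof. exact: linear0. Qed.
Lemma mactZ c p : mact (c *: p) = c *: mact p. Proof. exact: linearZ. Qed.

Lemma mact_mpolyX m : mact 'X_[m] = mact_mon m.
Proof. by rewrite /mact msuppX big_seq1 mcoeffX eqxx scale1r. Qed.

Lemma mact1 : mact 1 = v.
Proof.
rewrite -mpolyX0 mact_mpolyX /mact_mon.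
by elim: (enum _) => //= i r ->; rewrite mnm0E.
Qed.

Lemma mact_var i p : mact ('X_i * p) = X i (mact p).
Proof.
elim/mpolyind: p => [|c m p _ _ IH]; first by rewrite mulr0 mact0 linear0.
rewrite mulrDr !mactD linearD IH -scalerAr !mactZ linearZ /= -mpolyXD !mact_mpolyX.
by rewrite addmC mact_monU.
Qed.

(** Agreement is required on the orbit of [v] only, so that relations special to [v], such as
    [C_2 + C_3 = 0], become substitutions of polynomials. *)
Definition acts_as (a : {mpoly K[n]}) (f : M -> M) : Prop :=
  forall p, mact (a * p) = f (mact p).

Lemma acts_as_var i : acts_as 'X_i (X i).
Proof. exact: mact_var. Qed.

(* A relation satisfied at [v] propagates to the whole orbit. *)
Lemma acts_as_of_base a (f : {linear M -> M}) :
  (forall i w, f (X i w) = X i (f w)) -> mact a = f v -> acts_as a f.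
Proof.
move=> fX fv p; elim/mpolyind: p => [|c m p _ _ IH].
  by rewrite mulr0 mact0 linear0.
rewrite mulrDr !mactD linearD IH -scalerAr !mactZ linearZ /=; congr (_ *: _ + _).
move: {2}(mdeg m) (erefl (mdeg m)) => d; elim: d m {p IH} => [|d IH] m md.
  have -> : m = 0%MM by apply/eqP; rewrite -mdeg_eq0 md.
  by rewrite mpolyX0 mulr1 mact1.
have [i mi] : exists i, m i != 0%N.
  apply/existsP; apply: contraT; rewrite negb_exists => /forallP m0.
  suff m00 : m = 0%MM by rewrite m00 mdeg0 in md.
  by apply/mnmP => i; rewrite mnm0E; apply/eqP; rewrite -[_ == _]negbK m0.
have mE : m = ((m - U_(i)) + U_(i))%MM by rewrite submK ?lep1mP.
rewrite mE mpolyXD [_ * 'X_i]mulrC mulrCA !mact_var IH ?fX //.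
by move: md; rewrite {1}mE mdegD mdeg1 addn1 => -[].
Qed.

Lemma acts_asD a b f g :
  acts_as a f -> acts_as b g -> acts_as (a + b) (fun w => f w + g w).
Proof. by move=> af bg p; rewrite mulrDl mactD af bg. Qed.

Lemma acts_asN a f : acts_as a f -> acts_as (- a) (fun w => - f w).
Proof. by move=> af p; rewrite mulNr mactN af. Qed.

Lemma acts_asM a b f g : acts_as a f -> acts_as b g -> acts_as (a * b) (f \o g).
Proof. by move=> af bg p; rewrite -mulrA af bg. Qed.

Lemma acts_asC c : acts_as c%:MP (fun w => c *: w).
Proof. by move=> p; rewrite mul_mpolyC mactZ. Qed.

End PolynomialAction.

(** * Three-tensors *)

Section SlotOperators.
Variables (K : fieldType) (d n : nat).
Local Notation S := {mpoly K[d]}.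
Local Notation W := 'M[S]_n.
(** A finite function on triples, instead of the curried [tens3], inherits a [K]-module
    structure. *)
Definition tensor3 := {ffun 'I_n * 'I_n * 'I_n -> {mpoly K[d]}}.
HB.instance Definition _ := GRing.Lmodule.on tensor3.
Implicit Types (w : tensor3) (A B : W).

Definition op1 A w : tensor3 := [ffun p => \sum_i A p.1.1 i * w (i, p.1.2, p.2)].
Definition op2 A w : tensor3 := [ffun p => \sum_i A p.1.2 i * w (p.1.1, i, p.2)].
Definition op3 A w : tensor3 := [ffun p => \sum_i A p.2 i * w (p.1.1, p.1.2, i)].

Lemma tensor3P w w' : (forall a b c, w (a, b, c) = w' (a, b, c)) -> w = w'.
Proof. by move=> ww'; apply/ffunP => -[[a b] c]. Qed.

Lemma op1E A w a b c : op1 A w (a, b, c) = \sum_i A a i * w (i, b, c).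
Proof. by rewrite ffunE. Qed.
Lemma op2E A w a b c : op2 A w (a, b, c) = \sum_i A b i * w (a, i, c).
Proof. by rewrite ffunE. Qed.
Lemma op3E A w a b c : op3 A w (a, b, c) = \sum_i A c i * w (a, b, i).
Proof. by rewrite ffunE. Qed.
Definition opE := (op1E, op2E, op3E).

Lemma op1_linear A : linear (op1 A).
Proof.
move=> k w w'; apply: tensor3P => a b c; rewrite !ffunE scaler_sumr -big_split /=.
by apply: eq_bigr => i _; rewrite !ffunE mulrDr -scalerAr.
Qed.
Lemma op2_linear A : linear (op2 A).
Proof.
move=> k w w'; apply: tensor3P => a b c; rewrite !ffunE scaler_sumr -big_split /=.
by apply: eq_bigr => i _; rewrite !ffunE mulrDr -scalerAr.
Qed.
Lemma op3_linear A : linear (op3 A).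
Proof.
move=> k w w'; apply: tensor3P => a b c; rewrite !ffunE scaler_sumr -big_split /=.
by apply: eq_bigr => i _; rewrite !ffunE mulrDr -scalerAr.
Qed.

HB.instance Definition _ A :=
  GRing.isLinear.Build K tensor3 tensor3 *:%R (op1 A) (op1_linear A).
HB.instance Definition _ A :=
  GRing.isLinear.Build K tensor3 tensor3 *:%R (op2 A) (op2_linear A).
HB.instance Definition _ A :=
  GRing.isLinear.Build K tensor3 tensor3 *:%R (op3 A) (op3_linear A).

Lemma op12C A B w : op1 A (op2 B w) = op2 B (op1 A w).
Proof.
apply: tensor3P => a b c; rewrite !opE.
under eq_bigr do rewrite opE mulr_sumr; rewrite exchange_big /=.
by apply: eq_bigr => i _; rewrite opE mulr_sumr; apply: eq_bigr => j _; rewrite mulrCA.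
Qed.
Lemma op13C A B w : op1 A (op3 B w) = op3 B (op1 A w).
Proof.
apply: tensor3P => a b c; rewrite !opE.
under eq_bigr do rewrite opE mulr_sumr; rewrite exchange_big /=.
by apply: eq_bigr => i _; rewrite opE mulr_sumr; apply: eq_bigr => j _; rewrite mulrCA.
Qed.
Lemma op23C A B w : op2 A (op3 B w) = op3 B (op2 A w).
Proof.
apply: tensor3P => a b c; rewrite !opE.
under eq_bigr do rewrite opE mulr_sumr; rewrite exchange_big /=.
by apply: eq_bigr => i _; rewrite opE mulr_sumr; apply: eq_bigr => j _; rewrite mulrCA.
Qed.

(** The matrix ring acts through any single slot; the argument that transfers series to operators is
    thus made once for the three slots. *)
Definition slot_op (op : W -> tensor3 -> tensor3) : Prop :=
  [/\ forall w, op 0 w = 0, forall A B w, op (A + B) w = op A w + op B w,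
      forall A w, op (- A) w = - op A w,
      forall A B w, op (A * B) w = op A (op B w) &
      forall c w, op (mpolyC d c)%:M w = c *: w].

Lemma slot_op1 : slot_op op1.
Proof.
split.
- by move=> w; apply: tensor3P => a b c; rewrite opE ffunE big1 // => i _;
  rewrite mxE mul0r.
- move=> A B w; apply: tensor3P => a b c; rewrite !ffunE -big_split /=.
  by apply: eq_bigr => i _; rewrite mxE mulrDl.
- move=> A w; apply: tensor3P => a b c; rewrite !ffunE -sumrN.
  by apply: eq_bigr => i _; rewrite mxE mulNr.
- move=> A B w; apply: tensor3P => a b c; rewrite !opE.
  under [RHS]eq_bigr do rewrite opE mulr_sumr; rewrite exchange_big /=.
  by apply: eq_bigr => i _; rewrite mxE mulr_suml; apply: eq_bigr => j _; rewrite mulrA.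
- move=> k w; apply: tensor3P => a b c; rewrite !ffunE (bigD1 a) //= big1 ?addr0.
    by rewrite mxE eqxx mul_mpolyC.
  by move=> i ia; rewrite mxE eq_sym (negPf ia) mul0r.
Qed.

Lemma slot_op2 : slot_op op2.
Proof.
split.
- by move=> w; apply: tensor3P => a b c; rewrite opE ffunE big1 // => i _;
  rewrite mxE mul0r.
- move=> A B w; apply: tensor3P => a b c; rewrite !ffunE -big_split /=.
  by apply: eq_bigr => i _; rewrite mxE mulrDl.
- move=> A w; apply: tensor3P => a b c; rewrite !ffunE -sumrN.
  by apply: eq_bigr => i _; rewrite mxE mulNr.
- move=> A B w; apply: tensor3P => a b c; rewrite !opE.
  under [RHS]eq_bigr do rewrite opE mulr_sumr; rewrite exchange_big /=.
  by apply: eq_bigr => i _; rewrite mxE mulr_suml; apply: eq_bigr => j _; rewrite mulrA.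
- move=> k w; apply: tensor3P => a b c; rewrite !ffunE (bigD1 b) //= big1 ?addr0.
    by rewrite mxE eqxx mul_mpolyC.
  by move=> i ia; rewrite mxE eq_sym (negPf ia) mul0r.
Qed.

Lemma slot_op3 : slot_op op3.
Proof.
split.
- by move=> w; apply: tensor3P => a b c; rewrite opE ffunE big1 // => i _;
  rewrite mxE mul0r.
- move=> A B w; apply: tensor3P => a b c; rewrite !ffunE -big_split /=.
  by apply: eq_bigr => i _; rewrite mxE mulrDl.
- move=> A w; apply: tensor3P => a b c; rewrite !ffunE -sumrN.
  by apply: eq_bigr => i _; rewrite mxE mulNr.
- move=> A B w; apply: tensor3P => a b c; rewrite !opE.
  under [RHS]eq_bigr do rewrite opE mulr_sumr; rewrite exchange_big /=.
  by apply: eq_bigr => i _; rewrite mxE mulr_suml; apply: eq_bigr => j _; rewrite mulrA.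
- move=> k w; apply: tensor3P => a b c; rewrite !ffunE (bigD1 c) //= big1 ?addr0.
    by rewrite mxE eqxx mul_mpolyC.
  by move=> i ia; rewrite mxE eq_sym (negPf ia) mul0r.
Qed.

Lemma op1_lincomb m (c : 'I_m -> S) (A : 'I_m -> W) w p :
  op1 (\sum_i c i *: A i) w p = \sum_i c i * op1 (A i) w p.
Proof.
under [RHS]eq_bigr do rewrite ffunE mulr_sumr.
rewrite ffunE exchange_big; apply: eq_bigr => j _.
by rewrite summxE mulr_suml; apply: eq_bigr => i _; rewrite mxE mulrA.
Qed.
Lemma op2_lincomb m (c : 'I_m -> S) (A : 'I_m -> W) w p :
  op2 (\sum_i c i *: A i) w p = \sum_i c i * op2 (A i) w p.
Proof.
under [RHS]eq_bigr do rewrite ffunE mulr_sumr.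
rewrite ffunE exchange_big; apply: eq_bigr => j _.
by rewrite summxE mulr_suml; apply: eq_bigr => i _; rewrite mxE mulrA.
Qed.
Lemma op3_lincomb m (c : 'I_m -> S) (A : 'I_m -> W) w p :
  op3 (\sum_i c i *: A i) w p = \sum_i c i * op3 (A i) w p.
Proof.
under [RHS]eq_bigr do rewrite ffunE mulr_sumr.
rewrite ffunE exchange_big; apply: eq_bigr => j _.
by rewrite summxE mulr_suml; apply: eq_bigr => i _; rewrite mxE mulrA.
Qed.

End SlotOperators.

(** * The dynamical Yang-Baxter equation for commuting variables *)

Section RSeries.
Variables (K : fieldType) (W : pzRingType) (s : K -> W) (I : K).

(* The series [cot_reg(y)] on [l] and [i (g + i tan y) / (1 + i tan y g)] on [u],
   when [el] and [eu] are the projections; at [y = 1] one finds its coefficients. *)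
Definition r_ser (g el eu y : W) : fps W := fun k =>
  fps_sub_at s (cot_reg_fps K) y k * el + s I * cayley_quo s I g y k * eu.

End RSeries.

Lemma rel_r_ser (K : fieldType) (W W' : pzRingType) (s : K -> W) (s' : K -> W')
    (I : K) (Rel : W -> W' -> Prop) g g' el el' eu eu' y y' k :
  Rel 0 0 -> Rel 1 1 ->
  (forall a a' b b', Rel a a' -> Rel b b' -> Rel (a + b) (a' + b')) ->
  (forall a a', Rel a a' -> Rel (- a) (- a')) ->
  (forall a a' b b', Rel a a' -> Rel b b' -> Rel (a * b) (a' * b')) ->
  (forall a, Rel (s a) (s' a)) ->
  Rel g g' -> Rel el el' -> Rel eu eu' -> Rel y y' ->
  Rel (r_ser s I g el eu y k) (r_ser s' I g' el' eu' y' k).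
Proof.
move=> r0 r1 rD rN rM rs rg rel reu ry; apply: (rD); apply: (rM) => //.
  exact: (fps_rel_sub_at (Rel := Rel)).
by apply: (rM) => //; apply: (fps_rel_cayley_quo (Rel := Rel)).
Qed.

Lemma r_ser_odd (K : numFieldType) (W : pzRingType) (s : K -> W) I g el eu y k :
  s 0 = 0 -> r_ser s I (- g) el eu (- y) k = - r_ser s I g el eu y k.
Proof.
move=> s0; rewrite /r_ser cayley_quo_odd // fps_sub_at_odd //.
  by rewrite opprD mulrN !mulNr.
exact: even_cot_reg.
Qed.

Lemma r_ser_hom (K : fieldType) (W : pzRingType) (s : K -> W) I (g el eu y : W) k :
  (forall a, GRing.comm y (s a)) -> GRing.comm y g -> GRing.comm y el ->
  GRing.comm y eu -> r_ser s I g el eu y k = r_ser s I g el eu 1 k * y ^+ k.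
Proof.
move=> ys yg yl yu; have yk x : GRing.comm y x -> y ^+ k * x = x * y ^+ k.
  by move=> yx; apply: commr_sym; apply: commrX; apply: commr_sym.
rewrite /r_ser cayley_quo_hom // /fps_sub_at /hom_ser expr1n mulr1 mulrDl.
by rewrite -!mulrA (yk _ yl) (yk _ yu).
Qed.

Section UniversalIdentity.
Variables (K : numFieldType) (I : K) (I2 : I * I = -1).
Variables (A : idomainType) (s : {rmorphism K -> A}).
Variables (y1 y2 y3 : A) (y0 : y1 + y2 + y3 = 0).

(** The left-hand side of the equation divided by [- (pi c)^2], the slot operators being replaced by
    commuting variables; the expected value is [1]. The trailing [l3], [l1], [l2] stand for the
    projection to [l] in the slot that receives the derivation variable. *)
Definition cdybe_lhs (g1 g2 g3 l1 l2 l3 u1 u2 u3 : A) : fps A := fun k =>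
  \sum_(i < k.+1) (r_ser s I g2 l2 u2 y2 i * r_ser s I g3 l3 u3 y3 (k - i)%N
    + r_ser s I g1 l1 u1 y1 i * r_ser s I g3 l3 u3 y3 (k - i)%N
    + r_ser s I g1 l1 u1 y1 i * r_ser s I g2 l2 u2 y2 (k - i)%N)
  - (div_diff (r_ser s I g1 l1 u1 1) y1 (- y2) k * l3
     + div_diff (r_ser s I g2 l2 u2 1) y2 (- y3) k * l1
     + div_diff (r_ser s I g3 l3 u3 1) y3 (- y1) k * l2).

Local Notation cst x := (fps_const x : fps A).
Local Notation ccot x := (fps_sub_at s (cot_reg_fps K) x : fps A).
Local Notation quo g x := (cayley_quo s I g x : fps A).
Local Notation J := (cst (s I)).

Lemma cdybe_lhsE g1 g2 g3 l1 l2 l3 u1 u2 u3 :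
  cdybe_lhs g1 g2 g3 l1 l2 l3 u1 u2 u3 =
  (r_ser s I g2 l2 u2 y2 : fps A) * r_ser s I g3 l3 u3 y3
  + (r_ser s I g1 l1 u1 y1 : fps A) * r_ser s I g3 l3 u3 y3
  + (r_ser s I g1 l1 u1 y1 : fps A) * r_ser s I g2 l2 u2 y2
  - (cst l3 * div_diff (r_ser s I g1 l1 u1 1) y1 (- y2)
     + cst l1 * div_diff (r_ser s I g2 l2 u2 1) y2 (- y3)
     + cst l2 * div_diff (r_ser s I g3 l3 u3 1) y3 (- y1)).
Proof.
apply: fps_ext => k.
rewrite fpsB !fpsD !fps_constM !fpsM -!big_split /= /cdybe_lhs.
by rewrite [l3 * _]mulrC [l1 * _]mulrC [l2 * _]mulrC.
Qed.

Lemma r_ser_l g y : r_ser s I g 1 0 y = ccot y.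
Proof. by apply: fps_ext => k; rewrite /r_ser mulr1 mulr0 addr0. Qed.

Lemma r_ser_u g y : r_ser s I g 0 1 y = J * quo g y.
Proof. by apply: fps_ext => k; rewrite fps_constM /r_ser mulr1 mulr0 add0r. Qed.

Lemma div_diff_l g x y :
  div_diff (r_ser s I g 1 0 1) x y = div_diff (fun k => s (cot_reg_fps K k)) x y.
Proof.
apply: fps_ext => k; rewrite r_ser_l /div_diff /fps_sub_at /hom_ser.
by rewrite expr1n mulr1.
Qed.

Lemma div_diff_u g x y :
  (div_diff (r_ser s I g 0 1 1) x y : fps A) = J * div_diff (cayley_quo s I g 1) x y.
Proof.
by apply: fps_ext => k; rewrite r_ser_u fps_constM /div_diff fps_constM mulrA.
Qed.

Lemma cdybe_lll g1 g2 g3 : y1 != 0 -> y2 != 0 -> y3 != 0 ->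
  cdybe_lhs g1 g2 g3 1 1 1 0 0 0 = 1.
Proof.
move=> y10 y20 y30; rewrite cdybe_lhsE !div_diff_l !r_ser_l rmorph1 !mul1r.
by rewrite -(lll_identity I2 s y0 y10 y20 y30); ring.
Qed.

Lemma cdybe_luu g1 g : y1 != 0 -> cdybe_lhs g1 g (- g) 1 0 0 0 1 1 = 1.
Proof.
move=> y10; rewrite cdybe_lhsE !div_diff_u !r_ser_l !r_ser_u !rmorph0 !mul0r rmorph1.
have JJ := J2 I2 s.
have E := luu_identity I2 s g y0 y10; rewrite -[1 in RHS]opprK -E.
transitivity (J * J * (quo g y2 * quo (- g) y3)
  + J * (ccot y1 * (quo g y2 + quo (- g) y3))
  - J * div_diff (cayley_quo s I g 1) y2 (- y3)); first by ring.
by rewrite JJ; ring.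
Qed.

End UniversalIdentity.

Section UniversalRotation.
Variables (K : numFieldType) (I : K) (A : idomainType) (s : {rmorphism K -> A}).

(** Reduces the components [u l u] and [u u l] to [l u u]. *)
Lemma cdybe_rot y1 y2 y3 g1 g2 g3 l1 l2 l3 u1 u2 u3 :
  cdybe_lhs I s y1 y2 y3 g1 g2 g3 l1 l2 l3 u1 u2 u3
  = cdybe_lhs I s y2 y3 y1 g2 g3 g1 l2 l3 l1 u2 u3 u1.
Proof. by rewrite !cdybe_lhsE; ring. Qed.

(** The cofactor [w] stays unspecified: it is enough that the defect is a multiple of the Cayley
    relation, which will act as zero. *)
Lemma cdybe_uuu (y1 y2 y3 g1 g2 g3 : A) : I * I = -1 -> y1 + y2 + y3 = 0 ->
  exists w, forall k, cdybe_lhs I s y1 y2 y3 g1 g2 g3 0 0 0 1 1 1 k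
    = (k == 0%N)%:R - w k * (g1 * g2 + g2 * g3 + g3 * g1 + 1).
Proof.
move=> I2 y0; have := uuu_identity I2 s g1 g2 g3 y0.
set w := fps_inv _ => E; exists w => k.
have -> : cdybe_lhs I s y1 y2 y3 g1 g2 g3 0 0 0 1 1 1
    = 1 - fps_const (g1 * g2 + g2 * g3 + g3 * g1 + 1) * w.
  rewrite cdybe_lhsE !r_ser_u rmorph0 !mul0r -E.
  have JJ := J2 I2 s; move: JJ; move: (fps_const _) => J JJ.
  by ring: JJ.
by rewrite fpsB fps_constM fps1 [X in _ - X]mulrC.
Qed.

End UniversalRotation.

(** * The equation for slot operators *)

Section OperatorIdentity.
Variables (K : numFieldType) (I : K) (d n : nat).
Hypothesis I2 : I * I = -1.
Local Notation S := {mpoly K[d]}.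
Local Notation W := 'M[S]_n.
Local Notation M := (tensor3 K d n).
Variables Y C Pl Pu : W.
Hypotheses (YC : Y * C = C * Y) (YPl : Y * Pl = Pl * Y) (YPu : Y * Pu = Pu * Y).
Hypotheses (CPl : C * Pl = 0) (PlC : Pl * C = 0).
Hypotheses (CPu : C * Pu = C) (PuC : Pu * C = C).
Hypotheses (PlPu : Pl * Pu = 0) (PuPl : Pu * Pl = 0).

Definition scal_mx (c : K) : W := (mpolyC d c)%:M.

Local Notation r := (r_ser scal_mx I C Pl Pu).

(** The operator form of [cdybe_lhs]. Here [r 1 k.+1] is the coefficient that stands in front of
    [Y ^+ k.+1]. *)
Definition cdybe_op (k : nat) (w : M) : M :=
  \sum_(i < k.+1) (op2 (r Y i) (op3 (r Y (k - i)%N) w)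
    + op1 (r Y i) (op3 (r Y (k - i)%N) w)
    + op1 (r Y i) (op2 (r Y (k - i)%N) w))
  - (op1 (r 1 k.+1) (\sum_(a < k.+1) op1 (Y ^+ (k - a)) (op2 ((- Y) ^+ a) (op3 Pl w)))
   + op2 (r 1 k.+1) (\sum_(a < k.+1) op2 (Y ^+ (k - a)) (op3 ((- Y) ^+ a) (op1 Pl w)))
   + op3 (r 1 k.+1) (\sum_(a < k.+1) op3 (Y ^+ (k - a)) (op1 ((- Y) ^+ a) (op2 Pl w)))).

Let additive_fun (f : M -> M) := forall w w', f (w + w') = f w + f w'.

Let additive_comp (f h : M -> M) :
  additive_fun f -> additive_fun h -> additive_fun (fun w => f (h w)).
Proof. by move=> af ah w w'; rewrite ah af. Qed.
Let additive_add (f h : M -> M) :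
  additive_fun f -> additive_fun h -> additive_fun (fun w => f w + h w).
Proof. by move=> af ah w w'; rewrite ah af addrACA. Qed.
Let additive_sum m (f : 'I_m -> M -> M) :
  (forall i, additive_fun (f i)) -> additive_fun (fun w => \sum_i f i w).
Proof.
by move=> af w w'; rewrite -big_split; apply: eq_bigr => i _; rewrite af.
Qed.

Lemma cdybe_opD k w w' : cdybe_op k (w + w') = cdybe_op k w + cdybe_op k w'.
Proof.
have [a1 [a2 a3]] : (forall A : W, additive_fun (op1 A)) /\
    (forall A : W, additive_fun (op2 A)) /\ (forall A : W, additive_fun (op3 A)).
  by split; [|split] => A x y; rewrite linearD.
move: w w'; rewrite -/(additive_fun (cdybe_op k)); apply: additive_add.
  by apply: additive_sum => i; do 2?apply: additive_add; apply: additive_comp.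
move=> w w'; rewrite -opprD; congr (- _); move: w w'.
do 2?apply: additive_add; apply: additive_comp => //; apply: additive_sum => i;
  by do 2?apply: additive_comp.
Qed.

Lemma cdybe_op0 k : cdybe_op k 0 = 0.
Proof. by apply: (addrI (cdybe_op k 0)); rewrite -cdybe_opD !addr0. Qed.

(** Five variables suffice: [Y_3] will be [- (Y_1 + Y_2)], which keeps all three [y] nonzero
    polynomials, and each projection is [0] or [1] on a component. *)
Definition basic_op (i : 'I_5) : {linear M -> M} :=
  match val i with
  | 0 => op1 Y | 1 => op2 Y | 2 => op1 C | 3 => op2 C | _ => op3 C
  end.

Let slot1C (A B : W) (w : M) : A * B = B * A -> op1 A (op1 B w) = op1 B (op1 A w).
Proof. by case: (slot_op1 K d n) => _ _ _ opM _; rewrite -!opM => ->. Qed.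
Let slot2C (A B : W) (w : M) : A * B = B * A -> op2 A (op2 B w) = op2 B (op2 A w).
Proof. by case: (slot_op2 K d n) => _ _ _ opM _; rewrite -!opM => ->. Qed.
Let slot3C (A B : W) (w : M) : A * B = B * A -> op3 A (op3 B w) = op3 B (op3 A w).
Proof. by case: (slot_op3 K d n) => _ _ _ opM _; rewrite -!opM => ->. Qed.

Lemma op1_basicC (A : W) i (w : M) : A * Y = Y * A -> A * C = C * A ->
  op1 A (basic_op i w) = basic_op i (op1 A w).
Proof.
move=> AY AC; rewrite /basic_op.
by case: (val i) => [|[|[|[|j]]]]; rewrite ?op12C ?op13C //; apply: slot1C.
Qed.

Lemma op2_basicC (A : W) i (w : M) : A * Y = Y * A -> A * C = C * A ->
  op2 A (basic_op i w) = basic_op i (op2 A w).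
Proof.
move=> AY AC; rewrite /basic_op.
by case: (val i) => [|[|[|[|j]]]]; rewrite -?op12C ?op23C //; apply: slot2C.
Qed.

Lemma op3_basicC (A : W) i (w : M) : A * Y = Y * A -> A * C = C * A ->
  op3 A (basic_op i w) = basic_op i (op3 A w).
Proof.
move=> AY AC; rewrite /basic_op.
by case: (val i) => [|[|[|[|j]]]]; rewrite -?op13C -?op23C //; apply: slot3C.
Qed.

Lemma basic_opC i j w : basic_op i (basic_op j w) = basic_op j (basic_op i w).
Proof.
rewrite [basic_op i]/basic_op.
case: (val i) => [|[|[|[|k]]]];
  by rewrite /= ?op1_basicC ?op2_basicC ?op3_basicC ?YC.
Qed.

Section AtVector.
Variable v : M.
Local Notation acts := (@acts_as K M 5 basic_op v).
Local Notation A := {mpoly K[5]}.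

Section SlotTransfer.
Variables (op : W -> M -> M) (opP : slot_op op).

Let Rel (a : A) (B : W) := acts a (op B).

Lemma acts_slot0 : Rel 0 0.
Proof. by move=> p; rewrite mul0r mact0; case: opP => -> *. Qed.
Lemma acts_slotC c : Rel c%:MP (scal_mx c).
Proof. by case: opP => _ _ _ _ opC p; rewrite opC acts_asC. Qed.
Lemma acts_slot1 : Rel 1 1.
Proof. by have := acts_slotC 1; rewrite /scal_mx !rmorph1. Qed.
Lemma acts_slotD a B a' B' : Rel a B -> Rel a' B' -> Rel (a + a') (B + B').
Proof. by case: opP => _ opD _ _ _ r1 r2 p; rewrite opD; exact: (acts_asD r1 r2). Qed.
Lemma acts_slotN a B : Rel a B -> Rel (- a) (- B).
Proof. by case: opP => _ _ opN _ _ r1 p; rewrite opN; exact: (acts_asN r1). Qed.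
Lemma acts_slotM a B a' B' : Rel a B -> Rel a' B' -> Rel (a * a') (B * B').
Proof. by case: opP => _ _ _ opM _ r1 r2 p; rewrite opM; exact: (acts_asM r1 r2). Qed.

Lemma acts_slotX a B k : Rel a B -> Rel (a ^+ k) (B ^+ k).
Proof.
by move=> aB; apply: (rel_expr acts_slot1) => // *; apply: acts_slotM.
Qed.

Lemma acts_r_ser g l u y B k : Rel g C -> Rel l Pl -> Rel u Pu -> Rel y B ->
  Rel (r_ser (@mpolyC 5 K) I g l u y k) (r B k).
Proof.
by apply: (@rel_r_ser _ _ _ _ _ _ Rel);
  [exact: acts_slot0 | exact: acts_slot1 | exact: acts_slotD | exact: acts_slotN
  | exact: acts_slotM | exact: acts_slotC].
Qed.

End SlotTransfer.

Variables (y1 y2 y3 g1 g2 g3 l1 l2 l3 u1 u2 u3 : A).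
Hypotheses (y1P : acts y1 (op1 Y)) (y2P : acts y2 (op2 Y)) (y3P : acts y3 (op3 Y)).
Hypotheses (g1P : acts g1 (op1 C)) (g2P : acts g2 (op2 C)) (g3P : acts g3 (op3 C)).
Hypotheses (l1P : acts l1 (op1 Pl)) (l2P : acts l2 (op2 Pl)) (l3P : acts l3 (op3 Pl)).
Hypotheses (u1P : acts u1 (op1 Pu)) (u2P : acts u2 (op2 Pu)) (u3P : acts u3 (op3 Pu)).

Lemma acts_sum (J : Type) (rr : seq J) (P : pred J) (F : J -> A) (G : J -> M -> M) :
  (forall i, acts (F i) (G i)) ->
  acts (\sum_(i <- rr | P i) F i) (fun w => \sum_(i <- rr | P i) G i w).
Proof.
move=> FG p; rewrite mulr_suml (big_morph _ (@mactD _ _ _ _ _) (@mact0 _ _ _ _ _)).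
by apply: eq_bigr => i _; apply: FG.
Qed.

Lemma acts_cdybe k :
  acts (cdybe_lhs I (@mpolyC 5 K) y1 y2 y3 g1 g2 g3 l1 l2 l3 u1 u2 u3 k) (cdybe_op k).
Proof.
have [o1 [o2 o3]] := conj (slot_op1 K d n) (conj (slot_op2 K d n) (slot_op3 K d n)).
have div (op op' op'' : W -> M -> M) g l u y y' l'' : slot_op op -> slot_op op' ->
    acts y (op Y) -> acts g (op C) -> acts l (op Pl) -> acts u (op Pu) ->
    acts y' (op' Y) -> acts l'' (op'' Pl) ->
    acts (div_diff (r_ser (@mpolyC 5 K) I g l u 1) y (- y') k * l'')
     (fun w => op (r 1 k.+1)
        (\sum_(a < k.+1) op (Y ^+ (k - a)) (op' ((- Y) ^+ a) (op'' Pl w)))).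
  move=> oP oP' yP gP lP uP yP' lP''; rewrite /div_diff -mulrA.
  apply: (@acts_asM _ _ _ _ _ _ _ (op (r 1 k.+1))).
    by apply: acts_r_ser => //; apply: acts_slot1.
  rewrite mulr_suml; apply: acts_sum => a; rewrite -mulrA.
  apply: (@acts_asM _ _ _ _ _ _ _ (op (Y ^+ (k - a)))).
    exact: acts_slotX.
  apply: (@acts_asM _ _ _ _ _ _ _ (op' ((- Y) ^+ a))) => //.
  by apply: acts_slotX => //; apply: acts_slotN.
apply: acts_asD.
  apply: acts_sum => i; apply: acts_asD; [apply: acts_asD|].
  - by apply: (@acts_asM _ _ _ _ _ _ _ (op2 _)); apply: acts_r_ser.
  - by apply: (@acts_asM _ _ _ _ _ _ _ (op1 _)); apply: acts_r_ser.
  - by apply: (@acts_asM _ _ _ _ _ _ _ (op1 _)); apply: acts_r_ser.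
by apply: acts_asN; apply: acts_asD; [apply: acts_asD|]; apply: div.
Qed.

End AtVector.

Section Components.
Variable v : M.
Hypothesis Yv : op1 Y v + op2 Y v + op3 Y v = 0.
Local Notation acts := (@acts_as K M 5 basic_op v).
Local Notation act := (@mact K M 5 basic_op v).
Local Notation x k := ('X_(Ordinal (isT : k < 5)%N) : {mpoly K[5]}).

Let CY := esym YC.
Let PlY := esym YPl.
Let PuY := esym YPu.
Let PlCC : Pl * C = C * Pl. Proof. by rewrite PlC CPl. Qed.
Let PuCC : Pu * C = C * Pu. Proof. by rewrite PuC CPu. Qed.

Let act_x i : act 'X_i = basic_op i v.
Proof. by rewrite -['X_i]mulr1 (mact_var _ basic_opC) mact1. Qed.

Let acts_base (a : {mpoly K[5]}) (f : {linear M -> M}) :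
  (forall i w, f (basic_op i w) = basic_op i (f w)) -> act a = f v -> acts a f.
Proof. exact: acts_as_of_base basic_opC _ _. Qed.

Let acts_x0 : acts (x 0) (op1 Y). Proof. exact: (acts_as_var _ basic_opC). Qed.
Let acts_x1 : acts (x 1) (op2 Y). Proof. exact: (acts_as_var _ basic_opC). Qed.
Let acts_x2 : acts (x 2) (op1 C). Proof. exact: (acts_as_var _ basic_opC). Qed.
Let acts_x3 : acts (x 3) (op2 C). Proof. exact: (acts_as_var _ basic_opC). Qed.
Let acts_x4 : acts (x 4) (op3 C). Proof. exact: (acts_as_var _ basic_opC). Qed.

Let y3 := - (x 0 + x 1).
Let acts_y3 : acts y3 (op3 Y).
Proof.
apply: (acts_base (f := op3 Y)) => [i w|]; first exact: op3_basicC.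
rewrite mactN mactD !act_x; apply/eqP.
by rewrite eq_sym -addr_eq0 addrC Yv.
Qed.

Let y_sum : x 0 + x 1 + y3 = 0. Proof. exact: subrr. Qed.

Let acts0 (f : {linear M -> M}) :
  (forall i w, f (basic_op i w) = basic_op i (f w)) -> f v = 0 -> acts 0 f.
Proof. by move=> fX fv; apply: acts_base; rewrite ?mact0. Qed.

Let acts1 (f : {linear M -> M}) :
  (forall i w, f (basic_op i w) = basic_op i (f w)) -> f v = v -> acts 1 f.
Proof. by move=> fX fv; apply: acts_base; rewrite ?mact1. Qed.

Definition in_slot (op : W -> M -> M) (b : bool) : Prop :=
  if b then op Pl v = v else op Pu v = v.

Let slot_ops op b : slot_op op -> in_slot op b ->
  op Pl v = (b%:R : K) *: v /\ op Pu v = ((~~ b)%:R : K) *: v.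
Proof.
move=> [op0 _ _ opM _]; case: b => /= opv; rewrite ?scale1r ?scale0r; split => //.
  by rewrite -opv -opM PuPl op0.
by rewrite -opv -opM PlPu op0.
Qed.

Let acts_bit (b : bool) (f : {linear M -> M}) :
  (forall i w, f (basic_op i w) = basic_op i (f w)) ->
  f v = (b%:R : K) *: v -> acts b%:R f.
Proof.
by case: b => fX; rewrite ?scale1r ?scale0r; [apply: acts1|apply: acts0].
Qed.

(** The bits record which slots lie in [l]. The [g] are left free, so that a relation between the
    [C_j] can be built in by choosing, for instance, [- x 3] for [C_3]. *)
Lemma cdybe_op_act b1 b2 b3 g1 g2 g3 k :
  in_slot (@op1 K d n) b1 -> in_slot (@op2 K d n) b2 -> in_slot (@op3 K d n) b3 ->
  acts g1 (op1 C) -> acts g2 (op2 C) -> acts g3 (op3 C) ->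
  cdybe_op k v = act (cdybe_lhs I (@mpolyC 5 K) (x 0) (x 1) y3 g1 g2 g3
                        b1%:R b2%:R b3%:R (~~ b1)%:R (~~ b2)%:R (~~ b3)%:R k).
Proof.
move=> s1 s2 s3 G1 G2 G3.
have [L1 U1] := slot_ops (slot_op1 K d n) s1.
have [L2 U2] := slot_ops (slot_op2 K d n) s2.
have [L3 U3] := slot_ops (slot_op3 K d n) s3.
have := @acts_cdybe v _ _ _ _ _ _ _ _ _ _ _ _ acts_x0 acts_x1 acts_y3 G1 G2 G3.
have l1 := acts_bit (f := op1 Pl) (fun i w => op1_basicC i w PlY PlCC) L1.
have l2 := acts_bit (f := op2 Pl) (fun i w => op2_basicC i w PlY PlCC) L2.
have l3 := acts_bit (f := op3 Pl) (fun i w => op3_basicC i w PlY PlCC) L3.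
have u1 := acts_bit (f := op1 Pu) (fun i w => op1_basicC i w PuY PuCC) U1.
have u2 := acts_bit (f := op2 Pu) (fun i w => op2_basicC i w PuY PuCC) U2.
have u3 := acts_bit (f := op3 Pu) (fun i w => op3_basicC i w PuY PuCC) U3.
move=> /(_ _ _ _ _ _ _ l1 l2 l3 u1 u2 u3 k 1).
by rewrite mulr1 mact1.
Qed.

Let x0_neq0 : x 0 != 0.
Proof.
apply/eqP => /(congr1 (fun p => p@_(U_(Ordinal (isT : 0 < 5)%N)))) /eqP.
by rewrite mcoeffX mcoeff0 eqxx oner_eq0.
Qed.

Let x1_neq0 : x 1 != 0.
Proof.
apply/eqP => /(congr1 (fun p => p@_(U_(Ordinal (isT : 1 < 5)%N)))) /eqP.
by rewrite mcoeffX mcoeff0 eqxx oner_eq0.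
Qed.

Let y3_neq0 : y3 != 0.
Proof.
rewrite oppr_eq0; apply/eqP.
move=> /(congr1 (fun p => p@_(U_(Ordinal (isT : 1 < 5)%N)))) /eqP.
rewrite mcoeffD !mcoeffX mcoeff0 eqxx.
have /negPf-> : (U_(Ordinal (isT : 0 < 5)%N) != U_(Ordinal (isT : 1 < 5)%N))%MM.
  apply/eqP => E; have := (mnmP _ _).1 E (Ordinal (isT : 1 < 5)%N).
  by rewrite !mnm1E eqxx.
by rewrite add0r oner_eq0.
Qed.

Let act_delta k : act ((1 : fps {mpoly K[5]}) k) = (k == 0%N)%:R *: v.
Proof. by rewrite fps1; case: eqP; rewrite ?mact1 ?mact0 ?scale1r ?scale0r. Qed.

Let y_sum2 : x 1 + y3 + x 0 = 0. Proof. by rewrite addrC addrA. Qed.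
Let y_sum3 : y3 + x 0 + x 1 = 0. Proof. by rewrite -addrA addrC. Qed.

Lemma cdybe_op_lll k : op1 Pl v = v -> op2 Pl v = v -> op3 Pl v = v ->
  cdybe_op k v = (k == 0%N)%:R *: v.
Proof.
move=> s1 s2 s3.
rewrite (@cdybe_op_act true true true _ _ _ k s1 s2 s3 acts_x2 acts_x3 acts_x4).
by rewrite (cdybe_lll I2 _ y_sum).
Qed.

Let acts_opp i (f g : {linear M -> M}) : acts 'X_i f -> f v + g v = 0 ->
  (forall j w, g (basic_op j w) = basic_op j (g w)) -> acts (- 'X_i) g.
Proof.
move=> af fg gX; apply: acts_base => //; rewrite mactN.
have := af 1; rewrite mulr1 mact1 => ->; apply/eqP.
by rewrite eq_sym -addr_eq0 addrC fg.
Qed.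

Lemma cdybe_op_luu k : op1 Pl v = v -> op2 Pu v = v -> op3 Pu v = v ->
  op2 C v + op3 C v = 0 -> cdybe_op k v = (k == 0%N)%:R *: v.
Proof.
move=> s1 s2 s3 Cv.
have G3 : acts (- x 3) (op3 C).
  by apply: (acts_opp (f := op2 C) (g := op3 C)) => // j w; apply: op3_basicC.
rewrite (@cdybe_op_act true false false _ _ _ k s1 s2 s3 acts_x2 acts_x3 G3).
by rewrite (cdybe_luu I2 _ y_sum).
Qed.

Lemma cdybe_op_ulu k : op1 Pu v = v -> op2 Pl v = v -> op3 Pu v = v ->
  op3 C v + op1 C v = 0 -> cdybe_op k v = (k == 0%N)%:R *: v.
Proof.
move=> s1 s2 s3 Cv.
have G1 : acts (- x 4) (op1 C).
  by apply: (acts_opp (f := op3 C) (g := op1 C)) => // j w; apply: op1_basicC.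
rewrite (@cdybe_op_act false true false _ _ _ k s1 s2 s3 G1 acts_x3 acts_x4).
by rewrite cdybe_rot (cdybe_luu I2 _ y_sum2).
Qed.

Lemma cdybe_op_uul k : op1 Pu v = v -> op2 Pu v = v -> op3 Pl v = v ->
  op1 C v + op2 C v = 0 -> cdybe_op k v = (k == 0%N)%:R *: v.
Proof.
move=> s1 s2 s3 Cv.
have G2 : acts (- x 2) (op2 C).
  by apply: (acts_opp (f := op1 C) (g := op2 C)) => // j w; apply: op2_basicC.
rewrite (@cdybe_op_act false false true _ _ _ k s1 s2 s3 acts_x2 G2 acts_x4).
by rewrite cdybe_rot cdybe_rot (cdybe_luu I2 _ y_sum3).
Qed.

Lemma cdybe_op_uuu k : op1 Pu v = v -> op2 Pu v = v -> op3 Pu v = v ->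
  op1 C (op2 C v) + op2 C (op3 C v) + op3 C (op1 C v) + v = 0 ->
  cdybe_op k v = (k == 0%N)%:R *: v.
Proof.
move=> s1 s2 s3 Cv.
rewrite (@cdybe_op_act false false false _ _ _ k s1 s2 s3 acts_x2 acts_x3 acts_x4).
have [w ->] := cdybe_uuu (@mpolyC 5 K) (x 2) (x 3) (x 4) I2 y_sum.
rewrite mactD mactN -fps1 act_delta.
suff -> : act (w k * (x 2 * x 3 + x 3 * x 4 + x 4 * x 2 + 1)) = 0 by rewrite subr0.
(* Known at [v], the Cayley relation kills the whole orbit, so it absorbs the unspecified factor
   [w k]. *)
have rel0 : acts (x 2 * x 3 + x 3 * x 4 + x 4 * x 2 + 1) (\0 : {linear M -> M}).
  apply: acts_base => [i u|]; first by rewrite linear0.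
  by rewrite !mactD !(mact_var _ basic_opC) !act_x mact1.
by rewrite mulrC rel0.
Qed.

End Components.

End OperatorIdentity.

(** * Lie algebras in coordinates *)

Section Coordinates.
Variable K : fieldType.
Implicit Types V W : vectType K.

Lemma crd_sum V (x : V) : x = \sum_i crd i x *: bvec i.
Proof. by rewrite {1}(coord_vbasis (memvf x)). Qed.

Lemma crdD V i (x y : V) : crd i (x + y) = crd i x + crd i y.
Proof. by rewrite /crd linearD. Qed.
Lemma crdN V i (x : V) : crd i (- x) = - crd i x.
Proof. by rewrite /crd linearN. Qed.
Lemma crd0 V i : crd i (0 : V) = 0.
Proof. by rewrite /crd linear0. Qed.

Lemma crd_bvec V i j : crd i (bvec j : V) = (i == j)%:R.
Proof.
by rewrite /crd /bvec (coord_free j i (basis_free (vbasisP fullv))) eq_sym.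
Qed.

Lemma linear_crd V W (f : V -> W) : linear f ->
  forall x, f x = \sum_i crd i x *: f (bvec i).
Proof.
move=> fL; pose F := GRing.isLinear.Build K V W *:%R f fL.
pose f' : {linear V -> W} := HB.pack f F.
move=> x; rewrite -[f]/(f' : V -> W) {1}(crd_sum x) linear_sum.
by apply: eq_bigr => i _; rewrite linearZ.
Qed.

Lemma crd_linear V W (f : V -> W) : linear f ->
  forall i x, crd i (f x) = \sum_j mx_of f i j * crd j x.
Proof.
move=> fL i x; rewrite (linear_crd fL) /crd linear_sum.
by apply: eq_bigr => j _; rewrite linearZ mxE mulrC.
Qed.

Lemma mx_of_comp (U V W : vectType K) (f : V -> W) (h : U -> V) : linear f ->
  mx_of (f \o h) = mx_of f *m mx_of h.
Proof.
move=> fL; apply/matrixP => i j; rewrite !mxE /= (crd_linear fL).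
by apply: eq_bigr => k _; rewrite [mx_of h _ _]mxE.
Qed.

Lemma mx_of_ext V W (f h : V -> W) : f =1 h -> mx_of f = mx_of h.
Proof. by move=> fh; apply/matrixP => i j; rewrite !mxE fh. Qed.

Lemma mx_of_id V : mx_of (idfun : V -> V) = 1%:M.
Proof. by apply/matrixP => i j; rewrite !mxE crd_bvec. Qed.

Lemma mx_of_0 V W : mx_of (fun _ : V => 0 : W) = 0.
Proof. by apply/matrixP => i j; rewrite !mxE crd0. Qed.

Lemma mx_ofD V W (f h : V -> W) : mx_of (fun x => f x + h x) = mx_of f + mx_of h.
Proof. by apply/matrixP => i j; rewrite !mxE crdD. Qed.

Lemma mx_ofN V W (f : V -> W) : mx_of (fun x => - f x) = - mx_of f.
Proof. by apply/matrixP => i j; rewrite !mxE crdN. Qed.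

End Coordinates.

(** * Brackets, projections and the extension of the Cayley endomorphism *)

Section Splitting.
Variables (K : fieldType) (g : vectType K) (br : g -> g -> g) (l u : {vspace g}).
Hypotheses (g_lie : lie_bracket br) (g_split : lie_splitting br l u).

Local Notation L := (subvs_of l).
Local Notation U := (subvs_of u).

Lemma br_linl z : linear (br^~ z).
Proof. by move=> a x y; apply: lie_linl. Qed.
Lemma br_linr z : linear (br z).
Proof. by move=> a x y; apply: lie_linr. Qed.

Lemma brDl x y z : br (x + y) z = br x z + br y z.
Proof. by have := lie_linl g_lie 1 x y z; rewrite !scale1r. Qed.
Lemma brDr x y z : br z (x + y) = br z x + br z y.
Proof. by have := lie_linr g_lie 1 x y z; rewrite !scale1r. Qed.
Lemma br0l z : br 0 z = 0.
Proof. by apply: (addrI (br 0 z)); rewrite addr0 -brDl addr0. Qed.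
Lemma br0r z : br z 0 = 0.
Proof. by apply: (addrI (br z 0)); rewrite addr0 -brDr addr0. Qed.
Lemma brNl x z : br (- x) z = - br x z.
Proof. by apply: (addrI (br x z)); rewrite -brDl !subrr br0l. Qed.
Lemma brNr x z : br z (- x) = - br z x.
Proof. by apply: (addrI (br z x)); rewrite -brDr !subrr br0r. Qed.

Lemma brC x y : br x y = - br y x.
Proof.
apply/eqP; rewrite -addr_eq0; apply/eqP.
by have := lie_alt g_lie (x + y); rewrite brDl !brDr !(lie_alt g_lie) addr0 add0r.
Qed.

Lemma br_der x y z : br x (br y z) = br (br x y) z + br y (br x z).
Proof.
have /eqP := lie_jacobi g_lie x y z; rewrite -addrA addr_eq0 => /eqP ->.
by rewrite (brC z x) (brC z (br x y)) brNr opprD !opprK addrC.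
Qed.

Let cap_lu : (l :&: u)%VS = 0%VS := split_cap g_split.
Let cap_ul : (u :&: l)%VS = 0%VS. Proof. by rewrite capvC. Qed.

Definition pr_l (x : g) : g := daddv_pi l u x.
Definition pr_u (x : g) : g := daddv_pi u l x.

Lemma pr_l_mem x : pr_l x \in l. Proof. exact: memv_pi. Qed.
Lemma pr_u_mem x : pr_u x \in u. Proof. exact: memv_pi. Qed.
Lemma pr_lE x : x \in l -> pr_l x = x. Proof. exact: daddv_pi_id. Qed.
Lemma pr_uE x : x \in u -> pr_u x = x. Proof. exact: daddv_pi_id. Qed.

Lemma pr_sum x : pr_l x + pr_u x = x.
Proof. by rewrite /pr_l /pr_u daddv_pi_add ?(split_add g_split) ?memvf. Qed.

Lemma pr_l_u x : x \in u -> pr_l x = 0.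
Proof. by move=> xu; apply: (addIr (pr_u x)); rewrite pr_sum add0r pr_uE. Qed.
Lemma pr_u_l x : x \in l -> pr_u x = 0.
Proof. by move=> xl; apply: (addrI (pr_l x)); rewrite pr_sum addr0 pr_lE. Qed.

Lemma pr_l_linear : linear pr_l. Proof. by move=> a x y; apply: linearP. Qed.
Lemma pr_u_linear : linear pr_u. Proof. by move=> a x y; apply: linearP. Qed.

Lemma val_proj_l x : vsval (proj_along l u x) = pr_l x.
Proof. by rewrite /proj_along vsprojK // pr_l_mem. Qed.
Lemma val_proj_u x : vsval (proj_along u l x) = pr_u x.
Proof. by rewrite /proj_along vsprojK // pr_u_mem. Qed.

Lemma br_lu x y : x \in l -> y \in u -> br x y \in u.
Proof. exact: (split_lu g_split). Qed.
Lemma br_ll x y : x \in l -> y \in l -> br x y \in l.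
Proof. exact: (split_ll g_split). Qed.

Lemma pr_l_br x y : x \in l -> pr_l (br x y) = br x (pr_l y).
Proof.
move=> xl; rewrite -{1}(pr_sum y) brDr.
have := pr_l_linear 1 (br x (pr_l y)) (br x (pr_u y)); rewrite !scale1r => ->.
by rewrite (pr_lE (br_ll xl (pr_l_mem y))) (pr_l_u (br_lu xl (pr_u_mem y))) addr0.
Qed.

Lemma pr_u_br x y : x \in l -> pr_u (br x y) = br x (pr_u y).
Proof.
move=> xl; rewrite -{1}(pr_sum y) brDr.
have := pr_u_linear 1 (br x (pr_l y)) (br x (pr_u y)); rewrite !scale1r => ->.
by rewrite (pr_u_l (br_ll xl (pr_l_mem y))) (pr_uE (br_lu xl (pr_u_mem y))) add0r.
Qed.

Variable C : 'End(U).
Hypothesis C_cayley : cayley_endo br l C.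

(** Extending [C] by zero on [l] lets all the operators be matrices on [g]. *)
Definition ext_C (x : g) : g := vsval (C (proj_along u l x)).

Lemma ext_C_linear : linear ext_C.
Proof. by move=> a x y; rewrite /ext_C /proj_along !linearP. Qed.

Lemma ext_C_mem x : ext_C x \in u. Proof. exact: subvsP. Qed.

Lemma ext_C_val (x : U) : ext_C (vsval x) = vsval (C x).
Proof.
congr (vsval (C _)); apply: val_inj; rewrite /= val_proj_u.
by rewrite pr_uE // subvsP.
Qed.

Lemma ext_C_pr x : ext_C (pr_u x) = ext_C x.
Proof. by rewrite -val_proj_u ext_C_val. Qed.

Lemma ext_C_br x y : x \in l -> ext_C (br x y) = br x (ext_C y).
Proof.
move=> xl; rewrite -(ext_C_pr (br x y)) (pr_u_br _ xl).
transitivity (pr_u (br x (ext_C y))).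
  have /(congr1 vsval) := cayley_lmod C_cayley (Subvs xl) (proj_along u l y).
  by rewrite /ad_u [RHS]val_proj_u /= val_proj_u => E; exact: E.
by rewrite pr_uE //; apply: br_lu => //; apply: subvsP.
Qed.

Lemma ext_C_cayley x y :
  pr_u (br (ext_C x) (ext_C y)) =
  ext_C (br (ext_C x) (pr_u y)) + ext_C (br (pr_u x) (ext_C y))
  - pr_u (br (pr_u x) (pr_u y)).
Proof.
have := cayley_eq C_cayley (proj_along u l x) (proj_along u l y).
move=> /= /(congr1 vsval); rewrite linearB linearD /= !val_proj_u => E.
by rewrite /ext_C E.
Qed.

End Splitting.

Section ConstantMatrices.
Variables (K : fieldType) (L : vectType K).

Lemma symCE (c : K) (x : sym L) : c *: x = symC L c * x.
Proof. by rewrite /symC mul_mpolyC. Qed.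

Lemma mxCM p q r (A : 'M[K]_(p, q)) (B : 'M[K]_(q, r)) :
  mxC L (A *m B) = mxC L A *m mxC L B.
Proof. exact: (map_mxM (@mpolyC _ K)). Qed.
Lemma mxCD p q (A B : 'M[K]_(p, q)) : mxC L (A + B) = mxC L A + mxC L B.
Proof. exact: (map_mxD (@mpolyC _ K)). Qed.
Lemma mxCN p q (A : 'M[K]_(p, q)) : mxC L (- A) = - mxC L A.
Proof. exact: (map_mxN (@mpolyC _ K)). Qed.
Lemma mxC0 p q : mxC L (0 : 'M[K]_(p, q)) = 0.
Proof. exact: (map_mx0 (@mpolyC _ K)). Qed.
Lemma mxC1 p : mxC L (1%:M : 'M[K]_p) = 1%:M.
Proof. exact: (map_mx1 (@mpolyC _ K)). Qed.
Lemma mxCT p q (A : 'M[K]_(p, q)) : (mxC L A)^T = mxC L A^T.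
Proof. by rewrite /mxC map_trmx. Qed.
Lemma mxCE p q (A : 'M[K]_(p, q)) i j : mxC L A i j = symC L (A i j).
Proof. by rewrite mxE. Qed.

Lemma symCM a b : symC L (a * b) = symC L a * symC L b.
Proof. exact: (rmorphM (@mpolyC _ K)). Qed.
Lemma symCD a b : symC L (a + b) = symC L a + symC L b.
Proof. exact: (rmorphD (@mpolyC _ K)). Qed.
Lemma symCN a : symC L (- a) = - symC L a.
Proof. exact: (rmorphN (@mpolyC _ K)). Qed.
Lemma symC0 : symC L 0 = 0. Proof. exact: (rmorph0 (@mpolyC _ K)). Qed.
Lemma symC_sum (J : Type) (r : seq J) (P : pred J) (F : J -> K) :
  symC L (\sum_(i <- r | P i) F i) = \sum_(i <- r | P i) symC L (F i).
Proof. exact: (rmorph_sum (@mpolyC _ K)). Qed.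

End ConstantMatrices.

Lemma mderiv_var (K : fieldType) n (p q : 'I_n) :
  mderiv p ('X_q : {mpoly K[n]}) = (p == q)%:R.
Proof.
rewrite mderivX mnm1E eq_sym; have [->|_] := eqVneq p q; last by rewrite scale0r.
have -> : (U_(q) - U_(q))%MM = 0%MM :> 'X_{1..n}.
  by apply/mnmP => i; rewrite mnmBE subnn mnm0E.
by rewrite mpolyX0 scale1r.
Qed.

(** * The invariant tensor [t] and [Z] *)

Section InvariantTensor.
Variables (K : numFieldType) (g : vectType K) (br : g -> g -> g) (l : {vspace g}).
Variable t : 'M[K]_(\dim {:g}).
Hypotheses (g_lie : lie_bracket br) (t_inv : inv_sym2 br t).

Local Notation L := (subvs_of l).
Local Notation n := (\dim {:g}).
Local Notation d := (\dim {:L}).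
Local Notation S := (sym L).
Local Notation M := (tensor3 K d n).
Local Notation T := (mxC L t).
Local Notation cst f := (mxC L (mx_of f)).

Lemma T_sym : T^T = T.
Proof. by rewrite mxCT; case: t_inv => ->. Qed.

Lemma T_symE i j : T i j = T j i.
Proof. by rewrite -{1}T_sym mxE. Qed.

(** An equation [B T = T B'^T] says that [B'] is the adjoint of [B] with respect to [t]; invariance
    makes [- ad x] the adjoint of [ad x]. *)
Lemma ad_T x : cst (br x) *m T = T *m (cst (fun y => - br x y))^T.
Proof.
case: t_inv => _ /(_ x); rewrite /tder2 => /eqP; rewrite addr_eq0 => /eqP E.
rewrite -mxCM E mx_ofN mxCT -mxCM; congr (mxC _ _).
by rewrite linearN /= mulmxN.
Qed.

(** Writing [t] as a sum of [x (x) x'], and a second copy as a sum of [y (x) y'], this is the sum of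
    [phi(x, y) (x) x' (x) y']. Slot operators can be moved inside [phi], which reduces identities of
    tensors to identities between bilinear maps. *)
Definition contr (phi : g -> g -> g) : M := [ffun p => \sum_q \sum_r
  symC L (crd p.1.1 (phi (bvec q) (bvec r))) * (T q p.1.2 * T r p.2)].

Lemma contrE phi a b c : contr phi (a, b, c) =
  \sum_q \sum_r symC L (crd a (phi (bvec q) (bvec r))) * (T q b * T r c).
Proof. by rewrite ffunE. Qed.

Lemma contr_ext phi psi : (forall x y, phi x y = psi x y) -> contr phi = contr psi.
Proof.
move=> E; apply: tensor3P => a b c; rewrite !contrE.
by apply: eq_bigr => q _; apply: eq_bigr => r _; rewrite E.
Qed.

Lemma contrD phi psi : contr (fun x y => phi x y + psi x y) = contr phi + contr psi.
Proof.
apply: tensor3P => a b c; rewrite !ffunE -big_split; apply: eq_bigr => q _ /=.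
by rewrite -big_split; apply: eq_bigr => r _ /=; rewrite crdD symCD mulrDl.
Qed.

Lemma contrN phi : contr (fun x y => - phi x y) = - contr phi.
Proof.
apply: tensor3P => a b c; rewrite !ffunE -sumrN; apply: eq_bigr => q _ /=.
by rewrite -sumrN; apply: eq_bigr => r _ /=; rewrite crdN symCN mulNr.
Qed.

Lemma contr0 : contr (fun _ _ => 0) = 0.
Proof.
apply: tensor3P => a b c; rewrite !ffunE big1 // => q _; rewrite big1 // => r _.
by rewrite crd0 symC0 mul0r.
Qed.

Lemma op1_contr (A : g -> g) phi : linear A ->
  op1 (cst A) (contr phi) = contr (fun x y => A (phi x y)).
Proof.
move=> AL; apply: tensor3P => a b c; rewrite opE contrE.
under eq_bigr do rewrite contrE mulr_sumr; rewrite exchange_big /=.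
apply: eq_bigr => q _; under eq_bigr do rewrite mulr_sumr.
rewrite exchange_big /=; apply: eq_bigr => r _.
rewrite (crd_linear AL) symC_sum mulr_suml; apply: eq_bigr => i _.
by rewrite !mxCE mulrA symCM.
Qed.

Lemma crd_comp_linear (B : g -> g) (psi : g -> g) a p : linear psi ->
  \sum_q crd a (psi (bvec q)) * mx_of B q p = crd a (psi (B (bvec p))).
Proof.
move=> psiL; rewrite (crd_linear psiL); apply: eq_bigr => q _.
by rewrite !mxE.
Qed.

(** [BX] acts on the outer leg of the first copy of [t]; its adjoint acts on the inner leg, which is
    the first argument of [phi]. *)
Lemma op2_contr BX (B : g -> g) phi : (forall y, linear (phi^~ y)) ->
  BX *m T = T *m (cst B)^T -> op2 BX (contr phi) = contr (fun x y => phi (B x) y).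
Proof.
move=> phiL BT; apply: tensor3P => a b c; rewrite opE contrE.
transitivity (\sum_q \sum_r symC L (crd a (phi (bvec q) (bvec r)))
    * ((BX *m T) b q * T r c)).
  under eq_bigr do rewrite contrE mulr_sumr; rewrite exchange_big /=.
  apply: eq_bigr => q _; under eq_bigr do rewrite mulr_sumr.
  rewrite exchange_big /=; apply: eq_bigr => r _.
  rewrite [(BX *m _) _ _]mxE mulr_suml mulr_sumr; apply: eq_bigr => i _.
  by rewrite (T_symE q i) mulrCA; congr (_ * _); rewrite mulrA.
rewrite BT exchange_big [RHS]exchange_big /=; apply: eq_bigr => r _.
under eq_bigr do rewrite [(_ *m _) _ _]mxE mulr_suml mulr_sumr.
rewrite exchange_big /=; apply: eq_bigr => p _.
rewrite -(crd_comp_linear B a p (phiL _)) symC_sum mulr_suml; apply: eq_bigr => q _.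
by rewrite [(_^T) _ _]mxE [cst _ _ _]mxCE symCM (T_symE p b) -!mulrA;
  congr (_ * _); rewrite mulrCA.
Qed.

Lemma op3_contr BX (B : g -> g) phi : (forall x, linear (phi x)) ->
  BX *m T = T *m (cst B)^T -> op3 BX (contr phi) = contr (fun x y => phi x (B y)).
Proof.
move=> phiL BT; apply: tensor3P => a b c; rewrite opE contrE.
transitivity (\sum_q \sum_r symC L (crd a (phi (bvec q) (bvec r)))
    * (T q b * (BX *m T) c r)).
  under eq_bigr do rewrite contrE mulr_sumr; rewrite exchange_big /=.
  apply: eq_bigr => q _; under eq_bigr do rewrite mulr_sumr.
  rewrite exchange_big /=; apply: eq_bigr => r _.
  rewrite [(BX *m _) _ _]mxE !mulr_sumr; apply: eq_bigr => i _.
  by rewrite (T_symE r i) mulrCA; congr (_ * _); rewrite mulrCA.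
rewrite BT; apply: eq_bigr => q _.
under eq_bigr do rewrite [(_ *m _) _ _]mxE !mulr_sumr.
rewrite exchange_big /=; apply: eq_bigr => p _.
rewrite -(crd_comp_linear B a p (phiL _)) symC_sum mulr_suml; apply: eq_bigr => r _.
by rewrite [(_^T) _ _]mxE [cst _ _ _]mxCE symCM (T_symE p c) -!mulrA;
  congr (_ * _); rewrite mulrC -mulrA mulrC -mulrA.
Qed.

Definition Z_tensor : M := [ffun p => br_12_23 br T T p.1.1 p.1.2 p.2].

Lemma Z_tensorE a b c : Z_tensor (a, b, c) = br_12_23 br T T a b c.
Proof. by rewrite ffunE. Qed.

Lemma str_cstC a i j : str_cst br a i j = - str_cst br a j i.
Proof. by rewrite /str_cst (brC g_lie) crdN. Qed.

Lemma br_12_13_contr a b c : br_12_13 br T T a b c = contr br (a, b, c).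
Proof.
rewrite contrE; apply: eq_bigr => i _; apply: eq_bigr => j _.
by rewrite symCE.
Qed.

(** Invariance of [t] gives [[t^{1,2}, t^{1,3} + t^{2,3}] = 0]. *)
Lemma br_12_13_Z a b c : br_12_13 br T T a b c = - Z_tensor (a, b, c).
Proof.
rewrite Z_tensorE /br_12_13 /br_12_23 exchange_big [in RHS]exchange_big -sumrN /=.
apply: eq_bigr => j _.
transitivity (- (cst (br (bvec j)) *m T) a b * T j c).
  rewrite [(_ *m _) _ _]mxE -sumrN mulr_suml; apply: eq_bigr => i _.
  rewrite [cst _ _ _]mxCE [mx_of _ _ _]mxE symCE str_cstC symCN !mulNr.
  by rewrite -[in RHS]mulrA.
rewrite ad_T [(_ *m _) _ _]mxE -!sumrN mulr_suml; apply: eq_bigr => i _.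
rewrite [(_^T) _ _]mxE [cst _ _ _]mxCE [mx_of _ _ _]mxE crdN -/(str_cst br b j i)
  symCN symCE.
by rewrite (str_cstC b i j) symCN mulrN opprK mulNr opprK [_ * symC _ _]mulrC mulrA.
Qed.

Lemma Z_contr : Z_tensor = - contr br.
Proof.
by apply: tensor3P => a b c; rewrite [RHS]ffunE -br_12_13_contr br_12_13_Z opprK.
Qed.

Lemma Z_contr_op (A B D : g -> g) BX DX :
  linear A -> linear B -> linear D ->
  BX *m T = T *m (cst B)^T -> DX *m T = T *m (cst D)^T ->
  op1 (cst A) (op2 BX (op3 DX Z_tensor)) = - contr (fun x y => A (br (B x) (D y))).
Proof.
move=> AL BL DL BT DT; rewrite Z_contr !linearN; congr (- _) => /=.
rewrite (op3_contr (B := D)) //; last by move=> x; apply: br_linr.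
rewrite (op2_contr (B := B)) //; last first.
  by move=> y a x z; apply: (br_linl g_lie).
by rewrite op1_contr.
Qed.

Definition trot (w : M) : M := [ffun p => w (p.1.2, p.2, p.1.1)].

Lemma trotE w a b c : trot w (a, b, c) = w (b, c, a).
Proof. by rewrite ffunE. Qed.

Lemma trot_op1 A w : trot (op1 A w) = op2 A (trot w).
Proof. by apply: tensor3P => a b c; rewrite trotE !opE; apply: eq_bigr => i _;
  rewrite trotE. Qed.
Lemma trot_op2 A w : trot (op2 A w) = op3 A (trot w).
Proof. by apply: tensor3P => a b c; rewrite trotE !opE; apply: eq_bigr => i _;
  rewrite trotE. Qed.
Lemma trot_op3 A w : trot (op3 A w) = op1 A (trot w).
Proof. by apply: tensor3P => a b c; rewrite trotE !opE; apply: eq_bigr => i _;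
  rewrite trotE. Qed.
Lemma trotD w w' : trot (w + w') = trot w + trot w'.
Proof. by apply: tensor3P => a b c; rewrite !ffunE. Qed.
Lemma trot0 : trot 0 = 0.
Proof. by apply: tensor3P => a b c; rewrite !ffunE. Qed.

Lemma trot_sum m (w : 'I_m -> M) : trot (\sum_i w i) = \sum_i trot (w i).
Proof. exact: (big_morph trot trotD trot0). Qed.

(** Both sides bracket in the slot indexed by [c], one through [[t^{1,2}, t^{2,3}]] and the other
    through [- [t^{1,2}, t^{1,3}]]; antisymmetry of the bracket and symmetry of [t] identify
    them. *)
Lemma Z_swap a b c : Z_tensor (b, c, a) = Z_tensor (c, a, b).
Proof.
rewrite [in RHS]Z_contr [RHS]ffunE -br_12_13_contr Z_tensorE /br_12_23 /br_12_13.
rewrite exchange_big -sumrN; apply: eq_bigr => i _ /=; rewrite -sumrN.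
apply: eq_bigr => j _; rewrite str_cstC scaleNr; congr (- (_ *: _)).
by rewrite mulrC (T_symE b).
Qed.

Lemma Z_rotE a b c : Z_tensor (b, c, a) = Z_tensor (a, b, c).
Proof. by rewrite Z_swap Z_swap. Qed.

Lemma Z_rot : trot Z_tensor = Z_tensor.
Proof. by apply: tensor3P => a b c; rewrite trotE Z_rotE. Qed.

Lemma br_13_23_Z a b c : br_13_23 br T T a b c = - Z_tensor (a, b, c).
Proof.
rewrite -Z_rotE Z_tensorE /br_13_23 /br_12_23 exchange_big -sumrN.
apply: eq_bigr => i _ /=; rewrite -sumrN; apply: eq_bigr => j _.
by rewrite str_cstC scaleNr mulrC (T_symE j).
Qed.

(** Once the operators are inside the contraction, this is the Jacobi identity. *)
Lemma ad_Z x : op1 (cst (br x)) Z_tensor + op2 (cst (br x)) Z_tensor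
  + op3 (cst (br x)) Z_tensor = 0.
Proof.
have NL : linear (fun y => - br x y).
  by move=> a y z; rewrite (br_linr g_lie) opprD scalerN.
rewrite Z_contr !linearN /= -!opprD op1_contr; last exact: br_linr.
rewrite (op2_contr (B := fun y => - br x y)); last exact: ad_T; last first.
  by move=> y a z z'; apply: (br_linl g_lie).
rewrite (op3_contr (B := fun y => - br x y)); last exact: ad_T; last first.
  by move=> y; apply: br_linr.
rewrite -!contrD -contrN -[RHS]contr0; apply: contr_ext => a b.
by rewrite (brNl g_lie) (brNr g_lie) (br_der g_lie x a b) addrAC addrK subrr oppr0.
Qed.

Section Scaling.
Variables (x : S) (A B : 'M[S]_n) (a b c : 'I_n).

Lemma scale_entry_mul i j p q : (x *: A) i j * (x *: B) p q = x * x * (A i j * B p q).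
Proof. by rewrite !mxE mulrACA. Qed.

Lemma br_12_13Z : br_12_13 br (x *: A) (x *: B) a b c = x * x * br_12_13 br A B a b c.
Proof.
rewrite /br_12_13 mulr_sumr; apply: eq_bigr => p _; rewrite mulr_sumr.
by apply: eq_bigr => q _; rewrite scale_entry_mul scalerAr.
Qed.
Lemma br_12_23Z : br_12_23 br (x *: A) (x *: B) a b c = x * x * br_12_23 br A B a b c.
Proof.
rewrite /br_12_23 mulr_sumr; apply: eq_bigr => p _; rewrite mulr_sumr.
by apply: eq_bigr => q _; rewrite scale_entry_mul scalerAr.
Qed.
Lemma br_13_23Z : br_13_23 br (x *: A) (x *: B) a b c = x * x * br_13_23 br A B a b c.
Proof.
rewrite /br_13_23 mulr_sumr; apply: eq_bigr => p _; rewrite mulr_sumr.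
by apply: eq_bigr => q _; rewrite scale_entry_mul scalerAr.
Qed.

End Scaling.

End InvariantTensor.

(** * The r-matrix *)

Section DerivationRelation.
Variables (X : pzRingType) (a b b' d d' : X).
Hypotheses (E : a * b - b * a + d = 0) (E' : a * b' - b' * a + d' = 0).

(** With [d = D(b)] for a derivation [D], the map [b -> [a, b] + D(b)] is again a derivation. Its
    kernel is a subring, so [l]-invariance can be transferred to series. *)
Lemma der_relD : a * (b + b') - (b + b') * a + (d + d') = 0.
Proof.
by rewrite mulrDl mulrDr opprD (addrACA (a * b)) [LHS]addrACA E E' addr0.
Qed.

Lemma der_relN : a * (- b) - (- b) * a + (- d) = 0.
Proof. by rewrite mulrN mulNr -opprD -opprD E oppr0. Qed.

Lemma der_relM : a * (b * b') - b * b' * a + (d * b' + b * d') = 0.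
Proof.
have : (a * b - b * a + d) * b' + b * (a * b' - b' * a + d') = 0.
  by rewrite E E' mul0r mulr0 addr0.
rewrite !mulrDl !mulrDr mulNr mulrN !mulrA addrACA => <-; congr (_ + _).
by rewrite addrA subrK.
Qed.

End DerivationRelation.

Section RMatrixAlgebra.
Variables (K : numFieldType) (I : K) (I2 : I * I = -1) (v : K).
Variables (g : vectType K) (br : g -> g -> g) (l u : {vspace g}).
Variables (t : 'M[K]_(\dim {:g})).
Variables (tl : 'M[K]_(\dim {:subvs_of l})) (tu : 'M[K]_(\dim {:subvs_of u})).
Variable C : 'End(subvs_of u).
Hypotheses (g_lie : lie_bracket br) (g_split : lie_splitting br l u).
Hypothesis t_inv : inv_sym2 br t.
Hypotheses (tl_sym : tl^T = tl) (tu_sym : tu^T = tu).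
Hypothesis t_dec : t = tmap2 (vsval : subvs_of l -> g) tl
                       + tmap2 (vsval : subvs_of u -> g) tu.
Hypotheses (C_cayley : cayley_endo br l C) (C_anti : tder2 C tu = 0).

Local Notation L := (subvs_of l).
Local Notation U := (subvs_of u).
Local Notation n := (\dim {:g}).
Local Notation d := (\dim {:L}).
Local Notation S := (sym L).
Local Notation W := 'M[S]_n.
Local Notation T := (mxC L t).
Local Notation cst f := (mxC L (mx_of f)).
Local Notation Z := (Z_tensor br l t).
Local Notation iL := (mx_of (vsval : L -> g)).
Local Notation iU := (mx_of (vsval : U -> g)).

Definition mPl : W := cst (pr_l l u).
Definition mPu : W := cst (pr_u l u).
Definition mC : W := cst (ext_C l C).
Definition mY : W :=
  symC L v *: act_lam_vee (fun (x : L) (y : g) => br (vsval x) y) tl.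

Lemma cst_comp (f h : g -> g) : linear f -> cst f *m cst h = cst (f \o h).
Proof. by move=> fL; rewrite -mxCM -mx_of_comp. Qed.

Lemma cst_ext (f h : g -> g) : f =1 h -> cst f = cst h.
Proof. by move=> fh; rewrite (mx_of_ext fh). Qed.

Lemma cst_0 (f : g -> g) : (forall x, f x = 0) -> cst f = 0.
Proof. by move=> /(@mx_of_ext _ _ _ f (fun=> 0)) ->; rewrite mx_of_0 mxC0. Qed.

Let PlL := @pr_l_linear K g l u.
Let PuL := @pr_u_linear K g l u.
Let CL := @ext_C_linear K g l u C.

Lemma mPl_id : mPl *m mPl = mPl.
Proof. by rewrite cst_comp //; apply: cst_ext => x /=;
  rewrite (pr_lE g_split) ?pr_l_mem. Qed.
Lemma mPu_id : mPu *m mPu = mPu.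
Proof. by rewrite cst_comp //; apply: cst_ext => x /=;
  rewrite (pr_uE g_split) ?pr_u_mem. Qed.
Lemma mPlPu : mPl *m mPu = 0.
Proof. by rewrite cst_comp //; apply: cst_0 => x /=;
  rewrite (pr_l_u g_split) ?pr_u_mem. Qed.
Lemma mPuPl : mPu *m mPl = 0.
Proof. by rewrite cst_comp //; apply: cst_0 => x /=;
  rewrite (pr_u_l g_split) ?pr_l_mem. Qed.
Lemma mP_sum : mPl + mPu = 1%:M.
Proof.
rewrite -mxCD -mx_ofD -mxC1 -mx_of_id; congr (mxC _ _).
by apply: mx_of_ext => x; rewrite (pr_sum g_split).
Qed.
Lemma mCPu : mC *m mPu = mC.
Proof. by rewrite cst_comp //; apply: cst_ext => x /=; rewrite (ext_C_pr g_split). Qed.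
Lemma mPuC : mPu *m mC = mC.
Proof. by rewrite cst_comp //; apply: cst_ext => x /=;
  rewrite (pr_uE g_split) ?ext_C_mem. Qed.
Lemma mCPl : mC *m mPl = 0.
Proof. by rewrite -mCPu -mulmxA mPuPl mulmx0. Qed.
Lemma mPlC : mPl *m mC = 0.
Proof. by rewrite -mPuC mulmxA mPlPu mul0mx. Qed.

Definition lam_coef (i : 'I_d) : S := symC L v * lam_vee tl i.

Lemma mYE : mY = \sum_i lam_coef i *: cst (br (vsval (bvec i : L))).
Proof.
by rewrite /mY /act_lam_vee scaler_sumr; apply: eq_bigr => i _; rewrite scalerA.
Qed.

Lemma mY_comm (B : W) :
  (forall x : L, cst (br (vsval x)) *m B = B *m cst (br (vsval x))) ->
  mY *m B = B *m mY.
Proof.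
move=> adB; rewrite mYE mulmx_suml mulmx_sumr; apply: eq_bigr => i _.
by rewrite -scalemxAl -scalemxAr adB.
Qed.

Let brL x : linear (br x) := br_linr g_lie x.

Lemma mYPl : mY *m mPl = mPl *m mY.
Proof.
apply: mY_comm => x; rewrite !cst_comp //; apply: cst_ext => y /=.
by rewrite (pr_l_br g_lie g_split) // subvsP.
Qed.
Lemma mYPu : mY *m mPu = mPu *m mY.
Proof.
apply: mY_comm => x; rewrite !cst_comp //; apply: cst_ext => y /=.
by rewrite (pr_u_br g_lie g_split) // subvsP.
Qed.
Lemma mYC : mY *m mC = mC *m mY.
Proof.
apply: mY_comm => x; rewrite !cst_comp //; apply: cst_ext => y /=.
by rewrite (ext_C_br g_lie g_split C_cayley) // subvsP.
Qed.

Lemma mY_T : mY *m T = T *m (- mY)^T.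
Proof.
rewrite mYE linearN /= !linear_sum mulmx_suml /=; apply: eq_bigr => i _.
rewrite -scalemxAl (ad_T l t_inv) mx_ofN mxCN !linearN /=.
by rewrite !linearZ.
Qed.

Lemma mx_pr_l_iL : mx_of (pr_l l u) *m iL = iL.
Proof.
rewrite -mx_of_comp //; apply: mx_of_ext => x /=.
by rewrite (pr_lE g_split) ?subvsP.
Qed.
Lemma mx_pr_l_iU : mx_of (pr_l l u) *m iU = 0.
Proof.
rewrite -mx_of_comp // -(mx_of_0 U g); apply: mx_of_ext => x /=.
by rewrite (pr_l_u g_split) ?subvsP.
Qed.
Lemma mx_pr_u_iU : mx_of (pr_u l u) *m iU = iU.
Proof.
rewrite -mx_of_comp //; apply: mx_of_ext => x /=.
by rewrite (pr_uE g_split) ?subvsP.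
Qed.
Lemma mx_pr_u_iL : mx_of (pr_u l u) *m iL = 0.
Proof.
rewrite -mx_of_comp // -(mx_of_0 L g); apply: mx_of_ext => x /=.
by rewrite (pr_u_l g_split) ?subvsP.
Qed.

Lemma mPl_T : mPl *m T = mxC L (tmap2 (vsval : L -> g) tl).
Proof.
rewrite -mxCM t_dec mulmxDr /tmap2 !mulmxA mx_pr_l_iL mx_pr_l_iU.
by rewrite !mul0mx addr0.
Qed.
Lemma mPu_T : mPu *m T = mxC L (tmap2 (vsval : U -> g) tu).
Proof.
rewrite -mxCM t_dec mulmxDr /tmap2 !mulmxA mx_pr_u_iL mx_pr_u_iU.
by rewrite !mul0mx add0r.
Qed.

Let Tsym := T_sym l t_inv.

Lemma mPl_Ttr : mPl *m T = T *m mPl^T.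
Proof.
rewrite -{2}Tsym -trmx_mul mPl_T mxCT; congr (mxC _ _).
by rewrite /tmap2 !trmx_mul trmxK tl_sym mulmxA.
Qed.
Lemma mPu_Ttr : mPu *m T = T *m mPu^T.
Proof.
rewrite -{2}Tsym -trmx_mul mPu_T mxCT; congr (mxC _ _).
by rewrite /tmap2 !trmx_mul trmxK tu_sym mulmxA.
Qed.

Lemma mC_T : mC *m T = T *m (- mC)^T.
Proof.
have E : mC *m T = mxC L (iU *m (mx_of C *m tu) *m iU^T).
  rewrite -mCPu -mulmxA mPu_T -mxCM /tmap2 !mulmxA; congr (mxC _ (_ *m _ *m _)).
  rewrite -!mx_of_comp //.
  by apply: mx_of_ext => x /=; rewrite (ext_C_val g_split).
rewrite linearN /= mulmxN -{2}Tsym -trmx_mul E mxCT -mxCN; congr (mxC _ _).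
rewrite !trmx_mul trmxK tu_sym [in RHS]mulmxA -mulNmx -mulmxN.
congr (_ *m _ *m _); apply/eqP; rewrite -addr_eq0; apply/eqP.
exact: C_anti.
Qed.

(** * Antisymmetry and homogeneity of the series on [g] *)

Local Notation sc := (@scal_mx K d n).
Definition mR (y : W) (k : nat) : W := r_ser sc I mC mPl mPu y k.

Lemma scal_mx_comm c (B : W) : sc c * B = B * sc c.
Proof. exact: esym (scalar_mxC _ _). Qed.

Lemma scal_mx0 : sc 0 = 0. Proof. by rewrite /scal_mx mpolyC0 raddf0. Qed.

Let base (B : W) := [\/ B = mY, B = mC, B = mPl | B = mPu].

Let base_comm B D : base B -> base D -> B * D = D * B.
Proof.
have pc : mPl *m mC = mC *m mPl by rewrite mPlC mCPl.
have uc : mPu *m mC = mC *m mPu by rewrite mPuC mCPu.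
have pu : mPl *m mPu = mPu *m mPl by rewrite mPlPu mPuPl.
case=> ->; case=> ->.
- exact: erefl. - exact: mYC. - exact: mYPl. - exact: mYPu.
- exact: esym mYC. - exact: erefl. - exact: esym pc. - exact: esym uc.
- exact: esym mYPl. - exact: pc. - exact: erefl. - exact: pu.
- exact: esym mYPu. - exact: uc. - exact: esym pu. - exact: erefl.
Qed.

Let bicomm (B : W) := forall D, (forall E, base E -> D * E = E * D) -> B * D = D * B.

(* Transposition reverses products; on the bicommutant of the commuting family
   [Y, C, Pl, Pu] it is multiplicative. *)
Let tr_rel (B B' : W) := bicomm B /\ B' = B^T.

Let tr_rel_base B : base B -> tr_rel B B^T.
Proof. by move=> bB; split=> // D ->. Qed.

Let bicomm_comm B D : bicomm B -> bicomm D -> B * D = D * B.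
Proof.
move=> cB cD; apply: cB => E bE; apply: cD => F bF.
exact: base_comm.
Qed.

Lemma mR_trmx y k : y = mY \/ y = 1 ->
  (mR y k)^T = r_ser sc I mC^T mPl^T mPu^T y^T k :> W.
Proof.
move=> yP; suff [] : tr_rel (mR y k) (r_ser sc I mC^T mPl^T mPu^T y^T k) by [].
have t1 : tr_rel 1 1 by split; [move=> D _; rewrite mul1r mulr1 | rewrite trmx1].
apply: (@rel_r_ser _ _ _ _ _ _ tr_rel) => //.
- by split; [move=> D _; rewrite mul0r mulr0 | rewrite trmx0].
- move=> a a' b b' [ca ->] [cb ->]; split; last by rewrite linearD.
  by move=> D cD; rewrite mulrDl mulrDr ca // cb.
- move=> a a' [ca ->]; split; last by rewrite linearN.
  by move=> D cD; rewrite mulNr mulrN ca.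
- move=> a a' b b' [ca ->] [cb ->]; split.
    by move=> D cD; rewrite -mulrA (cb D cD) mulrA (ca D cD) mulrA.
  by rewrite (bicomm_comm ca cb); exact: esym (trmx_mul _ _).
- move=> a; split; first by move=> D _; apply: scal_mx_comm.
  by rewrite /scal_mx tr_scalar_mx.
- by apply: tr_rel_base; constructor 2.
- by apply: tr_rel_base; constructor 3.
- by apply: tr_rel_base; constructor 4.
- by case: yP => ->; [apply: tr_rel_base; constructor 1 | rewrite [1^T]trmx1].
Qed.

(** Passing through [T] replaces [Y] and [C] by their opposites and fixes the projections, while
    [r_ser] is odd in the pair [(g, y)]. *)
Lemma mR_anti k : mR mY k *m T = - (T *m (mR mY k)^T).
Proof.
rewrite mR_trmx; last by left.
rewrite -mulmxN -(r_ser_odd _ _ _ _ _ _ scal_mx0).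
apply: (@rel_r_ser _ _ _ _ _ _ (fun B B' => B *m T = T *m B')).
- by rewrite mul0mx mulmx0.
- by rewrite [LHS]mul1mx [RHS]mulmx1.
- by move=> a a' b b' ea eb; rewrite mulmxDl mulmxDr ea eb.
- by move=> a a' ea; rewrite mulNmx mulmxN ea.
- by move=> a a' b b' ea eb; rewrite -mulmxA eb mulmxA ea mulmxA.
- by move=> a; rewrite scalar_mxC.
- by rewrite mC_T linearN.
- exact: mPl_Ttr.
- exact: mPu_Ttr.
- by rewrite mY_T linearN.
Qed.

(** The partial derivatives of [S(l)] therefore annihilate the coefficients, and in [mR_hom] only
    [mY ^+ k] is differentiated. *)
Lemma mR_const k : exists B0 : 'M[K]_n, mR 1 k = mxC L B0.
Proof.
rewrite /mR; apply: (@rel_r_ser _ W W sc sc I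
  (fun B _ => exists B0 : 'M[K]_n, B = mxC L B0) mC mC mPl mPl mPu mPu 1 1).
- by exists (0 : 'M[K]_n); rewrite mxC0.
- by exists (1%:M : 'M[K]_n); rewrite mxC1.
- by move=> a _ b _ [a0 ->] [b0 ->]; exists (a0 + b0); rewrite mxCD.
- by move=> a _ [a0 ->]; exists (- a0); rewrite mxCN.
- by move=> a _ b _ [a0 ->] [b0 ->]; exists (a0 *m b0); rewrite mxCM.
- move=> a; exists a%:M; apply/matrixP => i j; rewrite !mxE.
  by case: eqP => _; rewrite ?mulr1n ?mulr0n ?symC0.
- by exists (mx_of (ext_C l C)).
- by exists (mx_of (pr_l l u)).
- by exists (mx_of (pr_u l u)).
- by exists 1%:M; rewrite mxC1.
Qed.

Lemma mR_hom k : mR mY k = mR 1 k * mY ^+ k.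
Proof.
apply: r_ser_hom; last exact: mYPu.
- by move=> a; rewrite /GRing.comm scal_mx_comm.
- exact: mYC.
- exact: mYPl.
Qed.

Lemma mYX_T a : mY ^+ a *m T = T *m ((- mY) ^+ a)^T.
Proof.
elim: a => [|a IH]; first by rewrite !expr0 trmx1 mul1mx mulmx1.
rewrite exprS (exprSr (- mY)) -[mY * _]/(mY *m _) -mulmxA IH.
by rewrite mulmxA mY_T -mulmxA -trmx_mul.
Qed.

(** * The differential of the r-matrix *)

Definition mder (i : 'I_d) p q (B : 'M[S]_(p, q)) : 'M[S]_(p, q) :=
  map_mx (mderiv i) B.

Lemma mderM i p q r (A : 'M[S]_(p, q)) (B : 'M[S]_(q, r)) :
  mder i (A *m B) = mder i A *m B + A *m mder i B.
Proof.
apply/matrixP => a b; rewrite !mxE linear_sum /= -big_split; apply: eq_bigr => j _ /=.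
by rewrite mderivM !mxE.
Qed.

Lemma mder_const i p q (B : 'M[K]_(p, q)) : mder i (mxC L B) = 0.
Proof. by apply/matrixP => a b; rewrite !mxE mderivC. Qed.

Lemma mderZ i p q c (B : 'M[S]_(p, q)) : mder i (symC L c *: B) = symC L c *: mder i B.
Proof. by apply/matrixP => a b; rewrite !mxE -symCE mderivZ symCE. Qed.

Lemma mderX i k : mder i (mY ^+ k.+1)
  = \sum_(a < k.+1) mY ^+ (k - a) *m mder i mY *m mY ^+ a.
Proof.
elim: k => [|k IH]; first by rewrite big_ord1 expr1 !expr0 mul1mx mulmx1.
rewrite exprSr -[_ * mY]/(_ *m mY) mderM IH mulmx_suml [RHS]big_ord_recl /= [LHS]addrC.
rewrite subn0 expr0 mulmx1; congr (_ + _); apply: eq_bigr => a _.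
by rewrite /bump /= add1n subSS exprSr -[X in _ = _ *m X]/(_ *m _) mulmxA.
Qed.

Lemma mder_mY i :
  mder i mY = symC L v *: \sum_j symC L (tl i j) *: cst (br (vsval (bvec j : L))).
Proof.
rewrite /mY mderZ; congr (_ *: _); rewrite /act_lam_vee.
apply/matrixP => a b; rewrite !mxE !summxE linear_sum /=.
apply: eq_bigr => j _; rewrite !mxE /symC mderivM mderivC mulr0 addr0; congr (_ * _).
rewrite linear_sum (bigD1 i) //= big1 ?addr0 => [|p pi].
  by rewrite linearZ /= mderiv_var eqxx alg_mpolyC.
by rewrite linearZ /= mderiv_var eq_sym (negPf pi) scaler0.
Qed.

Lemma op12_mx (A B : W) (F : 'I_n -> W) (w : tensor3 K d n) a b c :
  (forall a b c, w (a, b, c) = F c a b) ->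
  op1 A (op2 B w) (a, b, c) = (A *m F c *m B^T) a b.
Proof.
move=> wF; rewrite opE -mulmxA [RHS]mxE; apply: eq_bigr => p _; congr (_ * _).
rewrite opE mxE; apply: eq_bigr => q _.
by rewrite wF mulrC [(_^T) _ _]mxE.
Qed.

(** Differentiating [ad(lambda^vee)] and pairing with the basis of [l] produces
    [[t_l^{1,3}, t^{1,2}]], which is the projection to [l] in slot 3 of [- [t^{1,2}, t^{1,3}] =
    Z]. *)
Lemma op3_Pl_Z a b c : op3 mPl Z (a, b, c) =
  \sum_i symC L (crd c (vsval (bvec i : L)))
    * ((\sum_j symC L (tl i j) *: cst (br (vsval (bvec j : L)))) *m T) a b.
Proof.
have tlE p q : mxC L (tmap2 (vsval : L -> g) tl) p q
    = \sum_i \sum_j symC L (crd p (vsval (bvec i : L)) * tl i j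
                             * crd q (vsval (bvec j : L))).
  rewrite mxCE /tmap2 mxE symC_sum exchange_big /=; apply: eq_bigr => j _.
  rewrite !mxE mulr_suml symC_sum; apply: eq_bigr => i _.
  by rewrite !mxE.
have ZE : op3 mPl Z (a, b, c) = \sum_i \sum_j symC L (str_cst br a j i)
   * (T i b * mxC L (tmap2 (vsval : L -> g) tl) c j).
  rewrite opE; transitivity (\sum_k mPl c k * - br_12_13 br T T a b k).
    by apply: eq_bigr => k _; rewrite (br_12_13_Z l g_lie t_inv) opprK.
  rewrite /br_12_13; under eq_bigr do rewrite -sumrN mulr_sumr.
  rewrite exchange_big /=; apply: eq_bigr => i _.
  under eq_bigr do rewrite -sumrN mulr_sumr.
  rewrite exchange_big /=; apply: eq_bigr => j _.
  rewrite -mPl_T [(mPl *m T) _ _]mxE !mulr_sumr; apply: eq_bigr => k _.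
  rewrite (T_symE l t_inv k j) symCE (str_cstC g_lie a i j) symCN.
  by rewrite mulNr opprK mulrCA; congr (_ * _); rewrite mulrCA.
rewrite ZE.
under eq_bigr => i _ do under eq_bigr => j _ do rewrite tlE 2!mulr_sumr.
under [RHS]eq_bigr => i _ do rewrite mulmx_suml summxE mulr_sumr.
under eq_bigr => i _ do rewrite exchange_big /=.
rewrite exchange_big /=; apply: eq_bigr => i _.
under eq_bigr => p _ do under eq_bigr => q _ do rewrite 2!mulr_sumr.
under eq_bigr => p _ do rewrite exchange_big /=.
rewrite exchange_big /=; apply: eq_bigr => j _.
rewrite -scalemxAl !mxE !mulr_sumr; apply: eq_bigr => p _.
have -> : cst (br (vsval (bvec j : L))) a p
    = \sum_q symC L (crd q (vsval (bvec j : L)) * str_cst br a q p).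
  rewrite mxCE mxE (linear_crd (br_linl g_lie (bvec p))) /crd linear_sum symC_sum.
  by apply: eq_bigr => q _; rewrite linearZ.
rewrite mulr_suml !mulr_sumr; apply: eq_bigr => q _.
by rewrite !symCM; ring.
Qed.

Definition mrho (k : nat) : W := symC L v *: (mR mY k *m T).

Local Notation d_mrho k := (op1 (mR 1 k.+1) (\sum_(i < k.+1)
  op1 (mY ^+ (k - i)) (op2 ((- mY) ^+ i) (op3 mPl Z)))).

(** One factor [v] belongs to [mrho], the other comes from differentiating [Y = v ad(lambda^vee)];
    so the linear term scales by [v * v], just as the quadratic one does. *)
Lemma dform_mrho k a b c :
  dform mrho k a b c = symC L (v * v) * d_mrho k (a, b, c).
Proof.
pose X i := \sum_j symC L (tl i j) *: cst (br (vsval (bvec j : L))).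
pose A (a : 'I_k.+1) := mR 1 k.+1 *m mY ^+ (k - a).
have D i : mder i (mrho k.+1) = symC L (v * v) *:
    \sum_(a < k.+1) A a *m (X i *m T) *m ((- mY) ^+ a)^T.
  rewrite /mrho mderZ symCM -scalerA; congr (_ *: _).
  rewrite mderM mder_const mulmx0 addr0 mR_hom mderM; have [B0 E] := mR_const k.+1.
  rewrite {1}E mder_const mul0mx add0r mderX mulmx_sumr mulmx_suml scaler_sumr.
  apply: eq_bigr => j _; rewrite mder_mY -/(X i) -scalemxAr -scalemxAl.
  by rewrite -!scalemxAr -!scalemxAl /A -!mulmxA mYX_T.
transitivity (symC L (v * v) * \sum_i symC L (crd c (vsval (bvec i : L)))
   * \sum_(j < k.+1) (A j *m (X i *m T) *m ((- mY) ^+ j)^T) a b).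
  rewrite /dform mulr_sumr; apply: eq_bigr => i _; rewrite symCE mulrCA.
  congr (_ * _); have := congr1 (fun B : W => B a b) (D i).
  by rewrite [LHS]mxE [RHS]mxE summxE.
congr (_ * _); rewrite linear_sum sum_ffunE.
under eq_bigr do rewrite mulr_sumr.
rewrite exchange_big /=; apply: eq_bigr => j _.
case: (slot_op1 K d n) => _ _ _ opM _; rewrite -opM.
rewrite (op12_mx _ _ (F := fun c =>
   \sum_i symC L (crd c (vsval (bvec i : L))) *: (X i *m T))).
  rewrite mulmx_sumr mulmx_suml summxE; apply: eq_bigr => i _.
  by rewrite -scalemxAr -scalemxAl [RHS]mxE.
move=> a' b' c'; rewrite op3_Pl_Z summxE; apply: eq_bigr => i _.
by rewrite [RHS]mxE.
Qed.

(** The bracket occupies slot 1, so [A] and [B] must leave it for the slots 2 and 3. Their two signs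
    cancel, and the remaining one is that of [[t^{1,2}, t^{1,3}] = - Z]. *)
Lemma br_12_13_op (A B : W) a b c :
  A *m T = - (T *m A^T) -> B *m T = - (T *m B^T) ->
  br_12_13 br (A *m T) (B *m T) a b c = - op2 A (op3 B Z) (a, b, c).
Proof.
move=> AT BT; rewrite /br_12_13 opE -sumrN.
transitivity (\sum_p \sum_q A b p * (B c q * br_12_13 br T T a p q)); last first.
  apply: eq_bigr => p _; rewrite opE mulr_sumr -sumrN; apply: eq_bigr => q _.
  by rewrite (br_12_13_Z l g_lie t_inv) !mulrN.
transitivity (\sum_i \sum_j \sum_p \sum_q str_cst br a i j *: (A b p * (B c q *
  (T i p * T j q)))).
  apply: eq_bigr => i _; apply: eq_bigr => j _.
  rewrite AT BT [X in X * _]mxE [X in _ * X]mxE mulrNN !mxE mulr_suml scaler_sumr.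
  apply: eq_bigr => p _; rewrite mulr_sumr scaler_sumr; apply: eq_bigr => q _.
  by congr (_ *: _); rewrite ![(_^T) _ _]mxE; ring.
rewrite /br_12_13; under eq_bigr => i _ do rewrite exchange_big /=.
rewrite exchange_big /=; apply: eq_bigr => p _.
under eq_bigr => i _ do rewrite exchange_big /=.
rewrite exchange_big /=; apply: eq_bigr => q _.
rewrite !mulr_sumr; apply: eq_bigr => i _; rewrite !mulr_sumr; apply: eq_bigr => j _.
by rewrite !symCE; ring.
Qed.

(** The bracket is in slot 3, away from [A] and [B], hence no antisymmetry is involved. *)
Lemma br_13_23_op (A B : W) a b c :
  br_13_23 br (A *m T) (B *m T) a b c = - op1 A (op2 B Z) (a, b, c).
Proof.
rewrite /br_13_23 opE -sumrN.
transitivity (\sum_p \sum_q A a p * (B b q * br_13_23 br T T p q c)); last first.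
  apply: eq_bigr => p _; rewrite opE mulr_sumr -sumrN; apply: eq_bigr => q _.
  by rewrite (br_13_23_Z l g_lie t_inv) !mulrN.
transitivity (\sum_i \sum_j \sum_p \sum_q str_cst br c i j *: (A a p * (B b q *
  (T p i * T q j)))).
  apply: eq_bigr => i _; apply: eq_bigr => j _.
  rewrite [X in X * _]mxE [X in _ * X]mxE mulr_suml scaler_sumr.
  apply: eq_bigr => p _; rewrite mulr_sumr scaler_sumr; apply: eq_bigr => q _.
  by congr (_ *: _); ring.
rewrite /br_13_23; under eq_bigr => i _ do rewrite exchange_big /=.
rewrite exchange_big /=; apply: eq_bigr => p _.
under eq_bigr => i _ do rewrite exchange_big /=.
rewrite exchange_big /=; apply: eq_bigr => q _.
rewrite !mulr_sumr; apply: eq_bigr => i _; rewrite !mulr_sumr; apply: eq_bigr => j _.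
by rewrite !symCE; ring.
Qed.

Lemma br_12_23_op (A B : W) a b c : B *m T = - (T *m B^T) ->
  br_12_23 br (A *m T) (B *m T) a b c = - op1 A (op3 B Z) (a, b, c).
Proof.
move=> BT; rewrite /br_12_23 opE -sumrN.
transitivity (\sum_p \sum_q A a p * - (B c q * br_12_23 br T T p b q)); last first.
  apply: eq_bigr => p _; rewrite opE mulr_sumr -sumrN; apply: eq_bigr => q _.
  by rewrite Z_tensorE mulrN.
transitivity (\sum_i \sum_j \sum_p \sum_q str_cst br b i j *: (A a p * - (B c q *
  (T p i * T j q)))).
  apply: eq_bigr => i _; apply: eq_bigr => j _.
  rewrite BT [X in X * _]mxE [X in _ * X]mxE mulr_suml scaler_sumr.
  apply: eq_bigr => p _; rewrite [(_ *m B^T) _ _]mxE -sumrN mulr_sumr scaler_sumr;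
    apply: eq_bigr => q _.
  by congr (_ *: _); rewrite ![(_^T) _ _]mxE; ring.
rewrite /br_12_23; under eq_bigr => i _ do rewrite exchange_big /=.
rewrite exchange_big /=; apply: eq_bigr => p _.
under eq_bigr => i _ do rewrite exchange_big /=.
rewrite exchange_big /=; apply: eq_bigr => q _.
rewrite !mulr_sumr -sumrN mulr_sumr; apply: eq_bigr => i _.
rewrite !mulr_sumr -sumrN mulr_sumr; apply: eq_bigr => j _.
by rewrite !symCE; ring.
Qed.

Lemma CYB_mrho k a b c : CYB br mrho k a b c = - (symC L (v * v) *
  (\sum_(i < k.+1) (op2 (mR mY i) (op3 (mR mY (k - i)%N) Z)
    + op1 (mR mY i) (op3 (mR mY (k - i)%N) Z)
    + op1 (mR mY i) (op2 (mR mY (k - i)%N) Z))) (a, b, c)).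
Proof.
rewrite sum_ffunE mulr_sumr -sumrN; apply: eq_bigr => i _.
rewrite /mrho br_12_13Z br_12_23Z br_13_23Z -symCM.
rewrite (br_12_13_op _ _ _ (mR_anti _) (mR_anti _)) (br_12_23_op _ _ _ _ (mR_anti _)).
by rewrite br_13_23_op ![(_ + _ : tensor3 _ _ _) _]ffunE; ring.
Qed.

Lemma mY_Z : op1 mY Z + op2 mY Z + op3 mY Z = 0.
Proof.
apply/ffunP => p; rewrite ![(_ + _ : tensor3 _ _ _) _]ffunE [RHS]ffunE mYE.
rewrite op1_lincomb op2_lincomb op3_lincomb -!big_split big1 //= => i _.
have := congr1 (fun w : tensor3 K d n => w p) (ad_Z l g_lie t_inv (vsval (bvec i : L))).
rewrite ![(_ + _ : tensor3 _ _ _) _]ffunE [X in _ = X]ffunE => E.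
by rewrite -!mulrDr E mulr0.
Qed.

(** * Components of [Z] along the splitting *)

Definition mP (b : bool) : W := if b then mPl else mPu.

Definition Zcomp (b1 b2 b3 : bool) : tensor3 K d n :=
  op1 (mP b1) (op2 (mP b2) (op3 (mP b3) Z)).

Let o1M (A B : W) w : op1 A (op1 B w) = op1 (A *m B) w.
Proof. by case: (slot_op1 K d n) => _ _ _ ->. Qed.
Let o2M (A B : W) w : op2 A (op2 B w) = op2 (A *m B) w.
Proof. by case: (slot_op2 K d n) => _ _ _ ->. Qed.
Let o3M (A B : W) w : op3 A (op3 B w) = op3 (A *m B) w.
Proof. by case: (slot_op3 K d n) => _ _ _ ->. Qed.

Let mP_id b : mP b *m mP b = mP b.
Proof. by case: b; [exact: mPl_id | exact: mPu_id]. Qed.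

Let mY_mP b : mY *m mP b = mP b *m mY.
Proof. by case: b; [exact: mYPl | exact: mYPu]. Qed.

Lemma Zcomp1 b1 b2 b3 : op1 (mP b1) (Zcomp b1 b2 b3) = Zcomp b1 b2 b3.
Proof. by rewrite /Zcomp o1M mP_id. Qed.
Lemma Zcomp2 b1 b2 b3 : op2 (mP b2) (Zcomp b1 b2 b3) = Zcomp b1 b2 b3.
Proof. by rewrite /Zcomp -op12C o2M mP_id. Qed.
Lemma Zcomp3 b1 b2 b3 : op3 (mP b3) (Zcomp b1 b2 b3) = Zcomp b1 b2 b3.
Proof. by rewrite /Zcomp -op13C -op23C o3M mP_id. Qed.

Lemma mY_Zcomp b1 b2 b3 (w := Zcomp b1 b2 b3) :
  op1 mY w + op2 mY w + op3 mY w = 0.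
Proof.
have -> : op1 mY w = op1 (mP b1) (op2 (mP b2) (op3 (mP b3) (op1 mY Z))).
  by rewrite /w /Zcomp o1M mY_mP -o1M -op13C -op12C.
have -> : op2 mY w = op1 (mP b1) (op2 (mP b2) (op3 (mP b3) (op2 mY Z))).
  by rewrite /w /Zcomp -op12C o2M mY_mP -o2M -op23C.
have -> : op3 mY w = op1 (mP b1) (op2 (mP b2) (op3 (mP b3) (op3 mY Z))).
  by rewrite /w /Zcomp -op13C -op23C o3M mY_mP -o3M.
by rewrite -!linearD mY_Z !linear0.
Qed.

Lemma trot_Zcomp b1 b2 b3 : trot (Zcomp b1 b2 b3) = Zcomp b3 b1 b2.
Proof.
by rewrite /Zcomp trot_op1 trot_op2 trot_op3 (Z_rot l g_lie t_inv) op12C -op13C.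
Qed.

Let extN x := - ext_C l C x.
Let extN_linear : linear extN.
Proof. by move=> a x y; rewrite /extN CL opprD scalerN. Qed.
Let mC_Tcst : mC *m T = T *m (cst extN)^T.
Proof. by rewrite mC_T mx_ofN mxCN. Qed.

Let Zop A B D BX DX := @Z_contr_op K g br l t g_lie t_inv A B D BX DX.

(** The projections are self-adjoint for [t], so slots 2 and 3 in [l] make slot 1 a bracket of two
    elements of the subalgebra [l]. *)
Lemma Zcomp_ull : Zcomp false true true = 0.
Proof.
rewrite /Zcomp (Zop PuL PlL PlL mPl_Ttr mPl_Ttr) -[RHS]oppr0; congr (- _).
rewrite -(contr0 l t); apply: contr_ext => x y.
by rewrite (pr_u_l g_split) // (br_ll g_split) ?pr_l_mem.
Qed.
Lemma Zcomp_lul : Zcomp true false true = 0.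
Proof. by rewrite -trot_Zcomp Zcomp_ull trot0. Qed.
Lemma Zcomp_llu : Zcomp true true false = 0.
Proof. by rewrite -trot_Zcomp Zcomp_lul trot0. Qed.

(** [C] in slot 3 enters the bracket as [- C]. The other argument lies in [l], so [l]-linearity
    pulls [C] out of the bracket, into slot 1. *)
Lemma mC_Zcomp_ulu (w := Zcomp false true false) : op3 mC w + op1 mC w = 0.
Proof.
have -> : op3 mC w = op1 mPu (op2 mPl (op3 mC Z)).
  by rewrite /w /Zcomp -op13C -op23C o3M mCPu.
have -> : op1 mC w = op1 mC (op2 mPl (op3 mPu Z)).
  by rewrite /w /Zcomp o1M mCPu.
rewrite (Zop PuL PlL extN_linear mPl_Ttr mC_Tcst) (Zop CL PlL PuL mPl_Ttr mPu_Ttr).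
rewrite -!contrN -contrD -(contr0 l t); apply: contr_ext => x y.
have prN : pr_u l u (extN y) = extN y by rewrite (pr_uE g_split) // rpredN ext_C_mem.
have xl := pr_l_mem l u x.
rewrite (pr_u_br g_lie g_split _ xl) prN (brNr g_lie) opprK.
by rewrite (ext_C_br g_lie g_split C_cayley _ xl) (ext_C_pr g_split) subrr.
Qed.

Lemma mC_Zcomp_uul (w := Zcomp false false true) : op1 mC w + op2 mC w = 0.
Proof.
by rewrite /w -trot_Zcomp -trot_op3 -trot_op1 -trotD mC_Zcomp_ulu trot0.
Qed.

Lemma mC_Zcomp_luu (w := Zcomp true false false) : op2 mC w + op3 mC w = 0.
Proof.
by rewrite /w -trot_Zcomp -trot_op1 -trot_op2 -trotD mC_Zcomp_uul trot0.
Qed.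

(** [C] in slots 2 and 3 becomes [- C] on the arguments of the bracket, and what remains is the
    Cayley equation for these arguments. *)
Lemma mC_Zcomp_uuu (w := Zcomp false false false) :
  op1 mC (op2 mC w) + op2 mC (op3 mC w) + op3 mC (op1 mC w) + w = 0.
Proof.
have -> : op1 mC (op2 mC w) = op1 mC (op2 mC (op3 mPu Z)).
  by rewrite /w /Zcomp -op12C o2M o1M !mCPu.
have -> : op2 mC (op3 mC w) = op1 mPu (op2 mC (op3 mC Z)).
  by rewrite /w /Zcomp -op13C -op23C o3M -op12C o2M !mCPu.
have -> : op3 mC (op1 mC w) = op1 mC (op2 mPu (op3 mC Z)).
  by rewrite /w /Zcomp o1M -op13C -op23C o3M !mCPu.
rewrite /w /Zcomp (Zop CL extN_linear PuL mC_Tcst mPu_Ttr).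
rewrite (Zop PuL extN_linear extN_linear mC_Tcst mC_Tcst).
rewrite (Zop CL PuL extN_linear mPu_Ttr mC_Tcst) (Zop PuL PuL PuL mPu_Ttr mPu_Ttr).
rewrite -!contrN -!contrD -(contr0 l t); apply: contr_ext => x y.
have CN z : ext_C l C (- z) = - ext_C l C z.
  by rewrite /ext_C /proj_along !linearN.
rewrite /extN !(brNl g_lie) !(brNr g_lie) !CN !opprK.
rewrite (ext_C_cayley C_cayley) opprB addrCA opprD addNKr subrK subrr //.
Qed.

Lemma cdybe_Zcomp b1 b2 b3 k (w := Zcomp b1 b2 b3) :
  cdybe_op I mY mC mPl mPu k w = (k == 0%N)%:R *: w.
Proof.
have w0 : w = 0 -> cdybe_op I mY mC mPl mPu k w = (k == 0%N)%:R *: w.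
  by move=> ->; rewrite cdybe_op0 scaler0.
have [w1 [w2 w3]] := conj (Zcomp1 b1 b2 b3) (conj (Zcomp2 b1 b2 b3) (Zcomp3 b1 b2 b3)).
have Yw := mY_Zcomp b1 b2 b3.
move: w0 w1 w2 w3 Yw; rewrite {}/w.
case: b1; case: b2; case: b3 => w0 w1 w2 w3 Yw.
- exact: (cdybe_op_lll I2 mYC mYPl mYPu mCPl mPlC mCPu mPuC mPlPu mPuPl Yw).
- exact/w0/Zcomp_llu.
- exact/w0/Zcomp_lul.
- exact: (cdybe_op_luu I2 mYC mYPl mYPu mCPl mPlC mCPu mPuC mPlPu mPuPl Yw)
  mC_Zcomp_luu.
- exact/w0/Zcomp_ull.
- exact: (cdybe_op_ulu I2 mYC mYPl mYPu mCPl mPlC mCPu mPuC mPlPu mPuPl Yw)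
  mC_Zcomp_ulu.
- exact: (cdybe_op_uul I2 mYC mYPl mYPu mCPl mPlC mCPu mPuC mPlPu mPuPl Yw)
  mC_Zcomp_uul.
- exact: (cdybe_op_uuu I2 mYC mYPl mYPu mCPl mPlC mCPu mPuC mPlPu mPuPl Yw)
  mC_Zcomp_uuu.
Qed.

Lemma op_split op w : slot_op op -> op mPl w + op mPu w = w.
Proof.
case=> _ opD _ _ opC; rewrite -opD mP_sum.
by have := opC 1 w; rewrite mpolyC1 scale1r.
Qed.

Lemma cdybe_Z k : cdybe_op I mY mC mPl mPu k Z = (k == 0%N)%:R *: Z.
Proof.
pose P w := cdybe_op I mY mC mPl mPu k w = (k == 0%N)%:R *: w.
have PD w w' : P w -> P w' -> P (w + w') by rewrite /P cdybe_opD scalerDr => -> ->.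
rewrite -/(P Z) -(op_split Z (slot_op3 K d n)); set w1 := op3 mPl Z.
set w2 := op3 mPu Z; rewrite -(op_split w1 (slot_op2 K d n)).
rewrite -(op_split w2 (slot_op2 K d n)) {}/w1 {}/w2.
apply: (PD); apply: (PD); set w := op2 _ _; rewrite -(op_split w (slot_op1 K d n));
  apply: (PD).
- exact: (cdybe_Zcomp true true true).
- exact: (cdybe_Zcomp false true true).
- exact: (cdybe_Zcomp true false true).
- exact: (cdybe_Zcomp false false true).
- exact: (cdybe_Zcomp true true false).
- exact: (cdybe_Zcomp false true false).
- exact: (cdybe_Zcomp true false false).
- exact: (cdybe_Zcomp false false false).
Qed.

Lemma cdybe_mrho k a b c :
  CYB br mrho k a b c + Alt (dform mrho k) a b c
  = if k == 0%N then - symC L (v * v) * br_12_23 br T T a b c else 0.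
Proof.
(* The other two terms of [Alt] are rotations of the first. As [Z] is invariant under rotation, only
   the slots of the operators change. *)
have d2 : d_mrho k (b, c, a) = op2 (mR 1 k.+1) (\sum_(i < k.+1)
    op2 (mY ^+ (k - i)) (op3 ((- mY) ^+ i) (op1 mPl Z))) (a, b, c).
  rewrite -[LHS](trotE _ a b c) trot_op1 trot_sum; congr (op2 _ _ _).
  apply: eq_bigr => i _.
  by rewrite trot_op1 trot_op2 trot_op3 (Z_rot l g_lie t_inv).
have d3 : d_mrho k (c, a, b) = op3 (mR 1 k.+1) (\sum_(i < k.+1)
    op3 (mY ^+ (k - i)) (op1 ((- mY) ^+ i) (op2 mPl Z))) (a, b, c).
  rewrite -[LHS](trotE _ b c a) -[LHS](trotE _ a b c) trot_op1 trot_op2 !trot_sum.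
  congr (op3 _ _ _); apply: eq_bigr => i _.
  by rewrite !(trot_op1, trot_op2, trot_op3) !(Z_rot l g_lie t_inv).
rewrite /Alt CYB_mrho !dform_mrho d2 d3.
have gen (E1 E2 E3 E4 : tensor3 K d n) (p := (a, b, c)) (x := symC L (v * v)) :
    E1 - (E2 + E3 + E4) = (k == 0%N)%:R *: Z ->
    - (x * E1 p) + (x * E2 p + x * E3 p + x * E4 p)
    = if k == 0%N then - x * br_12_23 br T T a b c else 0.
  move=> E; transitivity (- x * (E1 - (E2 + E3 + E4)) p); first by rewrite !ffunE; ring.
  rewrite {}E; case: (k == 0%N); first by rewrite scale1r Z_tensorE.
  by rewrite scale0r [X in _ * X]ffunE mulr0.
exact: gen (cdybe_Z k).
Qed.

Lemma mrho_anti k : (mrho k)^T = - mrho k.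
Proof.
rewrite /mrho linearZ /= trmx_mul Tsym -[RHS]scalerN; congr (_ *: _).
by rewrite mR_anti opprK.
Qed.

(** * Degrees in the symmetric algebra *)

Definition hom_mx (k p q : nat) (B : 'M[S]_(p, q)) : Prop :=
  forall i j, B i j \is k.-homog.
Arguments hom_mx k {p q} B.

Lemma hom_mxM k k' p q r (A : 'M[S]_(p, q)) (B : 'M[S]_(q, r)) :
  hom_mx k A -> hom_mx k' B -> hom_mx (k + k') (A *m B).
Proof.
by move=> hA hB i j; rewrite mxE; apply: rpred_sum => a _; apply: dhomogM.
Qed.

Lemma symC_homog c : symC L c \is 0.-homog.
Proof. by rewrite -[symC L c]mulr1 -symCE; apply: dhomogZ; apply: dhomog1. Qed.

Lemma hom_mx_const p q (B : 'M[K]_(p, q)) : hom_mx 0 (mxC L B).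
Proof. by move=> i j; rewrite mxCE; apply: symC_homog. Qed.

Lemma hom_mxZ k p q c (B : 'M[S]_(p, q)) : hom_mx k B -> hom_mx k (symC L c *: B).
Proof. by move=> hB i j; rewrite mxE -symCE; apply: dhomogZ; apply: hB. Qed.

Lemma lam_coef_homog i : lam_coef i \is 1.-homog.
Proof.
rewrite /lam_coef -symCE; apply: dhomogZ; apply: rpred_sum => j _; apply: dhomogZ.
by rewrite dhomogX /= mdeg1.
Qed.

Lemma hom_mY : hom_mx 1 mY.
Proof.
move=> a b; rewrite mYE summxE; apply: rpred_sum => i _; rewrite mxE.
by rewrite -[1%N]addn0; apply: dhomogM; [apply: lam_coef_homog | apply: hom_mx_const].
Qed.

Lemma hom_mYX k : hom_mx k (mY ^+ k).
Proof.
elim: k => [|k IH]; first by rewrite expr0 -[1]/(1%:M) -mxC1; apply: hom_mx_const.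
by rewrite exprS -add1n; apply: hom_mxM; [apply: hom_mY|].
Qed.

Lemma mrho_homog k : hom_mx k (mrho k).
Proof.
apply: hom_mxZ; rewrite -[k]addn0; apply: hom_mxM; last exact: hom_mx_const.
rewrite addn0 mR_hom; have [B0 ->] := mR_const k; rewrite -[k]add0n.
by apply: hom_mxM; [exact: hom_mx_const | exact: hom_mYX].
Qed.

(** * Invariance under [l] *)

Section Derivation.
Variable D : L -> L.

Lemma sym_derM (p q : S) : sym_der D (p * q) = sym_der D p * q + p * sym_der D q.
Proof.
rewrite /sym_der mulr_suml mulr_sumr -big_split; apply: eq_bigr => i _ /=.
by rewrite mderivM; ring.
Qed.

Lemma sym_derD (p q : S) : sym_der D (p + q) = sym_der D p + sym_der D q.
Proof.
rewrite /sym_der -big_split; apply: eq_bigr => i _ /=.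
by rewrite mderivD mulrDr.
Qed.

Lemma sym_derC c : sym_der D (symC L c) = 0.
Proof. by rewrite /sym_der big1 // => i _; rewrite mderivC mulr0. Qed.

Lemma sym_der0 : sym_der D 0 = 0.
Proof. by rewrite -(symC0 L) sym_derC. Qed.

Lemma sym_derN (p : S) : sym_der D (- p) = - sym_der D p.
Proof. by apply/eqP; rewrite -addr_eq0 -sym_derD addNr sym_der0. Qed.

Lemma sym_der_sum m (F : 'I_m -> S) :
  sym_der D (\sum_i F i) = \sum_i sym_der D (F i).
Proof. exact: (big_morph _ sym_derD sym_der0). Qed.

Lemma sym_derX (p : 'I_d) :
  sym_der D ('X_p : S) = \sum_q symC L (mx_of D q p) * 'X_q.
Proof.
rewrite /sym_der (bigD1 p) //= big1 ?addr0 => [|i ip]; last first.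
  by rewrite mderiv_var (negPf ip) mulr0.
rewrite mderiv_var eqxx mulr1 /sym1.
by apply: eq_bigr => q _; rewrite symCE mxE.
Qed.

Definition mx_der p q (B : 'M[S]_(p, q)) : 'M[S]_(p, q) := map_mx (sym_der D) B.

Lemma mx_derM p q r (A : 'M[S]_(p, q)) (B : 'M[S]_(q, r)) :
  mx_der (A *m B) = mx_der A *m B + A *m mx_der B.
Proof.
apply/matrixP => a b; rewrite !mxE sym_der_sum -big_split.
by apply: eq_bigr => j _ /=; rewrite sym_derM !mxE.
Qed.

Lemma mx_derC p q (B : 'M[K]_(p, q)) : mx_der (mxC L B) = 0.
Proof. by apply/matrixP => a b; rewrite !mxE sym_derC. Qed.

Lemma mx_derD p q (A B : 'M[S]_(p, q)) : mx_der (A + B) = mx_der A + mx_der B.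
Proof. by apply/matrixP => a b; rewrite !mxE sym_derD. Qed.

Lemma mx_derN p q (A : 'M[S]_(p, q)) : mx_der (- A) = - mx_der A.
Proof. by apply/matrixP => a b; rewrite !mxE sym_derN. Qed.

Lemma mx_derZ c p q (B : 'M[S]_(p, q)) :
  mx_der (symC L c *: B) = symC L c *: mx_der B.
Proof. by apply/matrixP => a b; rewrite !mxE sym_derM sym_derC mul0r add0r. Qed.

End Derivation.

Section LInvariance.
Variable z : L.
Local Notation adz := (cst (br (vsval z))).
Local Notation D := (ad_l br u z).

Lemma ad_l_val x : vsval (D x) = br (vsval z) (vsval x).
Proof.
rewrite /ad_l (val_proj_l) (pr_lE g_split) // (br_ll g_split) //; exact: subvsP.
Qed.

(** The invariance of [t] is projected to [l (x) l], where the [u] part of [t] disappears. *)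
Lemma ad_tl : mx_of D *m tl + tl *m (mx_of D)^T = 0.
Proof.
pose pL := mx_of (proj_along l u : g -> L).
have pLL : linear (proj_along l u) by move=> a x y; rewrite /proj_along !linearP.
have pLi : pL *m iL = 1%:M.
  rewrite -mx_of_comp // -mx_of_id; apply: mx_of_ext => x /=; apply: val_inj.
  by rewrite /= val_proj_l (pr_lE g_split) // subvsP.
have pLu : pL *m iU = 0.
  rewrite -mx_of_comp // -(mx_of_0 U L); apply: mx_of_ext => x /=; apply: val_inj.
  by rewrite /= val_proj_l (pr_l_u g_split) ?linear0 // subvsP.
have pLad : pL *m mx_of (br (vsval z)) *m iL = mx_of D.
  by rewrite -mulmxA -!mx_of_comp.
have tp : t *m pL^T = iL *m tl.
  rewrite t_dec /tmap2 mulmxDl -!mulmxA -!trmx_mul pLi pLu trmx1 trmx0.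
  by rewrite !mulmx0 addr0 mulmx1.
have pt : pL *m t = tl *m iL^T.
  have t_sym : t^T = t by case: t_inv.
  by rewrite -[LHS]trmxK trmx_mul t_sym tp trmx_mul tl_sym.
case: t_inv => _ /(_ (vsval z)); rewrite /tder2 => /(congr1 (fun B => pL *m B *m pL^T)).
rewrite mulmx0 mul0mx mulmxDr mulmxDl => E; rewrite -[RHS]E -pLad; congr (_ + _).
  by rewrite -!mulmxA tp !mulmxA.
by rewrite [in RHS]mulmxA pt !trmx_mul !mulmxA.
Qed.

Lemma cst_br_val (x : L) : cst (br (vsval x))
  = \sum_j symC L (crd j x) *: cst (br (vsval (bvec j : L))).
Proof.
apply/matrixP => a b; rewrite summxE mxCE mxE.
have fL : linear (fun x : L => br (vsval x) (bvec b)).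
  by move=> c y y'; rewrite linearP (lie_linl g_lie).
rewrite (crd_linear fL a x) symC_sum; apply: eq_bigr => j _.
by rewrite mxE mulrC symCM [RHS]mxE !mxE.
Qed.

(** As an element of [l (x) S^1(l)], [lambda^vee] is [t_l] itself, so its invariance is that of
    [t_l]. *)
Lemma lam_coef_linv j :
  \sum_i lam_coef i * symC L (mx_of D j i) + sym_der D (lam_coef j) = 0.
Proof.
transitivity (symC L v * \sum_q symC L ((mx_of D *m tl
  + tl *m (mx_of D)^T) q j) * 'X_q).
  rewrite /lam_coef sym_derM sym_derC mul0r add0r /lam_vee sym_der_sum.
  under eq_bigr do rewrite mulr_sumr mulr_suml.
  rewrite exchange_big /= [RHS]mulr_sumr.
  transitivity (\sum_q symC L v * (symC L ((tl *m (mx_of D)^T) q j) * 'X_q)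
     + \sum_q symC L v * (symC L ((mx_of D *m tl) q j) * 'X_q)).
    congr (_ + _).
      apply: eq_bigr => q _; rewrite mxE symC_sum mulr_suml mulr_sumr.
      apply: eq_bigr => i _; rewrite symCE symCM [(_^T) _ _]mxE; ring.
    rewrite -mulr_sumr; congr (_ * _).
    under eq_bigr => p _ do rewrite symCE sym_derM sym_derC mul0r add0r sym_derX
      mulr_sumr.
    rewrite exchange_big /=; apply: eq_bigr => q _; rewrite mxE symC_sum mulr_suml.
    by apply: eq_bigr => p _; rewrite symCM; ring.
  rewrite -big_split; apply: eq_bigr => q _ /=.
  by rewrite [in RHS]mxE symCD; ring.
by rewrite ad_tl big1 ?mulr0 // => q _; rewrite mxE symC0 mul0r.
Qed.

Lemma ad_comm x : adz *m cst (br (vsval x)) - cst (br (vsval x)) *m adz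
  = cst (br (vsval (D x))).
Proof.
rewrite !cst_comp // -mxCN -mx_ofN -mxCD -mx_ofD; apply: cst_ext => y /=.
by rewrite ad_l_val (br_der g_lie) addrK.
Qed.

Lemma mY_linv : adz *m mY - mY *m adz + mx_der D mY = 0.
Proof.
rewrite mYE mulmx_sumr mulmx_suml -sumrB.
transitivity (\sum_j (\sum_i lam_coef i * symC L (mx_of D j i) + sym_der D (lam_coef j))
    *: cst (br (vsval (bvec j : L)))); last first.
  by rewrite big1 // => j _; rewrite lam_coef_linv scale0r.
under [RHS]eq_bigr do rewrite scalerDl scaler_suml.
rewrite [RHS]big_split /= [in RHS]exchange_big /=; congr (_ + _).
  apply: eq_bigr => i _; rewrite -scalemxAr -scalemxAl -scalerBr ad_comm cst_br_val.
  by rewrite scaler_sumr; apply: eq_bigr => j _; rewrite scalerA mxE.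
apply/matrixP => a b; rewrite mxE !summxE sym_der_sum; apply: eq_bigr => j _.
by rewrite [in LHS]mxE [RHS]mxE sym_derM mxCE sym_derC mulr0 addr0.
Qed.

Lemma mR_linv k : adz *m mR mY k - mR mY k *m adz + mx_der D (mR mY k) = 0.
Proof.
have const_linv (f : g -> g) : linear f -> (forall y,
  br (vsval z) (f y) = f (br (vsval z) y)) ->
    adz *m cst f - cst f *m adz + mx_der D (cst f) = 0.
  move=> fL fz; rewrite !cst_comp // mx_derC addr0; apply/eqP; rewrite subr_eq0.
  by apply/eqP/cst_ext => y /=.
have zl : vsval z \in l := subvsP z.
rewrite /mR; apply: (@rel_r_ser _ W W sc sc I
  (fun B _ => adz * B - B * adz + mx_der D B = 0) mC mC mPl mPl mPu mPu mY mY).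
- have := mx_derC D (0 : 'M[K]_n); rewrite mxC0 => ->.
  by rewrite mulr0 mul0r subrr add0r.
- have := mx_derC D (1%:M : 'M[K]_n); rewrite mxC1 => ->.
  by rewrite mulr1 mul1r subrr add0r.
- by move=> B _ B' _ E E'; rewrite mx_derD; exact: der_relD.
- by move=> B _ E; rewrite mx_derN; exact: der_relN.
- by move=> B _ B' _ E E'; rewrite (mx_derM D B B'); exact: der_relM.
- move=> c; rewrite scal_mx_comm subrr add0r /scal_mx.
  apply/matrixP => a b; rewrite !mxE; case: eqP => _; last exact: sym_der0.
  exact: sym_derC.
- by apply: const_linv => // y; rewrite (ext_C_br g_lie g_split C_cayley).
- by apply: const_linv => // y; rewrite (pr_l_br g_lie g_split).
- by apply: const_linv => // y; rewrite (pr_u_br g_lie g_split).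
- exact: mY_linv.
Qed.

End LInvariance.

Lemma mrho_linv : l_invariant br u mrho.
Proof.
move=> z k; pose D := ad_l br u z; pose adz := cst (br (vsval z)).
rewrite -[map_mx _ _]/(mx_der D (mrho k)) -/adz.
have -> : mx_der D (mrho k) = symC L v *: (mx_der D (mR mY k) *m T).
  by rewrite mx_derZ mx_derM mx_derC mulmx0 addr0.
(* This turns the action on the second factor of [g (x) g] into right multiplication of [mR],
   leaving a commutator with [adz]. *)
have Tad : T *m adz^T = - (adz *m T).
  by rewrite (ad_T l t_inv) mx_ofN mxCN linearN /= mulmxN opprK.
rewrite /mrho -scalemxAr -scalemxAl -!scalerDr -mulmxA Tad mulmxN !mulmxA.
by rewrite -mulmxBl -mulmxDl mR_linv mul0mx scaler0.
Qed.

(** * Identification with [rho_Cc] *)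

Local Notation m := (\dim {:U}).
Local Notation CU := (mxC L (mx_of C)).

Definition mYU : 'M[S]_m :=
  symC L v *: act_lam_vee (fun (x : L) (y : U) => ad_u br x y) tl.

Lemma mY_iU : mY *m mxC L iU = mxC L iU *m mYU.
Proof.
rewrite mYE /mYU /act_lam_vee scaler_sumr mulmx_suml mulmx_sumr.
apply: eq_bigr => i _; rewrite scalerA -scalemxAl -scalemxAr -!mxCM;
  congr (_ *: mxC _ _).
rewrite -!mx_of_comp //; apply: mx_of_ext => y /=.
by rewrite /ad_u val_proj_u (pr_uE g_split) // (br_lu g_split) // subvsP.
Qed.

(** The inclusion of [u] intertwines [C] and [Y] with their versions on [g], and intertwining is
    stable under ring operations; so the quotient on [g] restricts to the one on [u]. *)
Lemma quo_iU k : cayley_quo sc I mC mY k *m mxC L iU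
  = mxC L iU *m cayley_quo (@scal_mx K d m) I CU mYU k.
Proof.
apply: (@fps_rel_cayley_quo W 'M[S]_m
  (fun B B' => B *m mxC L iU = mxC L iU *m B')) => //.
- by rewrite mul0mx mulmx0.
- by rewrite [LHS]mul1mx [RHS]mulmx1.
- by move=> a a' b b' ea eb; rewrite mulmxDl mulmxDr ea eb.
- by move=> a a' ea; rewrite mulNmx mulmxN ea.
- by move=> a a' b b' ea eb; rewrite -mulmxA eb mulmxA ea mulmxA.
- by move=> a; rewrite mul_scalar_mx mul_mx_scalar.
- rewrite -!mxCM -!mx_of_comp //; congr (mxC _ _); apply: mx_of_ext => y /=.
  by rewrite (ext_C_val g_split).
- exact: mY_iU.
Qed.

Lemma scal_mxM c p (B : 'M[S]_(n, p)) : sc c *m B = symC L c *: B.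
Proof. exact: mul_scalar_mx. Qed.

Lemma mrho_expand k : mrho k = symC L v *:
  (symC L (cot_reg_fps K k) *: (mY ^+ k *m mxC L (tmap2 (vsval : L -> g) tl))
   + symC L I *: (mxC L iU
       *m (cayley_quo (@scal_mx K d m) I CU mYU k *m mxC L tu) *m (mxC L iU)^T)).
Proof.
pose X := cayley_quo sc I mC mY k.
have E : mR mY k = symC L (cot_reg_fps K k) *: (mY ^+ k *m mPl)
    + symC L I *: (X *m mPu).
  transitivity ((sc (cot_reg_fps K k) *m mY ^+ k) *m mPl + (sc I *m X) *m mPu).
    by [].
  by rewrite (scal_mxM _ (mY ^+ k)) (scal_mxM _ X) -!scalemxAl.
have El (a : S) (B : W) : (a *: (B *m mPl)) *m T
    = a *: (B *m mxC L (tmap2 (vsval : L -> g) tl)).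
  by rewrite -scalemxAl -(mulmxA B) mPl_T.
have Eu (a : S) (B : W) : (a *: (B *m mPu)) *m T
    = a *: (B *m mxC L (tmap2 (vsval : U -> g) tu)).
  by rewrite -scalemxAl -(mulmxA B) mPu_T.
rewrite /mrho E mulmxDl; congr (_ *: _); congr (_ + _); first exact: El.
transitivity (symC L I *: (X *m mxC L (tmap2 (vsval : U -> g) tu))); first exact: Eu.
congr (_ *: _); rewrite /tmap2 !mxCM -mxCT 2!mulmxA quo_iU.
by rewrite -!(mulmxA (mxC L iU)).
Qed.

End RMatrixAlgebra.

Lemma scale_mxX (S : comPzRingType) n (c : S) (B : 'M[S]_n) k :
  (c *: B) ^+ k = c ^+ k *: B ^+ k.
Proof.
elim: k => [|k IH]; first by rewrite !expr0 scale1r.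
rewrite !exprS IH -[(c *: B) * _]/((c *: B) *m _) -scalemxAl -scalemxAr.
by rewrite scalerA.
Qed.

(** With [a] equal to [pi] and [b] a coefficient of [cot_reg_fps], this is
    [c f(c ad) = pi c (cot Y - 1 / Y)] for [Y = pi c ad]. *)
Lemma scale_mx_power (K : fieldType) (L : vectType K) n (a b c : K)
  (B : 'M[sym L]_n) k :
  symC L c *: (symC L (a ^+ k.+1 * b) *: (symC L c *: B) ^+ k)
  = symC L (a * c * b) *: (symC L (a * c) *: B) ^+ k.
Proof.
have symCX x : symC L x ^+ k = symC L (x ^+ k).
  exact: esym (rmorphXn (@mpolyC _ K) k x).
rewrite !scale_mxX !scalerA !symCX -!symCM; congr (symC _ _ *: _).
by rewrite exprMn exprS; ring.
Qed.

Lemma scale_combination (K : fieldType) (L : vectType K) n (p c b x : K)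
    (Y T B : 'M[sym L]_n) :
  (symC L (p * c * b) *: Y) *m T + symC L (x * p * c) *: B
  = symC L (p * c) *: (symC L b *: (Y *m T) + symC L x *: B).
Proof.
have -> : x * p * c = p * c * x by ring.
by rewrite ![symC L (p * c * _)]symCM scalerDr !scalerA -scalemxAl.
Qed.

Section Realization.
Variables (R : realType) (g : vectType R[i]) (br : g -> g -> g).
Variables (l u : {vspace g}).
Variables (tl : 'M[R[i]]_(\dim {:subvs_of l})).
Variables (tu : 'M[R[i]]_(\dim {:subvs_of u})).
Variables (C : 'End(subvs_of u)) (c : R[i]).
Local Notation L := (subvs_of l).
Local Notation v := (piC R * c).

Lemma cf_adE k : cf_ad br tl c k = symC L (v * cot_reg_fps R[i] k) *: mY v br tl ^+ k.
Proof. exact: scale_mx_power. Qed.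

Lemma itan_adE : itan_ad br u tl c
  = itan (@scal_mx R[i] (\dim {:L}) (\dim {:subvs_of u})) 'i%C (mYU v br u tl).
Proof.
apply: boolp.funext => k; rewrite /itan_ad /fps_subst /itan /fps_sub_at /hom_ser.
rewrite -[_ * mYU _ _ _ _ ^+ k]/(_ *m _) -[RHS]/(_ *m _).
by rewrite (mul_scalar_mx (symC L 'i%C)) (mul_scalar_mx (symC L (tan_fps R[i] k))).
Qed.

Lemma cayley_quotientE k : cayley_quotient br tl C c k
  = cayley_quo (@scal_mx R[i] (\dim {:L}) (\dim {:subvs_of u})) 'i%C
      (mxC L (mx_of C)) (mYU v br u tl) k.
Proof. by rewrite /cayley_quotient itan_adE. Qed.

Lemma rho_CcE (t : 'M[R[i]]_(\dim {:g})) k :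
  lie_bracket br -> lie_splitting br l u ->
  t = tmap2 (vsval : L -> g) tl + tmap2 (vsval : subvs_of u -> g) tu ->
  rho_Cc br tl tu C c k = mrho 'i%C v br t tl C k.
Proof.
move=> g_lie g_split t_dec; rewrite (mrho_expand _ _ C g_lie g_split t_dec).
have E1 := cf_adE k; have E2 := cayley_quotientE k.
rewrite /rho_Cc E1 E2; exact: scale_combination.
Qed.

End Realization.

Theorem proposition0p4
  (R : realType) (g : vectType R[i]) (br : g -> g -> g)
  (l u : {vspace g})
  (t : 'M[R[i]]_(\dim {:g}))
  (tl : 'M[R[i]]_(\dim {:subvs_of l}))
  (tu : 'M[R[i]]_(\dim {:subvs_of u}))
  (C : 'End(subvs_of u)) (c : R[i])
  (g_lie : lie_bracket br)
  (g_split : lie_splitting br l u)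
  (t_inv : inv_sym2 br t)
  (tl_sym : tl^T = tl)
  (tu_sym : tu^T = tu)
  (t_dec : t = tmap2 (vsval : subvs_of l -> g) tl
               + tmap2 (vsval : subvs_of u -> g) tu)
  (C_cayley : cayley_endo br l C)
  (C_anti : tder2 C tu = 0) :
  let rho := rho_Cc br tl tu C c in
  [/\ formal_fun rho,
      forall k, (rho k)^T = - rho k,
      l_invariant br u rho &
      forall (k : nat) (i1 i2 i3 : 'I_(\dim {:g})),
        CYB br rho k i1 i2 i3 + Alt (dform rho k) i1 i2 i3
        = if k == 0%N
          then symC (subvs_of l) (- (piC R ^+ 2 * c ^+ 2))
               * br_12_23 br (mxC (subvs_of l) t) (mxC (subvs_of l) t) i1 i2 i3
          else 0].
Proof.
have i2 : 'i%C * 'i%C = -1 :> R[i] by rewrite -expr2 sqr_i.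
move=> rho; have -> : rho = mrho 'i%C (piC R * c) br t tl C.
  by apply: boolp.funext => k; apply: rho_CcE.
split.
- exact: mrho_homog g_lie g_split C_cayley.
- exact: mrho_anti g_lie g_split t_inv tl_sym tu_sym t_dec C_cayley C_anti.
- exact: mrho_linv g_lie g_split t_inv tl_sym t_dec C_cayley.
- move=> k i1 i3 i4.
  rewrite (cdybe_mrho i2 _ g_lie g_split t_inv tl_sym tu_sym t_dec C_cayley C_anti).
  by rewrite symCN -exprMn expr2.
Qed.
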